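(* There exists $n_0$ such that for all $n\ge n_0$: $$\mathrm{ex}(n,\mathbf D)=\mathrm{ex}(n,\mathbf B\mathbf D)=\begin{cases}\dfrac{n(n-1)}{3} & \text{if } n\equiv1,4 \pmod{12},\\[4pt] \dfrac{n(n-1)}{3}-4 & \text{if } n\equiv 7,10\pmod{12},\\[4pt] \dfrac{n(n-2)}{3} & \text{if } n\equiv 0,2,3,8\pmod{12},\\[4pt] \dfrac{n(n-2)}{3}-1 & \text{if } n\equiv5,11\pmod{12},\end{cases}$$ and $$\mathrm{ex}(n,\mathbf D)=\frac{n(n-2)}{3}\quad\text{and}\quad \mathrm{ex}(n,\mathbf B\mathbf D)=\frac{n(n-2)}{3}-1\quad\text{if } n\equiv6,9\pmod{12}.$$ Moreover, without the requirement $n\ge n_0$, the indicated quantities are always valid as upper bounds (for $\mathrm{ex}(n,\mathbf D)$ and $\mathrm{ex}(n,\mathbf B\mathbf D)$, respectively), and they are the exact values for all $n\equiv 0,1,3,4\pmod{12}$.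
   Context: A triple system on a finite vertex set $V$, $|V|=n$ ($n\ge1$), is a family of distinct $3$-element subsets (triples) of $V$. We write $123$ for $\{1,2,3\}$ etc. $\mathbf B=\{125,134,234\}$ and $\mathbf D=\{123,134,235\}$ (each on the vertex set $\{1,\dots,5\}$). A triple system contains a configuration if some of its triples form a system isomorphic to it (not necessarily induced). $\mathrm{ex}(n,X_1\dots X_k)$ denotes the maximum number of triples in a triple system on $n$ vertices that contains none of the configurations $X_1,\dots,X_k$. *)

(* Defs.v *)
From mathcomp Require Import all_boot.

Set Implicit Arguments.
Unset Strict Implicit.
Unset Printing Implicit Defensive.

Definition triple_system (V : finType) (H : {set {set V}}) : bool :=
  [forall e in H, #|e| == 3].

(* The vertices are labelled 1, ..., 5, the label i being the ordinal i.-1 of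
   'I_5.  *)
Definition triple5 (a b c : nat) : {set 'I_5} :=
  [set inord a.-1; inord b.-1; inord c.-1].

Definition confB : {set {set 'I_5}} :=
  [set triple5 1 2 5; triple5 1 3 4; triple5 2 3 4].

Definition confD : {set {set 'I_5}} :=
  [set triple5 1 2 3; triple5 1 3 4; triple5 2 3 5].

(* H has a subfamily isomorphic to F, not necessarily induced: the image of F
   under an injection of the five vertices is contained in H.  Both confB and
   confD use all five vertices, so no spare vertex is imposed on H.  *)
Definition contains (V : finType) (H : {set {set V}})
    (F : {set {set 'I_5}}) : bool :=
  [exists f : {ffun 'I_5 -> V},
     injectiveb f && [forall e in F, f @: e \in H]].

Definition avoids (V : finType) (H : {set {set V}})
    (Fs : seq {set {set 'I_5}}) : bool :=
  all (fun F => ~~ contains H F) Fs.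

(* The maximum is over a nonempty family: the empty system is admissible for
   Fs = [:: confD] and Fs = [:: confB; confD].  *)
Definition ex_num (n : nat) (Fs : seq {set {set 'I_5}}) : nat :=
  \max_(H : {set {set 'I_n}} | triple_system H && avoids H Fs) #|H|.

(* In the two formulas below all divisions by 3 are exact, and for n >= 1 no
   subtraction that is reached is truncated.  The last branch is n = 6, 9
   modulo 12.  *)
Definition valueD (n : nat) : nat :=
  let r := n %% 12 in
  if r \in [:: 1; 4] then n * (n - 1) %/ 3
  else if r \in [:: 7; 10] then n * (n - 1) %/ 3 - 4
  else if r \in [:: 0; 2; 3; 8] then n * (n - 2) %/ 3
  else if r \in [:: 5; 11] then n * (n - 2) %/ 3 - 1
  else n * (n - 2) %/ 3.

Definition valueBD (n : nat) : nat :=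
  let r := n %% 12 in
  if r \in [:: 1; 4] then n * (n - 1) %/ 3
  else if r \in [:: 7; 10] then n * (n - 1) %/ 3 - 4
  else if r \in [:: 0; 2; 3; 8] then n * (n - 2) %/ 3
  else if r \in [:: 5; 11] then n * (n - 2) %/ 3 - 1
  else n * (n - 2) %/ 3 - 1.

(* Main.v *)
Require Import Defs.
From mathcomp Require Import all_boot.
From mathcomp Require Import zify.

Set Implicit Arguments.
Unset Strict Implicit.
Unset Printing Implicit Defensive.

(* Upper bounds.  The configuration confD is a tight path on five vertices, so
   a triple system avoids it iff no link contains a path with three edges,
   i.e. iff the components of every link are triangles and stars (isolated
   vertices included).  If s(v) counts the stars of the link of v, then
   3 |H| = n (n - 1) - sum_v s(v).  Now s(v) > 0 unless 3 divides n - 1; parity,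
   counting of complete quadruples and, for n = 7, 10 modulo 12, a short analysis
   of the pairs outside the complete quadruples give the exact values.

   Lower bounds.  All triples in the blocks of a partial linear space with blocks
   of size at most 4 avoid both configurations, so group divisible designs with
   block size 4 are needed.  Wilson's fundamental construction applied to
   transversal designs gives type 3^s for all s = 0, 1 modulo 4, and the types
   2^s, 5^1 2^s, 6^1 3^s and 30^1 3^s for all large admissible s.  The part of
   size 6 is filled with a quadruple and a book, that of size 30 with triangles,
   one point being in four of them, and the part of size 31 (after adding a
   point) with a packing whose uncovered pairs form a triangular prism. *)

(** * Decompositions into complete quadruples *)

(** The upper bounds dictate the constructions, because the size asked for fixes the sum of all
    s(v). One star at every vertex gives n (n - 2) / 3; on the part of size 6 the quadruple with its
    book achieves this, but contains [confB]. The correction -1 means a sum of n + 3: a quadruple in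
    a part of size 5 leaves one point with four stars, and so do four triples through one point
    among 30. The correction -4 means a sum of 12: each of the six vertices of the prism has two
    stars, the edge of its triangle and its third neighbour. A component that is K_4 minus a triple
    is the obstacle to counting quadruples, since its pairs lie in a triangle of one link but not of
    the other. It is removed by passing to a maximum system or by a direct argument. Type 3^s serves
    n = 0, 1, 3, 4 modulo 12 for every n, so it needs a complete recursion. The other types are
    needed only for large n, and there one example in each residue class is enough. *)

Definition covers (T : eqType) (x y : T) : pred (seq T) :=
  fun b => (x \in b) && (y \in b).

(** Prescribing multiplicities instead of a graph makes decompositions additive, and no point set
    has to be carried along: it is read off from where [E] is positive. Diagonal values of [E] are
    ignored. *)
Definition design (T : eqType) (E : T -> T -> nat) (L : seq (seq T)) : Prop :=
  all uniq L /\ forall x y, x != y -> count (covers x y) L = E x y.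

Definition decomposable (T : eqType) (E : T -> T -> nat) : Prop :=
  exists2 L, design E L & all (fun b => size b == 4) L.

Lemma eq_decomposable (T : eqType) (E F : T -> T -> nat) :
  (forall x y, x != y -> E x y = F x y) -> decomposable E -> decomposable F.
Proof.
move=> EF [L [uL cL] sL]; exists L => //; split=> // x y xy.
by rewrite -EF // cL.
Qed.

Lemma decomposable0 (T : eqType) : decomposable (fun _ _ : T => 0).
Proof. by exists [::]. Qed.

Lemma decomposableD (T : eqType) (E F : T -> T -> nat) :
  decomposable E -> decomposable F -> decomposable (fun x y => E x y + F x y).
Proof.
move=> [L [uL cL] sL] [M [uM cM] sM]; exists (L ++ M).
  by split=> [|x y xy]; rewrite ?all_cat ?uL // count_cat cL // cM.
by rewrite all_cat sL.
Qed.

Lemma count_covers_gt0 (T : eqType) (L : seq (seq T)) (x y : T) b :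
  b \in L -> x \in b -> y \in b -> 0 < count (covers x y) L.
Proof. by move=> bL xb yb; rewrite -has_count; apply/hasP; exists b; rewrite /covers ?xb. Qed.

Lemma uniq_gt1_neq (T : eqType) (b : seq T) (x : T) :
  uniq b -> 1 < size b -> x \in b -> exists2 y, y \in b & x != y.
Proof.
case: b => [//|a [//|c b]] /andP[+ _] _ _; rewrite inE negb_or => /andP[ac _].
have [->|xa] := eqVneq x a; first by exists c; rewrite // !inE eqxx orbT.
by exists a; rewrite // inE eqxx.
Qed.

(** Blocks have four points, so each point of a block lies in a pair with [E] positive, hence in
    [P]; injectivity on [P] is then enough to transport the blocks. The hypothesis on pairs with [F]
    positive excludes pairs outside the image. *)
Lemma decomposable_img (S T : eqType) (P : pred S) (f : S -> T)
    (E : S -> S -> nat) (F : T -> T -> nat) :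
    {in P &, injective f} ->
    (forall x y, x != y -> 0 < E x y -> P x && P y) ->
    (forall x y, P x -> P y -> x != y -> F (f x) (f y) = E x y) ->
    (forall u v, u != v -> 0 < F u v ->
       exists x y, [/\ P x, P y, u = f x & v = f y]) ->
  decomposable E -> decomposable F.
Proof.
move=> injf EP FE Fim [L [uL cL] sL].
have LP b : b \in L -> {subset b <= P}.
  move=> bL x xb; have ub := allP uL _ bL.
  have [|y yb xy] := uniq_gt1_neq ub _ xb; first by rewrite (eqP (allP sL _ bL)).
  have := count_covers_gt0 bL xb yb; rewrite cL // => /(EP _ _ xy).
  by case/andP.
exists [seq map f b | b <- L]; last first.
  by apply/allP=> _ /mapP[b bL ->]; rewrite size_map (allP sL).
split.
  apply/allP=> _ /mapP[b bL ->]; rewrite map_inj_in_uniq ?(allP uL) //.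
  by move=> x y /(LP _ bL) Px /(LP _ bL) Py; apply: injf.
have memf b x : b \in L -> P x -> (f x \in map f b) = (x \in b).
  move=> bL Px; apply/mapP/idP => [[y yb /injf->//]|]; last by exists x.
  exact: LP yb.
have key x y : P x -> P y -> f x != f y ->
    count (covers (f x) (f y)) [seq map f b | b <- L] = F (f x) (f y).
  move=> Px Py fxy; have xy : x != y by apply: contra_neq fxy => ->.
  rewrite FE // -cL // count_map; apply: eq_in_count => b bL.
  by rewrite /covers /= !memf.
move=> u v uv; have [F0|F1] := posnP (F u v); last first.
  by have [x [y [Px Py uE vE]]] := Fim _ _ uv F1; subst u v; apply: key.
apply/eqP; rewrite F0 -leqn0 leqNgt -has_count; apply/hasP=> -[c /mapP[b bL ->]].
case/andP=> /mapP[x xb uE] /mapP[y yb vE]; subst u v.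
have [Px Py] := (LP _ bL _ xb, LP _ bL _ yb).
by have := key _ _ Px Py uv; rewrite F0 count_map => /eqP;
  rewrite -leqn0 leqNgt -has_count; apply/negP; rewrite negbK; apply/hasP; exists b;
  rewrite // /covers /= !map_f.
Qed.

Lemma reshape_index_cons a s i :
  reshape_index (a :: s) i = if i < a then 0 else (reshape_index s (i - a)).+1.
Proof.
rewrite /reshape_index /= subn_eq0; case: ltnP => // ai.
by rewrite subSn.
Qed.

Lemma reshape_index_cat s t i :
  reshape_index (s ++ t) i =
    if i < sumn s then reshape_index s i
    else size s + reshape_index t (i - sumn s).
Proof.
elim: s i => [|a s IHs] i; first by rewrite /= subn0.
rewrite cat_cons !reshape_index_cons IHs /=.
case: (ltnP i a) => ia; first by rewrite ltn_addr.
rewrite ltn_subLR // subnDA addSn.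
by case: ifP.
Qed.

Definition multipartite (s : seq nat) (x y : nat) : bool :=
  [&& x < sumn s, y < sumn s & reshape_index s x != reshape_index s y].

(* The K4-decomposition of the complete multipartite graph with part sizes s,
   that is, a 4-GDD of type s; its points are 0, ..., sumn s - 1, and the parts
   are consecutive intervals. *)
Definition gdd (s : seq nat) : Prop :=
  decomposable (fun x y => multipartite s x y : nat).

Lemma multipartite_cat s t x y :
  multipartite (s ++ t) x y =
    multipartite (sumn s :: t) x y + multipartite s x y :> nat.
Proof.
rewrite /multipartite sumn_cat /= !reshape_index_cat !reshape_index_cons.
have Hx := @reshape_indexP s x; have Hy := @reshape_indexP s y.
case: (ltnP x (sumn s)) => xs; case: (ltnP y (sumn s)) => ys //=.
- by rewrite !ltn_addr.
- rewrite addn0 ltn_addr //=; congr (nat_of_bool (_ && _)).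
  by apply/eqP=> E; move: (Hx xs); rewrite E; lia.
- rewrite addn0 (ltn_addr _ ys) /=; congr (nat_of_bool (_ && _)).
  by apply/eqP=> E; move: (Hy ys); rewrite -E; lia.
by rewrite addn0 eqSS eqn_add2l.
Qed.

Lemma gdd_sub a s t : gdd (a :: t) -> gdd s -> sumn s = a -> gdd (s ++ t).
Proof.
move=> ga gs sa; subst a; apply: eq_decomposable (decomposableD ga gs) => x y _.
by rewrite multipartite_cat.
Qed.

Lemma gdd_nil : gdd [::].
Proof. exact: eq_decomposable (@decomposable0 _). Qed.

Lemma gdd_one a : gdd [:: a].
Proof.
apply: eq_decomposable (@decomposable0 _) => x y _.
by rewrite /multipartite !reshape_index_cons /= addn0; case: (x < a); case: (y < a).
Qed.

Lemma gdd_cons0 s : gdd (0 :: s) <-> gdd s.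
Proof.
by split; apply: eq_decomposable => x y _;
  rewrite /multipartite !reshape_index_cons /= !subn0 eqSS.
Qed.

Lemma multipartite_lt s x y : multipartite s x y -> (x < sumn s) && (y < sumn s).
Proof. by case/and3P=> -> ->. Qed.

Lemma multipartite_cons a s x y :
  multipartite (a :: s) x y =
    if x < a then (a <= y) && (y < a + sumn s)
    else if y < a then x < a + sumn s
    else multipartite s (x - a) (y - a).
Proof.
rewrite /multipartite !reshape_index_cons /=.
by case: ifP => xa; case: ifP => ya; rewrite ?eqSS; lia.
Qed.

(** Adjunction of [w] points, numbered first. Each part is filled together with them in such a way
    that they stay a part, so their mutual pairs are never covered and they merge with the first
    part into a hole of size [w + g]. *)
Lemma gdd_fill (w g : nat) (ss : seq (seq nat)) :
  gdd (g :: map sumn ss) -> (forall s : seq nat, s \in ss -> gdd (w :: s)) ->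
  gdd (w + g :: flatten ss).
Proof.
move=> gdg fill; have [R decR RE] : exists2 R : nat -> nat -> nat, decomposable R & forall x y : nat, x != y ->
    multipartite (w + g :: flatten ss) x y =
    ((w <= x) && (w <= y) && multipartite (g :: map sumn ss) (x - w) (y - w))
      + R x y :> nat.
  elim: ss g fill {gdg} => [|s ss IHss] g fill.
    exists (fun _ _ => 0) => [|x y xy]; first exact: decomposable0.
    by rewrite /= !multipartite_cons /=; repeat case: ifP; rewrite /multipartite /=; lia.
  (* For the remaining parts, the part [s] counts as belonging to the hole. *)
  have [|R decR RE] := IHss (g + sumn s).
    by move=> u uss; apply: fill; rewrite inE uss orbT.
  (* [f] keeps the new points in place and moves the points of [s] beyond the hole. *)
  pose f i := if i < w then i else i + g.
  exists (fun x y => R x y + [&& (x < w) || (w + g <= x), (y < w) || (w + g <= y)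
     & multipartite (w :: s) (if x < w then x else x - g) (if y < w then y else y - g)]).
    apply: decomposableD => //; have := fill s (mem_head _ _).
    apply: (@decomposable_img _ _ predT f).
    - by move=> x y _ _; rewrite /f; do 2 case: ifP; lia.
    - by [].
    - move=> x y _ _ _; rewrite /f; congr nat_of_bool.
      have fK z : (if (if z < w then z else z + g) < w then if z < w then z else z + g
          else (if z < w then z else z + g) - g) = z by repeat case: ifP; lia.
      have fW z : ((if z < w then z else z + g) < w)
          || (w + g <= (if z < w then z else z + g)) by case: ifP; lia.
      by rewrite !fK !fW.
    move=> u v _; rewrite lt0b => /and3P[Hu Hv _].
    exists (if u < w then u else u - g), (if v < w then v else v - g); split=> //; rewrite /f.
      by case/orP: Hu; repeat case: ifP; lia.
    by case/orP: Hv; repeat case: ifP; lia.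
  move=> x y xy; rewrite [flatten _]/= -cat_cons multipartite_cat [sumn _]/= -addnA.
  rewrite RE // map_cons.
  have E2 : multipartite (g :: sumn s :: map sumn ss) (x - w) (y - w) =
     multipartite ((g + sumn s) :: map sumn ss) (x - w) (y - w)
       + multipartite [:: g; sumn s] (x - w) (y - w) :> nat.
    by rewrite -[g :: _]/([:: g; sumn s] ++ map sumn ss) multipartite_cat /= addn0.
  set W := (w <= x) && (w <= y).
  have {}E2 : W && multipartite (g :: sumn s :: map sumn ss) (x - w) (y - w) =
     (W && multipartite ((g + sumn s) :: map sumn ss) (x - w) (y - w))
       + (W && multipartite [:: g; sumn s] (x - w) (y - w)) :> nat by case: (W).
  rewrite E2 -!addnA; congr (_ + _); rewrite addnCA; congr (_ + _).
  rewrite {E2}/W !multipartite_cons /= addn0 subnDA.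
  have H := @multipartite_lt s.
  have nil0 a b : multipartite [::] a b = false by [].
  case: (ltnP x w) => xw; case: (ltnP y w) => yw; rewrite /= ?xw ?yw;
    repeat (case: ifP => ?); rewrite ?nil0 ?subnDA ?(subnAC _ g); lia.
apply: eq_decomposable (decomposableD _ decR) => [x y xy|]; first by rewrite RE.
apply: (@decomposable_img _ _ predT (addn^~ w)) gdg.
- by move=> x y _ _ /addIn.
- by [].
- by move=> x y _ _ _; rewrite !leq_addl !addnK.
move=> u v _; rewrite lt0b -andbA => /and3P[wu wv _].
by exists (u - w), (v - w); rewrite !subnK.
Qed.

Lemma multipartite_flatten_index s p q :
  p.2 < nth 0 s p.1 -> q.2 < nth 0 s q.1 ->
  multipartite s (flatten_index s p.1 p.2) (flatten_index s q.1 q.2) = (p.1 != q.1).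
Proof. by move=> Hp Hq; rewrite /multipartite !flatten_indexP // !flatten_indexKl. Qed.

Lemma gdd_of_pairs (s : seq nat) :
  decomposable (fun p q : nat * nat =>
    [&& p.2 < nth 0 s p.1, q.2 < nth 0 s q.1 & p.1 != q.1] : nat) -> gdd s.
Proof.
apply: (@decomposable_img _ _ (fun p => p.2 < nth 0 s p.1)
  (fun p => flatten_index s p.1 p.2)).
- move=> [i a] [j b]; rewrite !unfold_in /= => Ha Hb E.
  by rewrite -(flatten_indexKl Ha) -{2}(flatten_indexKr Ha) E flatten_indexKl // flatten_indexKr.
- by move=> p q _; rewrite lt0b => /and3P[-> ->].
- by move=> p q Hp Hq _; rewrite multipartite_flatten_index // Hp Hq.
move=> u v _; rewrite lt0b => /multipartite_lt/andP[us vs].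
exists (reshape_index s u, reshape_offset s u), (reshape_index s v, reshape_offset s v).
by rewrite /= !reshape_offsetP // !reshape_indexK.
Qed.

(* Wilson's fundamental construction. *)
Lemma decomposable_inflate (T : eqType) (F : T -> T -> nat) (L : seq (seq T))
    (wt : T -> nat) :
  design F L -> (forall b, b \in L -> gdd (map wt b)) ->
  decomposable (fun p q : T * nat =>
    (p.1 != q.1) * F p.1 q.1 * ((p.2 < wt p.1) && (q.2 < wt q.1))).
Proof.
move=> [uL cL] gL.
(* Counting blocks of [L] in place of [F] makes the claim additive in [L], so the blocks can be
   inflated one at a time. *)
suff: decomposable (fun p q : T * nat =>
    (p.1 != q.1) * count (covers p.1 q.1) L * ((p.2 < wt p.1) && (q.2 < wt q.1))).
  by apply: eq_decomposable => p q _; case: eqP => [//|/eqP pq]; rewrite cL.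
elim: L uL gL {cL} => [|b L IHL] /=.
  by move=> _ _; apply: eq_decomposable (@decomposable0 _) => p q _; rewrite muln0.
case/andP=> ub /IHL{}IHL gL; have {}IHL := IHL (fun c cL => gL c (@mem_behead _ (b :: L) c cL)).
have gb := gL b (mem_head _ _).
apply: eq_decomposable (decomposableD IHL (F := fun p q => (p.1 != q.1) * covers p.1 q.1 b
  * ((p.2 < wt p.1) && (q.2 < wt q.1))) _) => [p q _|].
  by rewrite addnC mulnDr mulnDl.
case: b ub gb {gL} => [|x0 b0]; last set b := x0 :: b0.
  by move=> _ _; apply: eq_decomposable (@decomposable0 _) => p q _; rewrite muln0.
move=> ub; set s := map wt b.
have ltb i : i < sumn s -> reshape_index s i < size b.
  by move/reshape_indexP; rewrite size_map.
have nths k : k < size b -> nth 0 s k = wt (nth x0 b k).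
  by move=> kb; rewrite (nth_map x0).
apply: (@decomposable_img _ _ (fun i => i < sumn s)
  (fun i => (nth x0 b (reshape_index s i), reshape_offset s i))).
- move=> i j; rewrite !unfold_in => Hi Hj [/eqP + E].
  rewrite nth_uniq ?ltb // => /eqP E'.
  by rewrite -(reshape_indexK s i) E' E reshape_indexK.
- by move=> x y _; rewrite lt0b => /multipartite_lt.
- move=> x y Hx Hy _; rewrite /multipartite /covers Hx Hy /= !mem_nth ?ltb //.
  by rewrite nth_uniq ?ltb // -!nths ?ltb // !reshape_offsetP // muln1 /= muln1.
move=> [x i] [y j] _ H.
have /and4P[xb yb ix jy] : [&& x \in b, y \in b, i < wt x & j < wt y].
  by move: H; rewrite !muln_gt0 !lt0b /covers /= => /andP[/andP[_ /andP[-> ->]] /andP[-> ->]].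
have [Hx Hy] : (i < nth 0 s (index x b)) /\ (j < nth 0 s (index y b)).
  by rewrite !nths ?index_mem // !nth_index.
exists (flatten_index s (index x b) i), (flatten_index s (index y b) j).
by rewrite !flatten_indexP // !flatten_indexKl // !flatten_indexKr // !nth_index.
Qed.

(** * Transversal designs *)
(* Transversal designs TD(k, m), as orthogonal arrays: each list in L is a block,
   given by its point in each of the k groups. *)
Definition td (k m : nat) : Prop :=
  exists2 L : seq (seq nat), all (fun b => (size b == k) && all (ltn^~ m) b) L &
    forall g h i j, g < k -> h < k -> g != h -> i < m -> j < m ->
      count (fun b => (nth 0 b g == i) && (nth 0 b h == j)) L = 1.

Lemma mem_zip_iota k (b : seq nat) (p : nat * nat) :
  size b = k -> (p \in zip (iota 0 k) b) = (p.1 < k) && (nth 0 b p.1 == p.2).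
Proof.
move=> sb; have sz : size (zip (iota 0 k) b) = k by rewrite size_zip size_iota sb minnn.
apply/(nthP (0, 0))/idP => [[i]|/andP[pk /eqP pE]].
  rewrite sz => ik <-; rewrite nth_zip ?size_iota ?sb //= nth_iota // add0n.
  by rewrite ik eqxx.
exists p.1; first by rewrite sz.
by rewrite nth_zip ?size_iota ?sb // nth_iota // pE; case: p pk {pE}.
Qed.

(** Points are pairs (group, entry). Two points of one group lie in no common block, so a group
    becomes a part of size its total weight. Weight 0 deletes a point, which is how groups are
    truncated. *)
Lemma td_wilson k m (wt : nat * nat -> nat) :
    td k m ->
    (forall b, size b = k -> all (ltn^~ m) b -> gdd (map wt (zip (iota 0 k) b))) ->
  gdd [seq sumn [seq wt (g, i) | i <- iota 0 m] | g <- iota 0 k].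
Proof.
move=> [L sL cL] ingr.
have szL b : b \in L -> size b = k by move=> /(allP sL)/andP[/eqP].
have ltL b g : b \in L -> g < k -> nth 0 b g < m.
  move=> bL gk; have /andP[/eqP sb /allP lb] := allP sL _ bL.
  by apply: lb; rewrite mem_nth ?sb.
pose F (p q : nat * nat) : nat :=
  [&& p.1 < k, q.1 < k, p.1 != q.1, p.2 < m & q.2 < m].
have dL : design F [seq zip (iota 0 k) b | b <- L].
  split.
    apply/allP=> _ /mapP[b bL ->]; apply: (@map_uniq _ _ fst).
    by rewrite -/unzip1 unzip1_zip ?iota_uniq // size_iota szL.
  move=> [g i] [h j] pq; rewrite count_map /F /=.
  transitivity (count (fun b => [&& g < k, h < k, nth 0 b g == i & nth 0 b h == j]) L).
    apply: eq_in_count => b bL; rewrite /covers /= !mem_zip_iota ?szL //=.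
    by case: (g < k); case: (h < k); rewrite //= andbF.
  case: (ltnP g k) => gk; last by rewrite count_pred0.
  case: (ltnP h k) => hk /=; last by rewrite count_pred0.
  case: (eqVneq g h) pq => [<-|gh] pq /=.
    apply/eqP; rewrite -leqn0 leqNgt -has_count; apply/hasP => -[b bL /andP[/eqP E1 /eqP E2]].
    by move: pq; rewrite -E1 E2 eqxx.
  case: (ltnP i m) => im /=; last first.
    apply/eqP; rewrite -leqn0 leqNgt -has_count; apply/hasP => -[b bL /andP[/eqP E _]].
    by move: (ltL b g bL gk); rewrite E ltnNge im.
  case: (ltnP j m) => jm; first exact: cL.
  apply/eqP; rewrite -leqn0 leqNgt -has_count; apply/hasP => -[b bL /andP[_ /eqP E]].
  by move: (ltL b h bL hk); rewrite E ltnNge jm.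
apply: gdd_of_pairs.
have ingrL c : c \in [seq zip (iota 0 k) b | b <- L] -> gdd (map wt c).
  by case/mapP=> b bL ->; apply: ingr; [exact: szL|case/andP: (allP sL _ bL)].
have dec := decomposable_inflate dL ingrL.
pose w g := [seq wt (g, i) | i <- iota 0 m].
have sw g : size (w g) = m by rewrite size_map size_iota.
have nw g i : i < m -> nth 0 (w g) i = wt (g, i).
  by move=> im; rewrite (nth_map 0) ?size_iota // nth_iota.
have ns g : g < k -> nth 0 [seq sumn (w g) | g <- iota 0 k] g = sumn (w g).
  by move=> gk; rewrite (nth_map 0) ?size_iota // nth_iota.
have nsk g c : c < nth 0 [seq sumn (w g) | g <- iota 0 k] g -> g < k.
  by case: (ltnP g k) => // kg; rewrite nth_default // size_map size_iota.
apply: (@decomposable_img _ _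
  (fun p => [&& p.1.1 < k, p.1.2 < m & p.2 < wt p.1])
  (fun p => (p.1.1, flatten_index (w p.1.1) p.1.2 p.2))) dec.
- move=> [[g i] c] [[h j] d]; rewrite !unfold_in /= => /and3P[gk im cw] /and3P[hk jm dw].
  case=> gh; rewrite -{}gh in hk jm dw * => E; rewrite -nw // in cw; rewrite -nw // in dw.
  have := congr1 (reshape_index (w g)) E; rewrite !flatten_indexKl // => ij.
  by have := congr1 (reshape_offset (w g)) E; rewrite !flatten_indexKr // ij => ->.
- move=> [[g i] c] [[h j] d] _ /=; rewrite !muln_gt0 !lt0b /F /=.
  by case/andP=> /andP[_ /and5P[-> -> _ -> ->]] /andP[-> ->].
- move=> [[g i] c] [[h j] d] /= /and3P[gk im cw] /and3P[hk jm dw] _.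
  rewrite !ns // !flatten_indexP ?nw // /F /= gk hk im jm cw dw /= !muln1 xpair_eqE.
  by case: (g == h); rewrite ?muln0.
move=> [g a] [h b] _; rewrite lt0b /= => /and3P[Ha Hb gh].
have [gk hk] := (nsk _ _ Ha, nsk _ _ Hb).
rewrite ns // in Ha; rewrite ns // in Hb.
have := reshape_indexP Ha; have := reshape_offsetP Ha.
have := reshape_indexP Hb; have := reshape_offsetP Hb.
rewrite !sw => ob ib oa ia; rewrite nw // in oa; rewrite nw // in ob.
exists ((g, reshape_index (w g) a), reshape_offset (w g) a).
exists ((h, reshape_index (w h) b), reshape_offset (w h) b).
by rewrite /= gk hk ia ib oa ob !reshape_indexK.
Qed.

(** Constant weight [m]: copy [c] of point [i] becomes [i * m + c], which keeps the parts
    consecutive intervals. *)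
Lemma gdd_inflate s m : gdd (nseq 4 m) -> gdd s -> gdd (map (muln m) s).
Proof.
have [->|m_gt0] := posnP m.
  have s0 : sumn (map (muln 0) s) = 0 by elim: s => //= a s ->.
  by move=> _ _; apply: eq_decomposable (@decomposable0 _) => x y _; rewrite /multipartite s0.
move=> gm [L dL sL].
have idx i c : c < m -> reshape_index (map (muln m) s) (i * m + c) = reshape_index s i.
  move=> cm; elim: s i {dL} => [|a s IHs] i; first by [].
  rewrite !reshape_index_cons mulnC; have -> : (m * i + c < m * a) = (i < a) by nia.
  by case: ltnP => // ai; rewrite -addnBAC ?leq_mul2l ?ai ?orbT // -mulnBr mulnC IHs.
have sm : sumn (map (muln m) s) = sumn s * m.
  by elim: s {dL idx} => //= a s IHs; rewrite IHs mulnDl mulnC.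
have ingr b : b \in L -> gdd (map (fun=> m) b).
  by move/(allP sL); case: b => [|x1 [|x2 [|x3 [|x4 [|]]]]].
have := decomposable_inflate dL ingr.
apply: (@decomposable_img _ _ (fun p => p.2 < m) (fun p => p.1 * m + p.2)).
- move=> [i c] [j d]; rewrite !unfold_in /= => cm dm E.
  have := congr1 (fun x => x %/ m) E; rewrite !divnMDl // !divn_small // !addn0 => ij.
  by move: E; rewrite ij => /addnI ->.
- by move=> p q _; rewrite !muln_gt0 !lt0b => /andP[].
- move=> [i c] [j d] /= cm dm _; rewrite cm dm muln1 /multipartite !idx // sm.
  have -> : (i * m + c < sumn s * m) = (i < sumn s) by nia.
  have -> : (j * m + d < sumn s * m) = (j < sumn s) by nia.
  by have [<-|_] := eqVneq i j; rewrite ?eqxx ?andbF ?mul1n ?mul0n.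
move=> u v _ _; exists (u %/ m, u %% m), (v %/ m, v %% m).
by rewrite /= !ltn_pmod // -!divn_eq.
Qed.

Lemma td_take k k' m : td k m -> k' <= k -> td k' m.
Proof.
move=> [L /allP sL cL] kk; exists (map (take k') L).
  apply/allP=> _ /mapP[b /sL/andP[/eqP sb /allP lb] ->].
  by rewrite size_takel ?sb // eqxx; apply/allP=> x /mem_take/lb.
move=> g h i j gk hk gh im jm; rewrite count_map -(cL g h i j) ?(leq_trans _ kk) //.
by apply: eq_count => b /=; rewrite !nth_take.
Qed.

Lemma sumn_map_const (T : Type) (l : seq T) c : sumn [seq c | _ <- l] = c * size l.
Proof. by elim: l => [|x l /= ->]; rewrite ?muln0 // mulnS. Qed.

Lemma gdd_td m : gdd (nseq 4 1) -> td 4 m -> gdd (nseq 4 m).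
Proof.
move=> g1 /(@td_wilson 4 m (fun=> 1)); rewrite /= sumn_map_const size_iota mul1n.
by apply=> -[|a [|b [|c [|d [|e l]]]]].
Qed.

(** MacNeish's product: entries [x] and [y] combine into [x * n + y], and quotient and remainder by
    [n] recover a row of either array. *)
Lemma td_prod k m n : 0 < n -> td k m -> td k n -> td k (m * n).
Proof.
move=> n_gt0 [L sL cL] [M sM cM].
pose f (b c : seq nat) := [seq p.1 * n + p.2 | p <- zip b c].
exists [seq f b c | b <- L, c <- M].
  apply/allP=> _ /allpairsP[[b c] [/= /(allP sL)/andP[/eqP sb /allP lb]
    /(allP sM)/andP[/eqP sc /allP lc] ->]].
  rewrite size_map size_zip sb sc minnn eqxx; apply/allP=> _ /mapP[[x y] xy ->] /=.
  have xb : x \in b by rewrite -(@unzip1_zip _ _ b c) ?sb ?sc //; apply: (map_f fst) xy.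
  have yc : y \in c by rewrite -(@unzip2_zip _ _ b c) ?sb ?sc //; apply: (map_f snd) xy.
  have /= xm : x < m := lb _ xb; have /= yn : y < n := lc _ yc.
  by rewrite (leq_trans (n := x.+1 * n)) ?leq_mul2r ?xm ?orbT // mulSn addnC ltn_add2r.
move=> g h i j gk hk gh im jm.
have im' : i %/ n < m by rewrite ltn_divLR.
have jm' : j %/ n < m by rewrite ltn_divLR.
have [in' jn'] : i %% n < n /\ j %% n < n by rewrite !ltn_pmod.
pose a b := (nth 0 b g == i %/ n) && (nth 0 b h == j %/ n).
pose e c := (nth 0 c g == i %% n) && (nth 0 c h == j %% n).
have fE b c l : b \in L -> c \in M -> l < k -> forall z,
    (nth 0 (f b c) l == z) = (nth 0 b l == z %/ n) && (nth 0 c l == z %% n).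
  move=> /(allP sL)/andP[/eqP sb /allP lb] /(allP sM)/andP[/eqP sc /allP lc] lk z.
  have cn : nth 0 c l < n by apply: lc; rewrite mem_nth ?sc.
  rewrite (nth_map (0, 0)) ?size_zip ?sb ?sc ?minnn // nth_zip ?sb ?sc //=.
  apply/eqP/andP => [<-|[/eqP-> /eqP->]]; last by rewrite -divn_eq.
  by rewrite divnMDl // divn_small // addn0 modnMDl modn_small.
rewrite -[RHS](cL g h (i %/ n) (j %/ n)) // -[in RHS]/(count a L).
transitivity (sumn [seq a b * count e M | b <- L]); last first.
  by rewrite [count e M]cM // -sumn_count; congr sumn; apply: eq_map => b; rewrite muln1.
rewrite count_flatten -map_comp; congr sumn; apply/eq_in_map => b bL /=.
rewrite count_map; transitivity (count (fun c => a b && e c) M).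
  by apply: eq_in_count => c cM'; rewrite /= !fE // /a /e andbACA.
by case: (a b); rewrite ?mul1n // mul0n count_pred0.
Qed.

Lemma count_uniq1 (T : eqType) (P : pred T) (l : seq T) p :
  uniq l -> p \in l -> P p -> {in l, forall q, P q -> q = p} -> count P l = 1.
Proof.
move=> ul pl Pp Pq; have -> : count P l = count_mem p l; last by rewrite count_uniq_mem ?pl.
by apply: eq_in_count => q ql; apply/idP/eqP => [/(Pq q ql)|->].
Qed.

Lemma modn_mull_inj m d a b :
  coprime m d -> d * a = d * b %[mod m] -> a = b %[mod m].
Proof.
move=> cop; wlog ab : a b / a <= b.
  by move=> H; case/orP: (leq_total a b) => ab E; [exact: H|apply/esym/H].
move/esym/eqP; rewrite eqn_mod_dvd ?leq_mul2l ?ab ?orbT // -mulnBr Gauss_dvdr //.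
by rewrite -eqn_mod_dvd // => /eqP.
Qed.

Lemma coprime_fact_le m k d : coprime m k`! -> 0 < d -> d <= k -> coprime m d.
Proof. by move=> cop d0 dk; apply: coprime_dvdr cop; apply: dvdn_fact; rewrite d0. Qed.

(* The rows of the array are y, x, x + y, x + 2y, ..., modulo m. *)
Lemma td_cyclic k m : coprime m k`! -> td k.+2 m.
Proof.
move=> cop; pose row x y := y :: [seq (x + i * y) %% m | i <- iota 0 k.+1].
exists [seq row x y | x <- iota 0 m, y <- iota 0 m].
  apply/allP=> _ /allpairsP[[x y] [/= + + ->]]; rewrite !mem_iota !add0n /= => xm ym.
  rewrite /row [size _]/= size_map size_iota eqxx /= ym /=; apply/andP; split.
    by rewrite ltn_pmod // (leq_ltn_trans _ xm).
  by apply/allP=> _ /mapP[i _ ->]; rewrite ltn_pmod // (leq_ltn_trans _ xm).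
move=> g h i j gk hk gh im jm; have m_gt0 : 0 < m by apply: leq_ltn_trans im.
have rowS x y l : l < k.+1 -> nth 0 (row x y) l.+1 = (x + l * y) %% m.
  by move=> lk; rewrite -[LHS]/(nth 0 [seq (x + i * y) %% m | i <- iota 0 k.+1] l) (nth_map 0) ?size_iota // nth_iota.
have row_lt x y l : x < m -> y < m -> l < k.+2 -> nth 0 (row x y) l < m.
  by case: l => // l _ _ lk; rewrite rowS // ltn_pmod.
have inj x y x' y' : x < m -> y < m -> x' < m -> y' < m ->
    nth 0 (row x y) g = nth 0 (row x' y') g ->
    nth 0 (row x y) h = nth 0 (row x' y') h -> (x, y) = (x', y').
  move=> xm ym xm' ym'.
  wlog gh' : g h gk hk gh / g < h.
    by move=> H; case: (ltngtP g h) gh => // gh' _ E1 E2; [apply: (H g h)|apply: (H h g)] => //;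
      rewrite ?(ltn_eqF gh') // eq_sym (ltn_eqF gh').
  have xE l : x + l * y = x' + l * y %[mod m] -> x = x'.
    by move/eqP; rewrite eqn_modDr !modn_small // => /eqP.
  case: h hk gh gh' => // h hk gh gh'; rewrite (rowS _ _ h) // (rowS _ _ h) //.
  case: g gk gh gh' => [_ _ _ /= <- /xE -> //|g gk gh gh']; rewrite !rowS // => E1.
  rewrite -(subnKC (ltnW (gh' : g < h))) 2!mulnDl !addnA => E2.
  (* The difference of the two columns isolates (h - g) y; as 0 < h - g <= k, this factor is
     invertible modulo [m]. *)
  have {}E2 : (h - g) * y = (h - g) * y' %[mod m].
    by apply/eqP; rewrite -(eqn_modDl (x + g * y)) E2 -modnDml -E1 modnDml.
  have yy : y = y'.
    have cop' : coprime m (h - g) by apply: coprime_fact_le cop _ _; lia.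
    by have := modn_mull_inj cop' E2; rewrite !modn_small.
  by rewrite -yy in E1 *; rewrite (xE _ E1).
(* Distinct rows differ in column [g] or [h]; there are as many rows as pairs of entries, so every
   pair occurs exactly once. *)
pose f (p : 'I_m * 'I_m) : 'I_m * 'I_m :=
  (Ordinal (row_lt p.1 p.2 g (ltn_ord _) (ltn_ord _) gk),
   Ordinal (row_lt p.1 p.2 h (ltn_ord _) (ltn_ord _) hk)).
have f_inj : injective f.
  move=> [x y] [x' y'] [E1 E2].
  by have [/val_inj-> /val_inj->] := inj _ _ _ _ (ltn_ord x) (ltn_ord y) (ltn_ord x') (ltn_ord y') E1 E2.
have [[x y] fxy] : exists p, f p = (Ordinal im, Ordinal jm).
  by have [f' _ f'K] := injF_bij f_inj; exists (f' (Ordinal im, Ordinal jm)); rewrite f'K.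
case: fxy => Ei Ej.
rewrite -(map_id [seq row _ _ | _ <- _, _ <- _]).
have -> : [seq row x y | x <- iota 0 m, y <- iota 0 m] =
    map (fun p => row p.1 p.2) [seq (x, y) | x <- iota 0 m, y <- iota 0 m].
  by rewrite map_allpairs.
rewrite map_id count_map; apply: (@count_uniq1 _ _ _ (val x, val y)).
- by apply: allpairs_uniq; rewrite ?iota_uniq // => -[? ?] [? ?].
- by apply/allpairsP; exists (val x, val y); rewrite !mem_iota /= !ltn_ord.
- by rewrite /= Ei Ej !eqxx.
move=> [x' y'] /allpairsP[[a b] [/= + + [-> ->]]]; rewrite !mem_iota !add0n /= => am bm.
by move=> /andP[/eqP E1 /eqP E2]; apply: inj; rewrite ?ltn_ord // ?E1 ?E2.
Qed.

(** * Explicit designs *)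
(** The list keeps multiplicities: once sorted, a single comparison with the expected neighbours
    checks all pairs at [x] at once. *)
Definition neighbours (L : seq (seq nat)) (x : nat) : seq nat :=
  flatten [seq [seq y <- b | y != x] | b <- L & x \in b].

Lemma count_covers_neighbours (L : seq (seq nat)) x y :
  all uniq L -> x != y -> count (covers x y) L = count_mem y (neighbours L x).
Proof.
move=> + xy; rewrite /neighbours; elim: L => //= b L IHL /andP[ub /IHL ->].
rewrite /covers; case: (boolP (x \in b)) => //= xb; rewrite count_cat; congr (_ + _).
by rewrite count_uniq_mem ?filter_uniq // mem_filter eq_sym xy.
Qed.

Definition gdd_check (s : seq nat) (L : seq (seq nat)) : bool :=
  [&& all (fun b => [&& uniq b, size b == 4 & all (ltn^~ (sumn s)) b]) L
    & all (fun x => sort leq (neighbours L x) ==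
                    [seq y <- iota 0 (sumn s) | multipartite s x y])
          (iota 0 (sumn s))].

Lemma gdd_checkP s L : gdd_check s L -> gdd s.
Proof.
case/andP=> /allP okL /allP nbL.
have uL : all uniq L by apply/allP=> b /okL/and3P[].
exists L; last by apply/allP=> b /okL/and3P[].
split=> // x y xy; case: (ltnP x (sumn s)) => xs; last first.
  rewrite /multipartite ltnNge xs /=; apply/eqP; rewrite -leqn0 leqNgt -has_count.
  apply/hasP=> -[b /okL/and3P[_ _ /allP lb] /andP[/lb /=]].
  by rewrite ltnNge xs.
have := nbL x; rewrite mem_iota => /(_ xs)/eqP nbx.
rewrite count_covers_neighbours // -(permP (permEl (perm_sort leq (neighbours L x)))) nbx.
rewrite count_uniq_mem ?filter_uniq ?iota_uniq // mem_filter mem_iota add0n; congr nat_of_bool.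
by apply: andb_idr => /multipartite_lt/andP[].
Qed.

Definition td_check (k m : nat) (L : seq (seq nat)) : bool :=
  all (fun b => (size b == k) && all (ltn^~ m) b) L &&
  all (fun g => all (fun h => (g == h) ||
    (sort leq [seq nth 0 b g * m + nth 0 b h | b <- L] == iota 0 (m * m)))
  (iota 0 k)) (iota 0 k).

Lemma td_checkP k m L : td_check k m L -> td k m.
Proof.
case/andP=> okL /allP pL; exists L => // g h i j gk hk gh im jm.
have := pL g; rewrite mem_iota => /(_ gk)/allP/(_ h); rewrite mem_iota => /(_ hk).
rewrite (negPf gh) /= => /eqP E.
have ltL b l : b \in L -> l < k -> nth 0 b l < m.
  by move=> /(allP okL)/andP[/eqP sb /allP lb] lk; apply: lb; rewrite mem_nth ?sb.
transitivity (count_mem (i * m + j) [seq nth 0 b g * m + nth 0 b h | b <- L]).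
  rewrite count_map; apply: eq_in_count => b bL /=.
  have bh := ltL b h bL hk; apply/andP/eqP => [[/eqP-> /eqP->] //|Eb].
  have := congr1 (fun x => x %/ m) Eb; have := congr1 (fun x => x %% m) Eb.
  rewrite !modnMDl !modn_small // !divnMDl ?(leq_ltn_trans _ im) // !divn_small // !addn0.
  by move=> -> ->.
rewrite -(permP (permEl (perm_sort leq [seq nth 0 b g * m + nth 0 b h | b <- L]))) E.
by rewrite count_uniq_mem ?iota_uniq // mem_iota; nia.
Qed.

Definition linear_check (n : nat) (L : seq (seq nat)) : bool :=
  all (fun b => uniq b && all (ltn^~ n) b) L &&
  all (fun x => uniq (neighbours L x)) (iota 0 n).

Lemma linear_checkP n L x y :
  linear_check n L -> x != y -> count (covers x y) L <= [&& x < n & y < n].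
Proof.
case/andP=> /allP okL /allP nbL xy; have uL : all uniq L by apply/allP=> b /okL/andP[].
case: (boolP (_ && _)) => [/andP[xn yn]|xyn].
  by rewrite count_covers_neighbours // count_uniq_mem ?leq_b1 // nbL ?mem_iota.
rewrite leqn0 -leqn0 leqNgt -has_count; apply: contra xyn => /hasP[b /okL/andP[_ /allP lb]].
by case/andP=> /lb /= -> /lb.
Qed.

Definition blocks_3x4 : seq (seq nat) :=
  [:: [:: 0; 3; 6; 9]; [:: 0; 4; 8; 11]; [:: 0; 5; 7; 10]; [:: 1; 3; 8; 10];
      [:: 1; 4; 7; 9]; [:: 1; 5; 6; 11]; [:: 2; 3; 7; 11]; [:: 2; 4; 6; 10];
      [:: 2; 5; 8; 9]].

(** An affine plane of order 4 with one point deleted; the parts are the remains of the lines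
    through it. *)
Definition blocks_3x5 : seq (seq nat) :=
  [:: [:: 0; 3; 7; 13]; [:: 0; 4; 10; 12]; [:: 0; 5; 8; 9]; [:: 0; 6; 11; 14];
      [:: 1; 3; 6; 10]; [:: 1; 4; 8; 14]; [:: 1; 5; 11; 13]; [:: 1; 7; 9; 12];
      [:: 2; 3; 9; 14]; [:: 2; 4; 7; 11]; [:: 2; 5; 6; 12]; [:: 2; 8; 10; 13];
      [:: 3; 8; 11; 12]; [:: 4; 6; 9; 13]; [:: 5; 7; 10; 14]].

Definition blocks_3x8 : seq (seq nat) :=
  [:: [:: 0; 3; 13; 15]; [:: 0; 4; 14; 21]; [:: 0; 5; 7; 23];
      [:: 0; 6; 9; 19]; [:: 0; 8; 11; 17]; [:: 0; 10; 12; 18];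
      [:: 0; 16; 20; 22]; [:: 1; 3; 9; 12]; [:: 1; 4; 10; 17];
      [:: 1; 5; 6; 22]; [:: 1; 7; 14; 19]; [:: 1; 8; 13; 16];
      [:: 1; 11; 18; 21]; [:: 1; 15; 20; 23]; [:: 2; 3; 19; 22];
      [:: 2; 4; 18; 23]; [:: 2; 5; 11; 15]; [:: 2; 6; 14; 17];
      [:: 2; 7; 10; 16]; [:: 2; 8; 12; 20]; [:: 2; 9; 13; 21];
      [:: 3; 6; 16; 18]; [:: 3; 7; 17; 21]; [:: 3; 8; 10; 23];
      [:: 3; 11; 14; 20]; [:: 4; 6; 12; 15]; [:: 4; 7; 13; 20];
      [:: 4; 8; 9; 22]; [:: 4; 11; 16; 19]; [:: 5; 8; 14; 18];
      [:: 5; 9; 17; 20]; [:: 5; 10; 13; 19]; [:: 5; 12; 16; 21];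
      [:: 6; 10; 20; 21]; [:: 6; 11; 13; 23]; [:: 7; 9; 15; 18];
      [:: 7; 11; 12; 22]; [:: 8; 15; 19; 21]; [:: 9; 14; 16; 23];
      [:: 10; 14; 15; 22]; [:: 12; 17; 19; 23]; [:: 13; 17; 18; 22]].

Definition blocks_3x9 : seq (seq nat) :=
  [:: [:: 0; 3; 8; 9]; [:: 0; 4; 13; 25]; [:: 0; 5; 6; 24]; [:: 0; 7; 12; 23];
      [:: 0; 10; 17; 20]; [:: 0; 11; 15; 22]; [:: 0; 14; 16; 19];
      [:: 0; 18; 21; 26]; [:: 1; 3; 7; 16]; [:: 1; 4; 12; 26];
      [:: 1; 5; 14; 20]; [:: 1; 6; 17; 21]; [:: 1; 8; 11; 18];
      [:: 1; 9; 23; 25]; [:: 1; 10; 22; 24]; [:: 1; 13; 15; 19];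
      [:: 2; 3; 21; 24]; [:: 2; 4; 7; 15]; [:: 2; 5; 12; 22];
      [:: 2; 6; 13; 18]; [:: 2; 8; 16; 20]; [:: 2; 9; 19; 26];
      [:: 2; 10; 14; 23]; [:: 2; 11; 17; 25]; [:: 3; 6; 11; 12];
      [:: 3; 10; 15; 26]; [:: 3; 13; 20; 23]; [:: 3; 14; 18; 25];
      [:: 3; 17; 19; 22]; [:: 4; 6; 10; 19]; [:: 4; 8; 17; 23];
      [:: 4; 9; 20; 24]; [:: 4; 11; 14; 21]; [:: 4; 16; 18; 22];
      [:: 5; 7; 10; 18]; [:: 5; 8; 15; 25]; [:: 5; 9; 16; 21];
      [:: 5; 11; 19; 23]; [:: 5; 13; 17; 26]; [:: 6; 9; 14; 15];
      [:: 6; 16; 23; 26]; [:: 6; 20; 22; 25]; [:: 7; 9; 13; 22];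
      [:: 7; 11; 20; 26]; [:: 7; 14; 17; 24]; [:: 7; 19; 21; 25];
      [:: 8; 10; 13; 21]; [:: 8; 12; 19; 24]; [:: 8; 14; 22; 26];
      [:: 9; 12; 17; 18]; [:: 10; 12; 16; 25]; [:: 11; 13; 16; 24];
      [:: 12; 15; 20; 21]; [:: 15; 18; 23; 24]].

Definition blocks_3x13 : seq (seq nat) :=
  [:: [:: 0; 3; 10; 27]; [:: 0; 4; 8; 13]; [:: 0; 5; 14; 18];
      [:: 0; 6; 17; 29]; [:: 0; 7; 24; 36]; [:: 0; 9; 25; 37];
      [:: 0; 11; 23; 33]; [:: 0; 12; 15; 22]; [:: 0; 16; 28; 30];
      [:: 0; 19; 32; 38]; [:: 0; 20; 31; 34]; [:: 0; 21; 26; 35];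
      [:: 1; 3; 12; 28]; [:: 1; 4; 9; 29]; [:: 1; 5; 10; 36];
      [:: 1; 6; 26; 37]; [:: 1; 7; 23; 25]; [:: 1; 8; 11; 32];
      [:: 1; 13; 15; 24]; [:: 1; 14; 20; 21]; [:: 1; 16; 22; 38];
      [:: 1; 17; 19; 34]; [:: 1; 18; 30; 33]; [:: 1; 27; 31; 35];
      [:: 2; 3; 22; 35]; [:: 2; 4; 19; 25]; [:: 2; 5; 26; 34];
      [:: 2; 6; 27; 32]; [:: 2; 7; 33; 37]; [:: 2; 8; 9; 28];
      [:: 2; 10; 17; 20]; [:: 2; 11; 15; 36]; [:: 2; 12; 18; 29];
      [:: 2; 13; 16; 21]; [:: 2; 14; 24; 30]; [:: 2; 23; 31; 38];
      [:: 3; 6; 13; 30]; [:: 3; 7; 11; 16]; [:: 3; 8; 17; 21];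
      [:: 3; 9; 20; 32]; [:: 3; 14; 26; 36]; [:: 3; 15; 18; 25];
      [:: 3; 19; 31; 33]; [:: 3; 23; 34; 37]; [:: 3; 24; 29; 38];
      [:: 4; 6; 15; 31]; [:: 4; 7; 12; 32]; [:: 4; 10; 26; 28];
      [:: 4; 11; 14; 35]; [:: 4; 16; 18; 27]; [:: 4; 17; 23; 24];
      [:: 4; 20; 22; 37]; [:: 4; 21; 33; 36]; [:: 4; 30; 34; 38];
      [:: 5; 6; 25; 38]; [:: 5; 7; 22; 28]; [:: 5; 8; 29; 37];
      [:: 5; 9; 30; 35]; [:: 5; 11; 12; 31]; [:: 5; 13; 20; 23];
      [:: 5; 15; 21; 32]; [:: 5; 16; 19; 24]; [:: 5; 17; 27; 33];
      [:: 6; 9; 16; 33]; [:: 6; 10; 14; 19]; [:: 6; 11; 20; 24];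
      [:: 6; 12; 23; 35]; [:: 6; 18; 21; 28]; [:: 6; 22; 34; 36];
      [:: 7; 9; 18; 34]; [:: 7; 10; 15; 35]; [:: 7; 13; 29; 31];
      [:: 7; 14; 17; 38]; [:: 7; 19; 21; 30]; [:: 7; 20; 26; 27];
      [:: 8; 10; 25; 31]; [:: 8; 12; 33; 38]; [:: 8; 14; 15; 34];
      [:: 8; 16; 23; 26]; [:: 8; 18; 24; 35]; [:: 8; 19; 22; 27];
      [:: 8; 20; 30; 36]; [:: 9; 12; 19; 36]; [:: 9; 13; 17; 22];
      [:: 9; 14; 23; 27]; [:: 9; 15; 26; 38]; [:: 9; 21; 24; 31];
      [:: 10; 12; 21; 37]; [:: 10; 13; 18; 38]; [:: 10; 16; 32; 34];
      [:: 10; 22; 24; 33]; [:: 10; 23; 29; 30]; [:: 11; 13; 28; 34];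
      [:: 11; 17; 18; 37]; [:: 11; 19; 26; 29]; [:: 11; 21; 27; 38];
      [:: 11; 22; 25; 30]; [:: 12; 16; 20; 25]; [:: 12; 17; 26; 30];
      [:: 12; 24; 27; 34]; [:: 13; 19; 35; 37]; [:: 13; 25; 27; 36];
      [:: 13; 26; 32; 33]; [:: 14; 16; 31; 37]; [:: 14; 22; 29; 32];
      [:: 14; 25; 28; 33]; [:: 15; 19; 23; 28]; [:: 15; 20; 29; 33];
      [:: 15; 27; 30; 37]; [:: 16; 29; 35; 36]; [:: 17; 25; 32; 35];
      [:: 17; 28; 31; 36]; [:: 18; 22; 26; 31]; [:: 18; 23; 32; 36];
      [:: 20; 28; 35; 38]; [:: 21; 25; 29; 34]; [:: 24; 28; 32; 37]].

Definition blocks_3x12 : seq (seq nat) :=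
  [:: [:: 0; 3; 7; 20]; [:: 0; 4; 17; 21]; [:: 0; 5; 15; 23];
      [:: 0; 6; 12; 27]; [:: 0; 8; 14; 24]; [:: 0; 9; 13; 26];
      [:: 0; 10; 22; 32]; [:: 0; 11; 25; 34]; [:: 0; 16; 18; 33];
      [:: 0; 19; 28; 31]; [:: 0; 29; 30; 35]; [:: 1; 3; 23; 26];
      [:: 1; 4; 24; 29]; [:: 1; 5; 19; 21]; [:: 1; 6; 15; 31];
      [:: 1; 7; 12; 35]; [:: 1; 8; 9; 20]; [:: 1; 10; 16; 28];
      [:: 1; 11; 18; 32]; [:: 1; 13; 25; 30]; [:: 1; 14; 17; 33];
      [:: 1; 22; 27; 34]; [:: 2; 3; 17; 28]; [:: 2; 4; 25; 31];
      [:: 2; 5; 7; 11]; [:: 2; 6; 23; 24]; [:: 2; 8; 18; 22];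
      [:: 2; 9; 19; 29]; [:: 2; 10; 27; 30]; [:: 2; 12; 20; 34];
      [:: 2; 13; 21; 33]; [:: 2; 14; 15; 32]; [:: 2; 16; 26; 35];
      [:: 3; 6; 13; 22]; [:: 3; 8; 16; 27]; [:: 3; 9; 15; 30];
      [:: 3; 10; 18; 31]; [:: 3; 11; 19; 35]; [:: 3; 12; 24; 33];
      [:: 3; 14; 21; 25]; [:: 3; 29; 32; 34]; [:: 4; 6; 11; 16];
      [:: 4; 7; 22; 26]; [:: 4; 8; 12; 30]; [:: 4; 9; 23; 27];
      [:: 4; 10; 15; 33]; [:: 4; 13; 18; 28]; [:: 4; 14; 19; 34];
      [:: 4; 20; 32; 35]; [:: 5; 6; 9; 14]; [:: 5; 8; 17; 35];
      [:: 5; 10; 12; 29]; [:: 5; 13; 16; 32]; [:: 5; 18; 25; 27];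
      [:: 5; 20; 24; 31]; [:: 5; 22; 30; 33]; [:: 5; 26; 28; 34];
      [:: 6; 10; 21; 34]; [:: 6; 17; 19; 32]; [:: 6; 18; 26; 30];
      [:: 6; 20; 29; 33]; [:: 6; 25; 28; 35]; [:: 7; 9; 16; 34];
      [:: 7; 10; 17; 25]; [:: 7; 13; 15; 19]; [:: 7; 14; 28; 30];
      [:: 7; 18; 21; 29]; [:: 7; 23; 31; 33]; [:: 7; 24; 27; 32];
      [:: 8; 10; 19; 23]; [:: 8; 11; 28; 33]; [:: 8; 13; 31; 34];
      [:: 8; 15; 25; 29]; [:: 8; 21; 26; 32]; [:: 9; 12; 17; 18];
      [:: 9; 21; 24; 28]; [:: 9; 22; 31; 35]; [:: 9; 25; 32; 33];
      [:: 10; 13; 24; 35]; [:: 10; 14; 20; 26]; [:: 11; 12; 15; 26];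
      [:: 11; 13; 23; 29]; [:: 11; 14; 27; 31]; [:: 11; 17; 22; 24];
      [:: 11; 20; 21; 30]; [:: 12; 16; 21; 31]; [:: 12; 19; 22; 25];
      [:: 12; 23; 28; 32]; [:: 13; 17; 20; 27]; [:: 14; 16; 22; 29];
      [:: 14; 18; 23; 35]; [:: 15; 18; 24; 34]; [:: 15; 20; 22; 28];
      [:: 15; 21; 27; 35]; [:: 16; 19; 24; 30]; [:: 16; 20; 23; 25];
      [:: 17; 23; 30; 34]; [:: 17; 26; 29; 31]; [:: 19; 26; 27; 33]].

Definition blocks_6_3x5 : seq (seq nat) :=
  [:: [:: 0; 6; 9; 16]; [:: 0; 7; 11; 20]; [:: 0; 8; 10; 12];
      [:: 0; 13; 15; 18]; [:: 0; 14; 17; 19]; [:: 1; 6; 11; 13];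
      [:: 1; 7; 16; 19]; [:: 1; 8; 15; 20]; [:: 1; 9; 12; 17];
      [:: 1; 10; 14; 18]; [:: 2; 6; 12; 15]; [:: 2; 7; 9; 14];
      [:: 2; 8; 13; 19]; [:: 2; 10; 17; 20]; [:: 2; 11; 16; 18];
      [:: 3; 6; 17; 18]; [:: 3; 7; 10; 15]; [:: 3; 8; 14; 16];
      [:: 3; 9; 13; 20]; [:: 3; 11; 12; 19]; [:: 4; 6; 14; 20];
      [:: 4; 7; 12; 18]; [:: 4; 8; 11; 17]; [:: 4; 9; 15; 19];
      [:: 4; 10; 13; 16]; [:: 5; 6; 10; 19]; [:: 5; 7; 13; 17];
      [:: 5; 8; 9; 18]; [:: 5; 11; 14; 15]; [:: 5; 12; 16; 20]].

Definition blocks_2x7 : seq (seq nat) :=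
  [:: [:: 0; 2; 5; 10]; [:: 0; 3; 8; 12]; [:: 0; 4; 6; 9]; [:: 0; 7; 11; 13];
      [:: 1; 2; 9; 13]; [:: 1; 3; 4; 11]; [:: 1; 5; 7; 8]; [:: 1; 6; 10; 12];
      [:: 2; 4; 7; 12]; [:: 2; 6; 8; 11]; [:: 3; 5; 6; 13]; [:: 3; 7; 9; 10];
      [:: 4; 8; 10; 13]; [:: 5; 9; 11; 12]].

Definition blocks_2x10 : seq (seq nat) :=
  [:: [:: 0; 2; 11; 17]; [:: 0; 3; 9; 13]; [:: 0; 4; 10; 18];
      [:: 0; 5; 7; 12]; [:: 0; 6; 14; 16]; [:: 0; 8; 15; 19];
      [:: 1; 2; 5; 15]; [:: 1; 3; 6; 18]; [:: 1; 4; 9; 16]; [:: 1; 7; 8; 11];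
      [:: 1; 10; 13; 14]; [:: 1; 12; 17; 19]; [:: 2; 4; 13; 19];
      [:: 2; 6; 10; 12]; [:: 2; 7; 9; 14]; [:: 2; 8; 16; 18];
      [:: 3; 4; 7; 17]; [:: 3; 5; 8; 10]; [:: 3; 11; 14; 19];
      [:: 3; 12; 15; 16]; [:: 4; 6; 11; 15]; [:: 4; 8; 12; 14];
      [:: 5; 6; 9; 19]; [:: 5; 11; 13; 16]; [:: 5; 14; 17; 18];
      [:: 6; 8; 13; 17]; [:: 7; 10; 16; 19]; [:: 7; 13; 15; 18];
      [:: 9; 10; 15; 17]; [:: 9; 11; 12; 18]].

Definition blocks_6x5 : seq (seq nat) :=
  [:: [:: 0; 6; 16; 20]; [:: 0; 7; 12; 21]; [:: 0; 8; 17; 26];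
      [:: 0; 9; 18; 25]; [:: 0; 10; 14; 24]; [:: 0; 11; 22; 28];
      [:: 0; 13; 19; 29]; [:: 0; 15; 23; 27]; [:: 1; 6; 15; 24];
      [:: 1; 7; 17; 18]; [:: 1; 8; 13; 22]; [:: 1; 9; 23; 29];
      [:: 1; 10; 19; 26]; [:: 1; 11; 12; 25]; [:: 1; 14; 20; 27];
      [:: 1; 16; 21; 28]; [:: 2; 6; 14; 23]; [:: 2; 7; 16; 25];
      [:: 2; 8; 15; 19]; [:: 2; 9; 13; 26]; [:: 2; 10; 21; 27];
      [:: 2; 11; 20; 24]; [:: 2; 12; 18; 28]; [:: 2; 17; 22; 29];
      [:: 3; 6; 21; 29]; [:: 3; 7; 20; 26]; [:: 3; 8; 16; 27];
      [:: 3; 9; 14; 22]; [:: 3; 10; 13; 28]; [:: 3; 11; 15; 18];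
      [:: 3; 12; 19; 24]; [:: 3; 17; 23; 25]; [:: 4; 6; 17; 28];
      [:: 4; 7; 22; 27]; [:: 4; 8; 18; 24]; [:: 4; 9; 16; 19];
      [:: 4; 10; 12; 23]; [:: 4; 11; 14; 29]; [:: 4; 13; 20; 25];
      [:: 4; 15; 21; 26]; [:: 5; 6; 19; 25]; [:: 5; 7; 15; 29];
      [:: 5; 8; 23; 28]; [:: 5; 9; 12; 27]; [:: 5; 10; 17; 20];
      [:: 5; 11; 13; 21]; [:: 5; 14; 18; 26]; [:: 5; 16; 22; 24];
      [:: 6; 12; 22; 26]; [:: 6; 13; 18; 27]; [:: 7; 13; 23; 24];
      [:: 7; 14; 19; 28]; [:: 8; 12; 20; 29]; [:: 8; 14; 21; 25];
      [:: 9; 15; 20; 28]; [:: 9; 17; 21; 24]; [:: 10; 15; 22; 25];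
      [:: 10; 16; 18; 29]; [:: 11; 16; 23; 26]; [:: 11; 17; 19; 27]].

Definition blocks_6x6 : seq (seq nat) :=
  [:: [:: 0; 6; 20; 25]; [:: 0; 7; 13; 32]; [:: 0; 8; 22; 30];
      [:: 0; 9; 18; 31]; [:: 0; 10; 16; 29]; [:: 0; 11; 26; 35];
      [:: 0; 12; 21; 33]; [:: 0; 14; 19; 24]; [:: 0; 15; 28; 34];
      [:: 0; 17; 23; 27]; [:: 1; 6; 12; 26]; [:: 1; 7; 24; 31];
      [:: 1; 8; 16; 19]; [:: 1; 9; 15; 23]; [:: 1; 10; 21; 35];
      [:: 1; 11; 14; 34]; [:: 1; 13; 20; 28]; [:: 1; 17; 29; 33];
      [:: 1; 18; 25; 30]; [:: 1; 22; 27; 32]; [:: 2; 6; 17; 35];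
      [:: 2; 7; 12; 18]; [:: 2; 8; 21; 28]; [:: 2; 9; 27; 30];
      [:: 2; 10; 13; 25]; [:: 2; 11; 20; 31]; [:: 2; 14; 23; 33];
      [:: 2; 15; 22; 26]; [:: 2; 16; 24; 34]; [:: 2; 19; 29; 32];
      [:: 3; 6; 23; 29]; [:: 3; 7; 28; 33]; [:: 3; 8; 15; 31];
      [:: 3; 9; 17; 25]; [:: 3; 10; 14; 20]; [:: 3; 11; 19; 27];
      [:: 3; 12; 24; 30]; [:: 3; 13; 22; 35]; [:: 3; 16; 18; 32];
      [:: 3; 21; 26; 34]; [:: 4; 6; 21; 30]; [:: 4; 7; 19; 26];
      [:: 4; 8; 14; 27]; [:: 4; 9; 13; 34]; [:: 4; 10; 23; 24];
      [:: 4; 11; 16; 33]; [:: 4; 12; 20; 32]; [:: 4; 15; 25; 35];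
      [:: 4; 17; 18; 28]; [:: 4; 22; 29; 31]; [:: 5; 6; 16; 22];
      [:: 5; 7; 23; 34]; [:: 5; 8; 25; 33]; [:: 5; 9; 12; 29];
      [:: 5; 10; 28; 32]; [:: 5; 11; 15; 18]; [:: 5; 13; 21; 27];
      [:: 5; 14; 26; 30]; [:: 5; 17; 19; 31]; [:: 5; 20; 24; 35];
      [:: 6; 13; 19; 33]; [:: 6; 14; 28; 31]; [:: 6; 15; 24; 32];
      [:: 6; 18; 27; 34]; [:: 7; 14; 22; 25]; [:: 7; 15; 21; 29];
      [:: 7; 16; 27; 35]; [:: 7; 17; 20; 30]; [:: 8; 12; 23; 35];
      [:: 8; 13; 18; 24]; [:: 8; 17; 26; 32]; [:: 8; 20; 29; 34];
      [:: 9; 14; 21; 32]; [:: 9; 16; 20; 26]; [:: 9; 19; 28; 35];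
      [:: 9; 22; 24; 33]; [:: 10; 12; 27; 31]; [:: 10; 15; 19; 30];
      [:: 10; 17; 22; 34]; [:: 10; 18; 26; 33]; [:: 11; 12; 22; 28];
      [:: 11; 13; 29; 30]; [:: 11; 17; 21; 24]; [:: 11; 23; 25; 32];
      [:: 12; 19; 25; 34]; [:: 13; 23; 26; 31]; [:: 14; 18; 29; 35];
      [:: 15; 20; 27; 33]; [:: 16; 21; 25; 31]; [:: 16; 23; 28; 30]].

Definition blocks_3_6x5 : seq (seq nat) :=
  [:: [:: 0; 3; 20; 30]; [:: 0; 4; 17; 31]; [:: 0; 5; 19; 22];
      [:: 0; 6; 9; 26]; [:: 0; 7; 10; 23]; [:: 0; 8; 18; 21];
      [:: 0; 11; 25; 28]; [:: 0; 12; 15; 32]; [:: 0; 13; 16; 29];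
      [:: 0; 14; 24; 27]; [:: 1; 3; 25; 29]; [:: 1; 4; 20; 24];
      [:: 1; 5; 9; 31]; [:: 1; 6; 16; 32]; [:: 1; 7; 11; 15];
      [:: 1; 8; 12; 22]; [:: 1; 10; 26; 30]; [:: 1; 13; 17; 21];
      [:: 1; 14; 18; 28]; [:: 1; 19; 23; 27]; [:: 2; 3; 24; 32];
      [:: 2; 4; 11; 19]; [:: 2; 5; 13; 28]; [:: 2; 6; 14; 15];
      [:: 2; 7; 22; 29]; [:: 2; 8; 9; 30]; [:: 2; 10; 17; 25];
      [:: 2; 12; 20; 21]; [:: 2; 16; 23; 31]; [:: 2; 18; 26; 27];
      [:: 3; 9; 18; 22]; [:: 3; 10; 19; 28]; [:: 3; 11; 21; 31];
      [:: 3; 12; 16; 27]; [:: 3; 13; 15; 23]; [:: 3; 14; 17; 26];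
      [:: 4; 9; 16; 25]; [:: 4; 10; 18; 32]; [:: 4; 12; 26; 28];
      [:: 4; 13; 22; 27]; [:: 4; 14; 23; 29]; [:: 4; 15; 21; 30];
      [:: 5; 10; 20; 29]; [:: 5; 11; 16; 26]; [:: 5; 12; 18; 23];
      [:: 5; 14; 21; 32]; [:: 5; 15; 25; 27]; [:: 5; 17; 24; 30];
      [:: 6; 10; 21; 27]; [:: 6; 11; 23; 30]; [:: 6; 12; 17; 29];
      [:: 6; 13; 19; 24]; [:: 6; 18; 25; 31]; [:: 6; 20; 22; 28];
      [:: 7; 9; 17; 27]; [:: 7; 12; 24; 31]; [:: 7; 13; 18; 30];
      [:: 7; 14; 20; 25]; [:: 7; 16; 21; 28]; [:: 7; 19; 26; 32];
      [:: 8; 10; 16; 24]; [:: 8; 11; 20; 27]; [:: 8; 13; 25; 32];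
      [:: 8; 14; 19; 31]; [:: 8; 15; 26; 29]; [:: 8; 17; 23; 28];
      [:: 9; 15; 24; 28]; [:: 9; 19; 21; 29]; [:: 9; 20; 23; 32];
      [:: 10; 15; 22; 31]; [:: 11; 17; 22; 32]; [:: 11; 18; 24; 29];
      [:: 12; 19; 25; 30]; [:: 13; 20; 26; 31]; [:: 14; 16; 22; 30]].

Definition blocks_3_6x6 : seq (seq nat) :=
  [:: [:: 0; 3; 18; 31]; [:: 0; 4; 26; 35]; [:: 0; 5; 14; 33];
      [:: 0; 6; 15; 28]; [:: 0; 7; 23; 38]; [:: 0; 8; 11; 36];
      [:: 0; 9; 20; 37]; [:: 0; 10; 25; 29]; [:: 0; 12; 17; 34];
      [:: 0; 13; 22; 32]; [:: 0; 16; 21; 30]; [:: 0; 19; 24; 27];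
      [:: 1; 3; 12; 37]; [:: 1; 4; 19; 32]; [:: 1; 5; 21; 36];
      [:: 1; 6; 9; 34]; [:: 1; 7; 16; 29]; [:: 1; 8; 24; 33];
      [:: 1; 10; 15; 38]; [:: 1; 11; 26; 30]; [:: 1; 13; 18; 35];
      [:: 1; 14; 23; 27]; [:: 1; 17; 22; 31]; [:: 1; 20; 25; 28];
      [:: 2; 3; 25; 34]; [:: 2; 4; 13; 38]; [:: 2; 5; 20; 27];
      [:: 2; 6; 22; 37]; [:: 2; 7; 10; 35]; [:: 2; 8; 17; 30];
      [:: 2; 9; 24; 28]; [:: 2; 11; 16; 33]; [:: 2; 12; 21; 31];
      [:: 2; 14; 19; 36]; [:: 2; 15; 26; 29]; [:: 2; 18; 23; 32];
      [:: 3; 9; 27; 35]; [:: 3; 10; 24; 30]; [:: 3; 11; 15; 32];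
      [:: 3; 13; 20; 23]; [:: 3; 14; 17; 21]; [:: 3; 16; 28; 38];
      [:: 3; 19; 26; 33]; [:: 3; 22; 29; 36]; [:: 4; 9; 18; 22];
      [:: 4; 10; 28; 36]; [:: 4; 11; 25; 31]; [:: 4; 12; 16; 27];
      [:: 4; 14; 15; 24]; [:: 4; 17; 29; 33]; [:: 4; 20; 21; 34];
      [:: 4; 23; 30; 37]; [:: 5; 9; 16; 25]; [:: 5; 10; 19; 23];
      [:: 5; 11; 29; 37]; [:: 5; 12; 26; 32]; [:: 5; 13; 17; 28];
      [:: 5; 15; 22; 35]; [:: 5; 18; 30; 34]; [:: 5; 24; 31; 38];
      [:: 6; 10; 17; 26]; [:: 6; 11; 20; 24]; [:: 6; 12; 30; 38];
      [:: 6; 13; 21; 27]; [:: 6; 14; 18; 29]; [:: 6; 16; 23; 36];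
      [:: 6; 19; 31; 35]; [:: 6; 25; 32; 33]; [:: 7; 9; 19; 30];
      [:: 7; 11; 18; 21]; [:: 7; 12; 15; 25]; [:: 7; 13; 31; 33];
      [:: 7; 14; 22; 28]; [:: 7; 17; 24; 37]; [:: 7; 20; 32; 36];
      [:: 7; 26; 27; 34]; [:: 8; 9; 23; 29]; [:: 8; 10; 20; 31];
      [:: 8; 12; 19; 22]; [:: 8; 13; 16; 26]; [:: 8; 14; 32; 34];
      [:: 8; 15; 27; 37]; [:: 8; 18; 25; 38]; [:: 8; 21; 28; 35];
      [:: 9; 15; 21; 33]; [:: 9; 17; 32; 38]; [:: 9; 26; 31; 36];
      [:: 10; 16; 22; 34]; [:: 10; 18; 27; 33]; [:: 10; 21; 32; 37];
      [:: 11; 17; 23; 35]; [:: 11; 19; 28; 34]; [:: 11; 22; 27; 38];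
      [:: 12; 18; 24; 36]; [:: 12; 20; 29; 35]; [:: 12; 23; 28; 33];
      [:: 13; 15; 30; 36]; [:: 13; 19; 25; 37]; [:: 13; 24; 29; 34];
      [:: 14; 16; 31; 37]; [:: 14; 20; 26; 38]; [:: 14; 25; 30; 35];
      [:: 15; 23; 31; 34]; [:: 16; 24; 32; 35]; [:: 17; 25; 27; 36];
      [:: 18; 26; 28; 37]; [:: 19; 21; 29; 38]; [:: 20; 22; 30; 33]].

(* The pairs of 0, ..., 30 not covered are those of a prism on 0, ..., 5 minus
   the two triangles of the prism, which are the last two blocks. *)
Definition blocks31 : seq (seq nat) :=
  [:: [:: 0; 4; 24; 28]; [:: 0; 5; 23; 27]; [:: 0; 6; 7; 17];
      [:: 0; 8; 12; 21]; [:: 0; 9; 19; 30]; [:: 0; 10; 11; 16];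
      [:: 0; 13; 25; 26]; [:: 0; 14; 18; 22]; [:: 0; 15; 20; 29];
      [:: 1; 3; 21; 25]; [:: 1; 5; 22; 26]; [:: 1; 6; 11; 15];
      [:: 1; 7; 23; 28]; [:: 1; 8; 9; 14]; [:: 1; 10; 12; 19];
      [:: 1; 13; 24; 27]; [:: 1; 16; 18; 20]; [:: 1; 17; 29; 30];
      [:: 2; 3; 20; 30]; [:: 2; 4; 19; 29]; [:: 2; 6; 9; 13];
      [:: 2; 7; 12; 18]; [:: 2; 8; 10; 23]; [:: 2; 11; 21; 26];
      [:: 2; 14; 16; 24]; [:: 2; 15; 27; 28]; [:: 2; 17; 22; 25];
      [:: 3; 6; 10; 14]; [:: 3; 7; 8; 13]; [:: 3; 9; 11; 24];
      [:: 3; 12; 22; 27]; [:: 3; 15; 17; 19]; [:: 3; 16; 28; 29];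
      [:: 3; 18; 23; 26]; [:: 4; 6; 8; 18]; [:: 4; 7; 9; 22];
      [:: 4; 10; 20; 25]; [:: 4; 11; 12; 17]; [:: 4; 13; 15; 23];
      [:: 4; 14; 26; 27]; [:: 4; 16; 21; 30]; [:: 5; 6; 12; 16];
      [:: 5; 7; 11; 20]; [:: 5; 8; 24; 29]; [:: 5; 9; 10; 15];
      [:: 5; 13; 17; 21]; [:: 5; 14; 19; 28]; [:: 5; 18; 25; 30];
      [:: 6; 19; 21; 23]; [:: 6; 20; 22; 24]; [:: 6; 25; 27; 29];
      [:: 6; 26; 28; 30]; [:: 7; 10; 27; 30]; [:: 7; 14; 21; 29];
      [:: 7; 15; 16; 26]; [:: 7; 19; 24; 25]; [:: 8; 11; 25; 28];
      [:: 8; 15; 22; 30]; [:: 8; 16; 17; 27]; [:: 8; 19; 20; 26];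
      [:: 9; 12; 26; 29]; [:: 9; 16; 23; 25]; [:: 9; 17; 18; 28];
      [:: 9; 20; 21; 27]; [:: 10; 13; 18; 29]; [:: 10; 17; 24; 26];
      [:: 10; 21; 22; 28]; [:: 11; 13; 14; 30]; [:: 11; 18; 19; 27];
      [:: 11; 22; 23; 29]; [:: 12; 13; 20; 28]; [:: 12; 14; 15; 25];
      [:: 12; 23; 24; 30]; [:: 13; 16; 19; 22]; [:: 14; 17; 20; 23];
      [:: 15; 18; 21; 24]; [:: 0; 1; 2]; [:: 3; 4; 5]].

(* Point 0 lies in four blocks of size 3, every other point in one. *)
Definition blocks30 : seq (seq nat) :=
  [:: [:: 0; 1; 2]; [:: 0; 3; 4]; [:: 0; 5; 6]; [:: 0; 7; 8];
      [:: 0; 9; 14; 23]; [:: 0; 10; 11; 25]; [:: 0; 12; 13; 21];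
      [:: 0; 15; 22; 28]; [:: 0; 16; 18; 20]; [:: 0; 17; 24; 27];
      [:: 0; 19; 26; 29]; [:: 1; 3; 10; 15]; [:: 1; 4; 20; 29];
      [:: 1; 5; 18; 27]; [:: 1; 6; 14; 19]; [:: 1; 7; 12; 17];
      [:: 1; 8; 16; 28]; [:: 1; 9; 25; 26]; [:: 1; 11; 21; 22];
      [:: 1; 13; 23; 24]; [:: 2; 3; 17; 29]; [:: 2; 4; 13; 18];
      [:: 2; 5; 11; 16]; [:: 2; 6; 15; 27]; [:: 2; 7; 19; 28];
      [:: 2; 8; 9; 20]; [:: 2; 10; 21; 26]; [:: 2; 12; 22; 23];
      [:: 2; 14; 24; 25]; [:: 3; 5; 21; 23]; [:: 3; 6; 13; 20];
      [:: 3; 7; 9; 16]; [:: 3; 8; 22; 26]; [:: 3; 11; 24; 28];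
      [:: 3; 12; 14; 18]; [:: 3; 19; 25; 27]; [:: 4; 5; 10; 17];
      [:: 4; 6; 24; 26]; [:: 4; 7; 23; 25]; [:: 4; 8; 12; 19];
      [:: 4; 9; 11; 15]; [:: 4; 14; 21; 28]; [:: 4; 16; 22; 27];
      [:: 5; 7; 22; 24]; [:: 5; 8; 14; 15]; [:: 5; 9; 13; 19];
      [:: 5; 12; 25; 29]; [:: 5; 20; 26; 28]; [:: 6; 7; 11; 18];
      [:: 6; 8; 21; 25]; [:: 6; 9; 22; 29]; [:: 6; 10; 12; 16];
      [:: 6; 17; 23; 28]; [:: 7; 10; 14; 20]; [:: 7; 13; 26; 27];
      [:: 7; 15; 21; 29]; [:: 8; 10; 23; 27]; [:: 8; 11; 13; 17];
      [:: 8; 18; 24; 29]; [:: 9; 10; 24]; [:: 9; 12; 27; 28];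
      [:: 9; 17; 18; 21]; [:: 10; 13; 28; 29]; [:: 10; 18; 19; 22];
      [:: 11; 12; 26]; [:: 11; 14; 27; 29]; [:: 11; 19; 20; 23];
      [:: 12; 15; 20; 24]; [:: 13; 14; 22]; [:: 13; 15; 16; 25];
      [:: 14; 16; 17; 26]; [:: 15; 17; 19]; [:: 15; 18; 23; 26];
      [:: 16; 19; 21; 24]; [:: 16; 23; 29]; [:: 17; 20; 22; 25];
      [:: 18; 25; 28]; [:: 20; 21; 27]].

(** The rows y, x, x + y, x + 2y, x + 3y over the field of order 4, whose elements are coded by
    their binary digits; the cyclic construction of [td_cyclic] is confined to orders prime to 6
    here. *)
Definition array5_4 : seq (seq nat) :=
  [:: [:: 0; 0; 0; 0; 0]; [:: 1; 0; 1; 2; 3]; [:: 2; 0; 2; 3; 1];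
      [:: 3; 0; 3; 1; 2]; [:: 0; 1; 1; 1; 1]; [:: 1; 1; 0; 3; 2];
      [:: 2; 1; 3; 2; 0]; [:: 3; 1; 2; 0; 3]; [:: 0; 2; 2; 2; 2];
      [:: 1; 2; 3; 0; 1]; [:: 2; 2; 0; 1; 3]; [:: 3; 2; 1; 3; 0];
      [:: 0; 3; 3; 3; 3]; [:: 1; 3; 2; 1; 0]; [:: 2; 3; 1; 0; 2];
      [:: 3; 3; 0; 2; 1]].

Definition array6_8 : seq (seq nat) :=
  [:: [:: 0; 0; 0; 0; 0; 0]; [:: 1; 0; 1; 2; 3; 4]; [:: 2; 0; 2; 4; 6; 3];
      [:: 3; 0; 3; 6; 5; 7]; [:: 4; 0; 4; 3; 7; 6]; [:: 5; 0; 5; 1; 4; 2];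
      [:: 6; 0; 6; 7; 1; 5]; [:: 7; 0; 7; 5; 2; 1]; [:: 0; 1; 1; 1; 1; 1];
      [:: 1; 1; 0; 3; 2; 5]; [:: 2; 1; 3; 5; 7; 2]; [:: 3; 1; 2; 7; 4; 6];
      [:: 4; 1; 5; 2; 6; 7]; [:: 5; 1; 4; 0; 5; 3]; [:: 6; 1; 7; 6; 0; 4];
      [:: 7; 1; 6; 4; 3; 0]; [:: 0; 2; 2; 2; 2; 2]; [:: 1; 2; 3; 0; 1; 6];
      [:: 2; 2; 0; 6; 4; 1]; [:: 3; 2; 1; 4; 7; 5]; [:: 4; 2; 6; 1; 5; 4];
      [:: 5; 2; 7; 3; 6; 0]; [:: 6; 2; 4; 5; 3; 7]; [:: 7; 2; 5; 7; 0; 3];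
      [:: 0; 3; 3; 3; 3; 3]; [:: 1; 3; 2; 1; 0; 7]; [:: 2; 3; 1; 7; 5; 0];
      [:: 3; 3; 0; 5; 6; 4]; [:: 4; 3; 7; 0; 4; 5]; [:: 5; 3; 6; 2; 7; 1];
      [:: 6; 3; 5; 4; 2; 6]; [:: 7; 3; 4; 6; 1; 2]; [:: 0; 4; 4; 4; 4; 4];
      [:: 1; 4; 5; 6; 7; 0]; [:: 2; 4; 6; 0; 2; 7]; [:: 3; 4; 7; 2; 1; 3];
      [:: 4; 4; 0; 7; 3; 2]; [:: 5; 4; 1; 5; 0; 6]; [:: 6; 4; 2; 3; 5; 1];
      [:: 7; 4; 3; 1; 6; 5]; [:: 0; 5; 5; 5; 5; 5]; [:: 1; 5; 4; 7; 6; 1];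
      [:: 2; 5; 7; 1; 3; 6]; [:: 3; 5; 6; 3; 0; 2]; [:: 4; 5; 1; 6; 2; 3];
      [:: 5; 5; 0; 4; 1; 7]; [:: 6; 5; 3; 2; 4; 0]; [:: 7; 5; 2; 0; 7; 4];
      [:: 0; 6; 6; 6; 6; 6]; [:: 1; 6; 7; 4; 5; 2]; [:: 2; 6; 4; 2; 0; 5];
      [:: 3; 6; 5; 0; 3; 1]; [:: 4; 6; 2; 5; 1; 0]; [:: 5; 6; 3; 7; 2; 4];
      [:: 6; 6; 0; 1; 7; 3]; [:: 7; 6; 1; 3; 4; 7]; [:: 0; 7; 7; 7; 7; 7];
      [:: 1; 7; 6; 5; 4; 3]; [:: 2; 7; 5; 3; 1; 4]; [:: 3; 7; 4; 1; 2; 0];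
      [:: 4; 7; 3; 4; 0; 1]; [:: 5; 7; 2; 6; 3; 5]; [:: 6; 7; 1; 0; 6; 2];
      [:: 7; 7; 0; 2; 5; 6]].

Lemma gdd_3x4 : gdd [:: 3; 3; 3; 3].
Proof. by apply: (@gdd_checkP _ blocks_3x4); vm_compute. Qed.

(** The part of size 0 stands for a point of weight 0, which remains in the list of weights of a
    block in Wilson's construction. The same holds for the other types with zeros below. *)
Lemma gdd_03x4 : gdd [:: 0; 3; 3; 3; 3].
Proof. by apply: (@gdd_checkP _ blocks_3x4); vm_compute. Qed.

Lemma gdd_3x5 : gdd [:: 3; 3; 3; 3; 3].
Proof. by apply: (@gdd_checkP _ blocks_3x5); vm_compute. Qed.

Lemma gdd_03x5 : gdd [:: 0; 3; 3; 3; 3; 3].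
Proof. by apply: (@gdd_checkP _ blocks_3x5); vm_compute. Qed.

Lemma gdd_6_3x5 : gdd [:: 6; 3; 3; 3; 3; 3].
Proof. by apply: (@gdd_checkP _ blocks_6_3x5); vm_compute. Qed.

Lemma gdd_3x8 : gdd (nseq 8 3).
Proof. by apply: (@gdd_checkP _ blocks_3x8); vm_compute. Qed.

Lemma gdd_3x9 : gdd (nseq 9 3).
Proof. by apply: (@gdd_checkP _ blocks_3x9); vm_compute. Qed.

Lemma gdd_3x12 : gdd (nseq 12 3).
Proof. by apply: (@gdd_checkP _ blocks_3x12); vm_compute. Qed.

Lemma gdd_3x13 : gdd (nseq 13 3).
Proof. by apply: (@gdd_checkP _ blocks_3x13); vm_compute. Qed.

Lemma gdd_2x7 : gdd (nseq 7 2).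
Proof. by apply: (@gdd_checkP _ blocks_2x7); vm_compute. Qed.

Lemma gdd_2x10 : gdd (nseq 10 2).
Proof. by apply: (@gdd_checkP _ blocks_2x10); vm_compute. Qed.

Lemma gdd_006x5 : gdd [:: 0; 0; 6; 6; 6; 6; 6].
Proof. by apply: (@gdd_checkP _ blocks_6x5); vm_compute. Qed.

Lemma gdd_06x6 : gdd [:: 0; 6; 6; 6; 6; 6; 6].
Proof. by apply: (@gdd_checkP _ blocks_6x6); vm_compute. Qed.

Lemma gdd_306x5 : gdd [:: 3; 0; 6; 6; 6; 6; 6].
Proof. by apply: (@gdd_checkP _ blocks_3_6x5); vm_compute. Qed.

Lemma gdd_36x6 : gdd [:: 3; 6; 6; 6; 6; 6; 6].
Proof. by apply: (@gdd_checkP _ blocks_3_6x6); vm_compute. Qed.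

Lemma gdd_1x4 : gdd [:: 1; 1; 1; 1].
Proof. by apply: (@gdd_checkP _ [:: [:: 0; 1; 2; 3]]); vm_compute. Qed.

Lemma td5_4 : td 5 4.
Proof. by apply: (@td_checkP _ _ array5_4); vm_compute. Qed.

Lemma td6_8 : td 6 8.
Proof. by apply: (@td_checkP _ _ array6_8); vm_compute. Qed.

Lemma linear_blocks30 : linear_check 30 blocks30.
Proof. by vm_compute. Qed.

Lemma linear_blocks31 : linear_check 31 blocks31.
Proof. by vm_compute. Qed.

(** * Designs of type 3^s *)
Lemma sumn_map_lt c t m : t <= m -> sumn [seq c * (i < t) | i <- iota 0 m] = c * t.
Proof.
move=> tm; rewrite -(subnKC tm) iotaD map_cat sumn_cat add0n.
have -> : [seq c * (i < t) | i <- iota 0 t] = [seq c | _ <- iota 0 t].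
  by apply/eq_in_map => i; rewrite mem_iota => /= ->; rewrite muln1.
have -> : [seq c * (i < t) | i <- iota t (m - t)] = [seq 0 | _ <- iota t (m - t)].
  by apply/eq_in_map => i; rewrite mem_iota => /andP[/leq_gtF-> _]; rewrite muln0.
by rewrite !sumn_map_const size_iota mul0n addn0.
Qed.

(** All weights are 3, except for m - t points of weight 0 in the first group; a block therefore
    becomes type 3^5 or 3^4. *)
Lemma gdd_wilson5 m t : td 5 m -> t <= m -> gdd (3 * t :: nseq 4 (3 * m)).
Proof.
move=> tdm tm; pose wt (p : nat * nat) := if p.1 == 0 then 3 * (p.2 < t) else 3.
have := @td_wilson 5 m wt tdm; rewrite /= /wt /= sumn_map_lt // !sumn_map_const size_iota.
apply=> -[|a [|b [|c [|d [|e [|f l]]]]]] //= _ _.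
by case: (a < t); [exact: gdd_3x5|exact: gdd_03x4].
Qed.

Lemma gdd_wilson6 m r : td 6 m -> r <= m -> gdd (6 * r :: nseq 5 (3 * m)).
Proof.
move=> tdm rm; pose wt (p : nat * nat) := if p.1 == 0 then 6 * (p.2 < r) else 3.
have := @td_wilson 6 m wt tdm; rewrite /= /wt /= sumn_map_lt // !sumn_map_const size_iota.
apply=> -[|a [|b [|c [|d [|e [|f [|g l]]]]]]] //= _ _.
by case: (a < r); [exact: gdd_6_3x5|exact: gdd_03x5].
Qed.

(** The first two groups are truncated, with weights 3 and 6. In the applications [e] is 0 or 1, and
    [e = 1] yields the part of size 3 that two further points turn into the part of size 5. *)
Lemma gdd_wilson7 m e r :
  td 7 m -> e <= m -> r <= m -> gdd [:: 3 * e, 6 * r & nseq 5 (6 * m)].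
Proof.
move=> tdm em rm.
pose wt (p : nat * nat) :=
  if p.1 == 0 then 3 * (p.2 < e) else if p.1 == 1 then 6 * (p.2 < r) else 6.
have := @td_wilson 7 m wt tdm; rewrite /= /wt /= !sumn_map_lt // !sumn_map_const size_iota.
apply=> -[|a [|b [|c [|d [|f [|g [|h [|i l]]]]]]]] //= _ _.
by case: (a < e); case: (b < r);
  [exact: gdd_36x6|exact: gdd_306x5|exact: gdd_06x6|exact: gdd_006x5].
Qed.

Lemma gdd_fill_nseq w g c a x k :
    gdd (g :: nseq k (a * x)) -> gdd (w :: nseq a x) -> c = k * a ->
  gdd (w + g :: nseq c x).
Proof.
move=> gk ga ->; have -> : nseq (k * a) x = flatten (nseq k (nseq a x)).
  by elim: k {gk} => //= k <-; rewrite mulSn nseqD.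
apply: gdd_fill => [|s /nseqP[-> _] //].
by rewrite map_nseq sumn_nseq mulnC.
Qed.

Lemma gdd_sub_nseq x a b c :
  gdd (a * x :: nseq b x) -> gdd (nseq a x) -> c = a + b -> gdd (nseq c x).
Proof. by move=> gb ga ->; rewrite nseqD; apply: gdd_sub gb ga _; rewrite sumn_nseq mulnC. Qed.

Definition gdd3 s := gdd (nseq s 3).

(** After the adjunction of 3k points, the four large parts are filled with type 3^(m + k) and the
    remaining 3q points with type 3^q. *)
Lemma gdd3_step5 m k q :
    td 5 m -> k <= 1 -> gdd3 (m + k) -> gdd3 q -> k <= q <= m + k ->
  gdd3 (4 * m + q).
Proof.
move=> tdm k1 gm gq /andP[kq qm]; have tm : q - k <= m by lia.
apply: (@gdd_sub_nseq 3 q (4 * m)) => //; last by rewrite addnC.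
have -> : q * 3 = 3 * k + 3 * (q - k) by lia.
apply: (@gdd_fill_nseq _ _ _ m 3 4) => //; first by rewrite (mulnC m); apply: gdd_wilson5.
by case: k k1 gm {kq qm tm} => [|[|//]] _; rewrite ?addn0 ?addn1 // => gm; apply/gdd_cons0.
Qed.

Lemma td_prime_to_6 m : coprime m 6 -> td 5 m.
Proof. exact: (@td_cyclic 3 m). Qed.

(** The new point completes every part of size 3 to a block. *)
Lemma gdd3_add_point g s : gdd (g :: nseq s 3) -> gdd (g.+1 :: nseq (3 * s) 1).
Proof. by move=> gs; apply: (@gdd_fill_nseq 1 g _ 3 1 s gs gdd_1x4); rewrite mulnC. Qed.

Lemma gdd3_base s : s \in [:: 0; 1; 4; 5; 8; 9; 12; 13] -> gdd3 s.
Proof.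
rewrite !inE; repeat case/orP; move/eqP->.
- exact: gdd_nil.
- exact: gdd_one.
- exact: gdd_3x4.
- exact: gdd_3x5.
- exact: gdd_3x8.
- exact: gdd_3x9.
- exact: gdd_3x12.
- exact: gdd_3x13.
Qed.

(** 28 is out of reach of the recursion in [gdd3_exists]. A point added to type 3^9 gives a Steiner
    system S(2, 4, 28), whose points are then tripled. *)
Lemma gdd3_28 : gdd3 28.
Proof.
have g28 : gdd (nseq 28 1).
  by apply: (@gdd_sub _ [:: 1]) (gdd_one 1) _ => //; apply: (@gdd3_add_point 0 9); apply/gdd_cons0/gdd_3x9.
have g3 : gdd (nseq 4 3) := gdd_3x4.
by have := gdd_inflate g3 g28; rewrite map_nseq.
Qed.

(** 44 is the other value missed by the recursion. A TD(6, 8) with weight 6 on two points of the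
    first group gives type 12 24^5; then 24 is split as 3^8 and 12 as 3^4. *)
Lemma gdd3_44 : gdd3 44.
Proof.
apply: (@gdd_sub_nseq 3 4 40) gdd_3x4 _ => //.
apply: (@gdd_fill_nseq 0 12 _ 8 3 5) => //; last by apply/gdd_cons0/gdd_3x8.
exact: (@gdd_wilson6 8 2) td6_8 _.
Qed.

Lemma gdd3_exists s : s %% 4 <= 1 -> gdd3 s.
Proof.
have [n] := ubnP s; elim: n s => // n IHn s sn s4.
have step m k : td 5 m -> k <= 1 -> (m + k) %% 4 <= 1 -> m + k < s ->
    4 * m + k <= s -> s <= 5 * m + k -> gdd3 s.
  move=> tdm k1 mk4 mks lo hi; have -> : s = 4 * m + (s - 4 * m) by lia.
  by apply: (gdd3_step5 tdm k1); [apply: IHn|apply: IHn|]; lia.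
have [s_lt|s_ge] := ltnP s 101; last first.
  (* [m] is prime to 6 and is 1 or 3 modulo 4, which decides between k = 0 and k = 1. Since 4m + 1
     <= s <= 4m + 24, the bound s <= 5m holds as soon as m >= 24, whence the threshold 101 = 24 * 4
     + 5. *)
  pose m := 6 * ((s - 5) %/ 24) + 1.
  have tdm : td 5 m.
    by apply: td_prime_to_6; rewrite /m mulnC coprime_sym /coprime gcdnMDl gcdn1.
  have [m4|m4] : (m %% 4 <= 1) \/ ((m + 1) %% 4 <= 1) by rewrite /m; lia.
    by apply: (step m 0) => //; rewrite /m in m4 *; lia.
  by apply: (step m 1) => //; rewrite /m in m4 *; lia.
have [s_base|s_nbase] := boolP (s \in [:: 0; 1; 4; 5; 8; 9; 12; 13]); first exact: gdd3_base.
have [->|s28] := eqVneq s 28; first exact: gdd3_28.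
have [->|s44] := eqVneq s 44; first exact: gdd3_44.
pose good s m k := [&& (m \in [:: 4; 8]) || coprime m 6, (m + k) %% 4 <= 1, m + k < s,
  4 * m + k <= s & s <= 5 * m + k].
have /hasP[m _ /hasP[k + /and5P[tdm mk4 mks lo hi]]] :
    has (fun m => has (good s m) [:: 0; 1]) (iota 4 22).
  have : all (fun s => [|| s \in [:: 0; 1; 4; 5; 8; 9; 12; 13; 28; 44], 1 < s %% 4
      | has (fun m => has (good s m) [:: 0; 1]) (iota 4 22)]) (iota 0 101) by vm_compute.
  move/allP/(_ s); rewrite mem_iota => /(_ s_lt) /or3P[||//]; last by rewrite ltnNge s4.
  by move=> H; exfalso; move: H s_nbase s28 s44; rewrite !inE; lia.
rewrite !inE => /orP kE; apply: (step m k) => //; last by case: kE => /eqP->.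
case/orP: tdm => [|/td_prime_to_6 //]; rewrite !inE => /orP[]/eqP->; first exact: td5_4.
exact: td_take td6_8 _.
Qed.

(** * Designs of type 2^s, 5^1 2^s, 6^1 3^s and 30^1 3^s *)
Lemma residue_steps (P : nat -> Prop) M d t k :
    (forall t, P t -> exists2 t', P t' & t' = t + d %[mod M]) ->
  P t -> exists2 t', P t' & t' = t + k * d %[mod M].
Proof.
move=> step Pt; elim: k => [|k [t' Pt' E]]; first by exists t; rewrite ?addn0.
have [t'' Pt'' E'] := step _ Pt'; exists t'' => //.
by rewrite E' -modnDml E modnDml mulSnr addnA.
Qed.

(** The step fixes the residue of M j + d + t, and [j] is arbitrary beyond a bound, so a single [t]
    in a class provides all large members of the class shifted by [d]. The classes are then
    collected one after the other. *)
Lemma eventually_of_residues (P : nat -> Prop) (D : pred nat) M d :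
    0 < M ->
    (forall t, P t -> exists K, forall j, K <= j -> P (M * j + d + t)) ->
    (forall a, a < M -> D a -> exists2 t, P t & t = a %[mod M]) ->
  exists N, forall s, N <= s -> D ((s - d) %% M) -> P s.
Proof.
move=> M_gt0 step rep.
suff H n : n <= M -> exists N, forall s, N <= s -> (s - d) %% M < n -> D ((s - d) %% M) -> P s.
  by have [N HN] := H M (leqnn M); exists N => s /HN; apply; rewrite ltn_pmod.
elim: n => [|n IHn] nM; first by exists 0.
have [N HN] := IHn (ltnW nM); have [Dn|nDn] := boolP (D n); last first.
  exists N => s Ns; rewrite ltnS leq_eqVlt => /predU1P[->|]; last exact: HN.
  by rewrite (negPf nDn).
have [t Pt tE] := rep n nM Dn; have [K HK] := step t Pt.
exists (maxn N (M * K + d + t)) => s; rewrite geq_max => /andP[Ns Ks].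
rewrite ltnS leq_eqVlt => /predU1P[sn _|]; last exact: HN.
have st : s - d - t = M * ((s - d - t) %/ M).
  rewrite mulnC divnK // -eqn_mod_dvd; last by lia.
  by rewrite sn -(modn_small nM) tE eqxx.
have -> : s = M * ((s - d - t) %/ M) + d + t by rewrite -st; lia.
by apply: HK; rewrite leq_divRL // mulnC; lia.
Qed.

(** The number of parts is 1 modulo 3 because a point of type 2^u has 2 (u - 1) neighbours, in
    triples. *)
Definition gdd2 s := gdd (nseq (3 * s).+1 2).

(** Type 3^u inflated by 4 is 12^u; with two more points each part is filled by type 2^7. *)
Lemma gdd2_double u : u %% 4 <= 1 -> gdd2 (2 * u).
Proof.
move=> /gdd3_exists gu; have g4 : gdd (nseq 4 4) := gdd_td gdd_1x4 (td_take td5_4 (isT : 4 <= 5)).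
have := gdd_inflate g4 gu; rewrite map_nseq => /gdd_cons0 g12.
by apply: (@gdd_fill_nseq 2 0 _ 6 2 u g12 gdd_2x7); lia.
Qed.

(** A TD(5, 4u) with 2b points kept in the first group gives parts 6b and four times 12u. Two more
    points make 12u + 2 = 2 (6u + 1), which [gdd2_double] fills, and 6b + 2 = 2 (3b + 1). *)
Lemma gdd2_step8 u b :
  u %% 4 <= 1 -> coprime u 6 -> b <= 2 * u -> gdd2 b -> gdd2 (8 * u + b).
Proof.
move=> u4 cu bu gb; have tdu : td 5 (u * 4).
  by apply: td_prod => //; [exact: td_prime_to_6|exact: td5_4].
apply: (@gdd_sub_nseq 2 (3 * b).+1 (24 * u)) gb _; last by lia.
have -> : (3 * b).+1 * 2 = 2 + 3 * (2 * b) by lia.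
apply: (@gdd_fill_nseq 2 _ _ (6 * u) 2 4); last by lia.
  have -> : 6 * u * 2 = 3 * (u * 4) by lia.
  by apply: gdd_wilson5 => //; lia.
have := gdd2_double u4; rewrite /gdd2 (_ : (3 * (2 * u)).+1 = (6 * u).+1) //; lia.
Qed.

Lemma td_prime_to_120 m : coprime m 120 -> td 7 m.
Proof. by move=> cm; apply: (@td_cyclic 5); rewrite (_ : 5`! = 120). Qed.

(** Parts 6r and five times 6m; with two more points these are 2 (3r + 1) and 2 (3m + 1). *)
Lemma gdd2_step5 m r :
  coprime m 120 -> r <= m -> gdd2 m -> gdd2 r -> gdd2 (5 * m + r).
Proof.
move=> /td_prime_to_120 tdm rm gm gr.
apply: (@gdd_sub_nseq 2 (3 * r).+1 (15 * m)) gr _; last by lia.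
have -> : (3 * r).+1 * 2 = 2 + 6 * r by lia.
apply: (@gdd_fill_nseq 2 _ _ (3 * m) 2 5); last by lia.
  have -> : 3 * m * 2 = 6 * m by lia.
  by apply/gdd_cons0; apply: (@gdd_wilson7 m 0 r tdm).
exact: gm.
Qed.

Lemma gdd2_residue_step8 t :
  gdd2 t -> exists K, forall j, K <= j -> gdd2 (480 * j + 8 + t).
Proof.
move=> gt; exists t => j tj; have -> : 480 * j + 8 + t = 8 * (60 * j + 1) + t by lia.
apply: gdd2_step8 => //; [lia| |lia].
by rewrite coprime_sym /coprime (_ : 60 * j = 10 * j * 6) ?gcdnMDl ?gcdn1 //; lia.
Qed.

(** These values can serve as [m] in [gdd2_step5], since 11 is prime to 120 and 120 divides 480;
    they are the source of the step 55 = 5 * 11. The residue 11 is 8 + 3, starting from type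
    2^10. *)
Lemma gdd2_480 j : 0 < j -> gdd2 (480 * j + 11).
Proof.
move=> j_gt0; have -> : 480 * j + 11 = 8 * (60 * j + 1) + 3 by lia.
apply: (@gdd2_step8 (60 * j + 1) 3); [lia| |lia|exact: gdd_2x10].
by rewrite coprime_sym /coprime (_ : 60 * j = 10 * j * 6) ?gcdnMDl ?gcdn1 //; lia.
Qed.

(* The steps t -> t + 8 and t -> t + 55 reach everything, as
   7 * 55 + 12 * 8 = 1 modulo 480. *)
Lemma gdd2_residue a : exists2 t, gdd2 t & t = a %[mod 480].
Proof.
have step8 t : gdd2 t -> exists2 t', gdd2 t' & t' = t + 8 %[mod 480].
  move=> /gdd2_residue_step8[K /(_ K (leqnn K)) gK]; exists (480 * K + 8 + t) => //.
  by rewrite -addnA mulnC modnMDl addnC.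
have step55 t : gdd2 t -> exists2 t', gdd2 t' & t' = t + 55 %[mod 480].
  move=> gt; exists (5 * (480 * t.+1 + 11) + t); last by lia.
  apply: gdd2_step5 (gdd2_480 (ltn0Sn t)) gt; last by lia.
  by rewrite coprime_sym /coprime (_ : 480 * t.+1 = 4 * t.+1 * 120) ?gcdnMDl //; lia.
have step1 t : gdd2 t -> exists2 t', gdd2 t' & t' = t + 1 %[mod 480].
  move=> /(residue_steps 7 step55)[t' /(residue_steps 12 step8)[t'' gt'' E'] E].
  by exists t'' => //; lia.
have [t gt tE] := residue_steps a step1 (gdd_one 2 : gdd2 0); exists t => //.
by rewrite tE muln1.
Qed.

Lemma gdd2_eventually : exists N, forall s, N <= s -> gdd2 s.
Proof.
have [//|a _ _|N HN] := @eventually_of_residues gdd2 predT 480 8 _ gdd2_residue_step8.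
  exact: gdd2_residue.
by exists N => s /HN; apply.
Qed.

Lemma gdd_5_2_eventually : exists N, forall s, N <= s -> gdd (5 :: nseq (3 * s) 2).
Proof.
have [N HN] := gdd2_eventually; exists (600 * (N + 5) + N + 5) => s Hs.
(* The choice gives s = r + 5m with [m] prime to 120. The lower bound on [s] makes m >= 120 (N + 5)
   + 1, which exceeds both [N] and r <= N + 599. *)
pose r := N + (s - 5 - N) %% 600; pose m := 120 * ((s - 5 - N) %/ 600) + 1.
have -> : nseq (3 * s) 2 = flatten (nseq (3 * r) 2 :: nseq 5 (nseq (3 * m) 2)).
  by rewrite /= cats0 -!nseqD; congr nseq; rewrite /r /m; lia.
apply: (@gdd_fill 2 3) => [|l].
  have tdm : td 7 m.
    by apply: td_prime_to_120; rewrite /m mulnC coprime_sym /coprime gcdnMDl gcdn1.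
  have := @gdd_wilson7 m 1 r tdm; rewrite /= !sumn_nseq.
  have -> : 2 * (3 * r) = 6 * r by lia.
  have -> : 2 * (3 * m) = 6 * m by lia.
  by apply; rewrite /m /r; lia.
rewrite inE => /predU1P[->|/nseqP[-> _]]; first by apply: HN; rewrite /r; lia.
by apply: HN; rewrite /m; lia.
Qed.

(** A design with the hole fits into the truncated first part 3 (h + t) of a larger one, so the hole
    survives the addition of 4m parts of size 3. The values u = 0 and [u1] start the residues 0 and
    1 modulo 4. *)
Lemma gdd_hole3_eventually h u1 :
    gdd (3 * h :: nseq u1 3) -> u1 %% 4 = 1 ->
  exists N, forall u, N <= u -> u %% 4 <= 1 -> gdd (3 * h :: nseq u 3).
Proof.
move=> gu1 u14; pose P u := gdd (3 * h :: nseq u 3).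
have stepP t : P t -> exists K, forall j, K <= j -> P (48 * j + 4 + t).
  move=> gt; exists (h + t) => j htj; pose m := 12 * j + 1.
  rewrite /P (_ : _ + t = t + 4 * m); last by rewrite /m; lia.
  rewrite nseqD -cat_cons; apply: (@gdd_sub (3 * (h + t))) gt _; last first.
    by rewrite /= sumn_nseq mulnDr.
  apply: (@gdd_fill_nseq 0 _ _ m 3 4) => //.
    rewrite (mulnC m); apply: gdd_wilson5; last by rewrite /m; lia.
    apply: td_prime_to_6; rewrite /m (_ : 12 * j = 2 * j * 6); last by lia.
    by rewrite coprime_sym /coprime gcdnMDl gcdn1.
  by apply/gdd_cons0/gdd3_exists; rewrite /m; lia.
have [//|a _ a4|N HN] := @eventually_of_residues P [pred a | a %% 4 <= 1] 48 4 _ stepP.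
  have step4 t : P t -> exists2 t', P t' & t' = t + 4 %[mod 48].
    by move=> /stepP[K /(_ K (leqnn K)) gK]; exists (48 * K + 4 + t) => //; lia.
  have [t0 P0 t04] : exists2 t, P t & t = a %% 4 %[mod 4].
    move: a4; rewrite inE; case E: (a %% 4) => [|[|//]] _.
      by exists 0 => //; apply: gdd_one.
    by exists u1.
  have [t Pt tE] := residue_steps ((a + 48 * t0 - t0) %/ 4) step4 P0.
  by exists t => //; rewrite tE; lia.
by exists (N + 4) => u Nu u4; apply: HN; rewrite ?inE; lia.
Qed.

Lemma gdd_6_3_eventually :
  exists N, forall u, N <= u -> u %% 4 <= 1 -> gdd (6 :: nseq u 3).
Proof. exact: (@gdd_hole3_eventually 2 5 gdd_6_3x5). Qed.

Lemma gdd_30_3_eventually :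
  exists N, forall u, N <= u -> u %% 4 <= 1 -> gdd (30 :: nseq u 3).
Proof.
apply: (@gdd_hole3_eventually 10 25) => //.
apply: (@gdd_fill_nseq 0 30 _ 5 3 5) => //; last by apply/gdd_cons0/gdd3_exists.
(* In a TD(6, 5) the whole first group gets weight 6: type 30 15^5, and each 15 is split as 3^5. *)
exact: (@gdd_wilson6 5 5 (@td_cyclic 4 5 isT)).
Qed.

(** * Triple systems from designs *)
Lemma imset_triple5 (V : finType) (f : 'I_5 -> V) a b c :
  f @: triple5 a b c = [set f (inord a.-1); f (inord b.-1); f (inord c.-1)].
Proof. by rewrite /triple5 !imsetU !imset_set1. Qed.

Lemma uniq_map_ord5 (V : finType) (f : 'I_5 -> V) :
  injective f ->
  uniq [:: f (inord 0); f (inord 1); f (inord 2); f (inord 3); f (inord 4)].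
Proof.
move=> finj; rewrite -[[:: _; _; _; _; _]]/(map (fun i => f (inord i)) (iota 0 5)).
rewrite map_inj_in_uniq ?iota_uniq // => i j; rewrite !mem_iota !add0n => /= i5 j5 /finj E.
by rewrite -(inordK i5) E inordK.
Qed.

Lemma containsD (V : finType) (H : {set {set V}}) :
  reflect (exists a b c d e, [/\ uniq [:: a; b; c; d; e], [set a; b; c] \in H,
             [set a; c; d] \in H & [set b; c; e] \in H])
          (contains H confD).
Proof.
apply: (iffP existsP) => [[f /andP[/injectiveP/uniq_map_ord5 uf /forall_inP fH]]|].
  exists (f (inord 0)), (f (inord 1)), (f (inord 2)), (f (inord 3)), (f (inord 4)); split=> //.
  - by rewrite -(imset_triple5 f 1 2 3); apply: fH; rewrite !inE eqxx ?orbT.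
  - by rewrite -(imset_triple5 f 1 3 4); apply: fH; rewrite !inE eqxx ?orbT.
  - by rewrite -(imset_triple5 f 2 3 5); apply: fH; rewrite !inE eqxx ?orbT.
case=> [a [b [c [d [e [u5 H1 H2 H3]]]]]].
pose f := [ffun i : 'I_5 => nth a [:: a; b; c; d; e] i]; exists f; apply/andP; split.
  by apply/injectiveP=> i j; rewrite !ffunE => /eqP; rewrite nth_uniq // => /eqP/val_inj.
by apply/forall_inP=> t; rewrite !inE -orbA => /or3P[]/eqP->;
  rewrite imset_triple5 !ffunE !inordK.
Qed.

Lemma containsB (V : finType) (H : {set {set V}}) :
  reflect (exists a b c d e, [/\ uniq [:: a; b; c; d; e], [set a; b; e] \in H,
             [set a; c; d] \in H & [set b; c; d] \in H])
          (contains H confB).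
Proof.
apply: (iffP existsP) => [[f /andP[/injectiveP/uniq_map_ord5 uf /forall_inP fH]]|].
  exists (f (inord 0)), (f (inord 1)), (f (inord 2)), (f (inord 3)), (f (inord 4)); split=> //.
  - by rewrite -(imset_triple5 f 1 2 5); apply: fH; rewrite !inE eqxx ?orbT.
  - by rewrite -(imset_triple5 f 1 3 4); apply: fH; rewrite !inE eqxx ?orbT.
  - by rewrite -(imset_triple5 f 2 3 4); apply: fH; rewrite !inE eqxx ?orbT.
case=> [a [b [c [d [e [u5 H1 H2 H3]]]]]].
pose f := [ffun i : 'I_5 => nth a [:: a; b; c; d; e] i]; exists f; apply/andP; split.
  by apply/injectiveP=> i j; rewrite !ffunE => /eqP; rewrite nth_uniq // => /eqP/val_inj.
by apply/forall_inP=> t; rewrite !inE -orbA => /or3P[]/eqP->;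
  rewrite imset_triple5 !ffunE !inordK.
Qed.

(** * Triples inside the blocks of a partial linear space *)

Definition linear (n : nat) (P : seq (seq nat)) : Prop :=
  all (fun b => uniq b && all (ltn^~ n) b) P /\
  forall x y, x != y -> count (covers x y) P <= 1.

Definition block_set n (b : seq nat) : {set 'I_n} := [set i : 'I_n | val i \in b].

Definition triples_in n (P : seq (seq nat)) : {set {set 'I_n}} :=
  [set e : {set 'I_n} | (#|e| == 3) && has (fun b => e \subset block_set n b) P].

Lemma card_block_set n b : uniq b -> all (ltn^~ n) b -> #|block_set n b| = size b.
Proof.
move=> ub /allP lb; rewrite cardE -(size_map val); apply: perm_size.
apply: uniq_perm => //; first by rewrite map_inj_uniq ?enum_uniq //; apply: val_inj.
move=> x; apply/mapP/idP => [[i] | xb]; first by rewrite mem_enum inE => xb ->.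
by exists (Ordinal (lb x xb)); rewrite // mem_enum inE.
Qed.

Lemma count_le1_eq (T : eqType) (p : pred T) (l : seq T) a b :
  count p l <= 1 -> a \in l -> b \in l -> p a -> p b -> a = b.
Proof.
move=> + al bl pa pb; rewrite -size_filter.
have : a \in filter p l by rewrite mem_filter pa.
have : b \in filter p l by rewrite mem_filter pb.
by case: (filter p l) => [|c [|? ?]] //; rewrite !inE => /eqP-> /eqP->.
Qed.

Lemma sum_seq_count (T : Type) (p : pred T) (l : seq T) :
  \sum_(x <- l) p x = count p l.
Proof. by rewrite -sumn_count sumnE big_map. Qed.

Lemma triple_two (T : finType) (e : {set T}) :
  #|e| = 3 -> exists x y, [/\ x != y, x \in e & y \in e].
Proof.
move=> e3; have /card_gt1P[x [y [xe ye xy]]] : 1 < #|e| by rewrite e3.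
by exists x, y.
Qed.

(** A triple contains a pair and so lies in at most one block: the sum over blocks counts nothing
    twice. *)
Lemma card_triples_in n P :
  linear n P -> #|triples_in n P| = \sum_(b <- P) 'C(size b, 3).
Proof.
move=> [okP linP].
transitivity (\sum_(b <- P) #|[set e : {set 'I_n} | (e \subset block_set n b) && (#|e| == 3)]|).
  under eq_bigr => b _ do rewrite -sum1_card big_mkcond /=.
  rewrite exchange_big /= -sum1_card big_mkcond /=; apply: eq_bigr => e _.
  under eq_bigr => b _ do rewrite inE.
  rewrite inE; case: eqP => /= [e3|_]; last by rewrite big1 // => b _; rewrite andbF.
  under eq_bigr => b _ do rewrite andbT -[if _ then _ else _]/(nat_of_bool _).
  rewrite sum_seq_count has_count.
  have [x [y [xy xe ye]]] := triple_two e3.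
  suff : count (fun b => e \subset block_set n b) P <= 1 by case: count => [|[]].
  apply: leq_trans (linP (val x) (val y) xy); apply: sub_count => b /subsetP eb.
  by have := eb x xe; have := eb y ye; rewrite !inE /covers => -> ->.
rewrite !big_seq; apply: eq_bigr => b bP; rewrite cards_draws.
by have /andP[ub lb] := allP okP b bP; rewrite card_block_set.
Qed.

Lemma same_block n P (e e' : {set 'I_n}) (x y : 'I_n) c :
    linear n P -> e \in triples_in n P -> e' \in triples_in n P -> x != y ->
    x \in e -> y \in e -> x \in e' -> y \in e' ->
  c \in P -> e \subset block_set n c -> e' \subset block_set n c.
Proof.
move=> [_ linP]; rewrite !inE => /andP[_ _] /andP[_ /hasP[c' c'P ec']] xy xe ye xe' ye' cP ec.
suff -> : c = c' by [].
apply: (count_le1_eq (linP (val x) (val y) xy)) => //.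
  by have := subsetP ec x xe; have := subsetP ec y ye; rewrite !inE /covers => -> ->.
by have := subsetP ec' x xe'; have := subsetP ec' y ye'; rewrite !inE /covers => -> ->.
Qed.

Lemma no_five_in_block n P c (p q r s t : 'I_n) :
    linear n P -> all (fun b => size b <= 4) P -> c \in P -> uniq [:: p; q; r; s; t] ->
  ~~ all (mem (block_set n c)) [:: p; q; r; s; t].
Proof.
move=> [okP _] sP cP u5; have := allP sP c cP; have /andP[uc lc] := allP okP c cP.
rewrite -(card_block_set uc lc); apply: contraTN => /allP sub5.
rewrite -ltnNge -[5]/(size [:: p; q; r; s; t]) -(card_uniqP u5).
by apply: subset_leq_card; apply/subsetP.
Qed.

Lemma uniq5_neq (T : eqType) (a b c d e : T) : uniq [:: a; b; c; d; e] ->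
  [/\ a != c, b != c, a != b & c != d].
Proof.
rewrite /= !inE !negb_or => /and5P[/and4P[ab ac _ _] /and3P[bc _ _] /andP[cd _] _ _].
by split.
Qed.

(** The middle triple p q r shares a pair with each of the other two, so all three lie in one block,
    which would have five points. *)
Lemma triples_in_D_free n P :
  linear n P -> all (fun b => size b <= 4) P -> ~~ contains (triples_in n P) confD.
Proof.
move=> linP sP; apply/negP => /containsD[p [q [r [s [t [u5 e1 e2 e3]]]]]].
have [pr qr _ _] := uniq5_neq u5.
have := e1; rewrite inE => /andP[_ /hasP[c cP e1c]].
have e2c : [set p; r; s] \subset block_set n c.
  by apply: (same_block (x := p) (y := r) linP e1 e2) => //; rewrite !inE eqxx ?orbT.
have e3c : [set q; r; t] \subset block_set n c.
  by apply: (same_block (x := q) (y := r) linP e1 e3) => //; rewrite !inE eqxx ?orbT.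
have /negP[] := no_five_in_block linP sP cP u5.
by move: e1c e2c e3c; rewrite !subUset !sub1set /= =>
  /andP[/andP[-> ->] ->] /andP[_ ->] /andP[_ ->].
Qed.

(** Two triples share the pair r s and hence a block. The third meets each of them in one vertex
    only, but its pair p q lies in that block, which again would have five points. *)
Lemma triples_in_B_free n P :
  linear n P -> all (fun b => size b <= 4) P -> ~~ contains (triples_in n P) confB.
Proof.
move=> linP sP; apply/negP => /containsB[p [q [r [s [t [u5 e1 e2 e3]]]]]].
have [_ _ pq rs] := uniq5_neq u5.
have := e2; rewrite inE => /andP[_ /hasP[c cP e2c]].
have e3c : [set q; r; s] \subset block_set n c.
  by apply: (same_block (x := r) (y := s) linP e2 e3) => //; rewrite !inE eqxx ?orbT.
have e1c : [set p; q; t] \subset block_set n c.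
  move: e2c e3c; rewrite !subUset !sub1set => /andP[/andP[pc rc] sc] /andP[/andP[qc _] _].
  have := e1; rewrite inE => /andP[_ /hasP[c' c'P e1c']].
  suff -> : c = c' by move: e1c'; rewrite !subUset !sub1set.
  apply: (count_le1_eq (proj2 linP (val p) (val q) pq)) => //; first by move: pc qc; rewrite !inE /covers => -> ->.
  by move: e1c'; rewrite !subUset !sub1set !inE /covers => /andP[/andP[-> ->]].
have /negP[] := no_five_in_block linP sP cP u5.
by move: e1c e2c e3c; rewrite !subUset !sub1set /= =>
  /andP[/andP[-> ->] ->] /andP[/andP[_ ->] ->] _.
Qed.

Definition book n (a b : 'I_n) (X : {set 'I_n}) : {set {set 'I_n}} :=
  [set [set a; b; x] | x in X].

(** Two vertices of a page triple include [a] or [b], so no page triple shares a pair with a triple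
    inside a block. A copy of [confD] therefore lies on one side. Inside the book its triples would
    have [a] and [b] in common, whereas they only have r in common. The pairs inside [X] may be
    covered. *)
Lemma triples_in_book_D_free n P (a b : 'I_n) (X : {set 'I_n}) :
    linear n P -> all (fun b => size b <= 4) P -> a != b ->
    (forall x y : 'I_n, x != y -> x \in [set a; b] -> y \in [set a; b] :|: X ->
       count (covers (val x) (val y)) P = 0) ->
  ~~ contains (triples_in n P :|: book a b X) confD.
Proof.
move=> linP sP ab uncov; apply/negP => /containsD[p [q [r [s [t [u5 e1 e2 e3]]]]]].
have [pr qr pq _] := uniq5_neq u5.
have apart (e e' : {set 'I_n}) x y : x != y -> x \in e -> y \in e -> x \in e' -> y \in e' ->
    e \in triples_in n P -> e' \in book a b X -> False.
  rewrite inE => xy xe ye xe' ye' /andP[_ /hasP[c cP ec]] /imsetP[z zX e'E].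
  have cov : (0 < count (covers (val x) (val y)) P) && (0 < count (covers (val y) (val x)) P).
    by have := subsetP ec x xe; have := subsetP ec y ye; rewrite !inE => yc xc;
      rewrite !(count_covers_gt0 cP).
  have mem2 u v : u != v -> u \in e' -> v \in e' -> u \in [set a; b] ->
      count (covers (val u) (val v)) P = 0.
    move=> uv _ ve' uab; apply: uncov => //; move: ve'; rewrite e'E !inE => /orP[->//|/eqP->].
    by rewrite zX orbT.
  have [xab|xab] := boolP (x \in [set a; b]); first by rewrite (mem2 x y) in cov.
  have [yab|yab] := boolP (y \in [set a; b]).
    by rewrite (mem2 y x) ?andbF // eq_sym in cov.
  move: xe' ye' xab yab xy; rewrite e'E !inE => /orP[->//|/eqP->] /orP[->//|/eqP->].
  by rewrite eqxx.
have in12 : (p \in [set p; q; r]) && (r \in [set p; q; r]) &&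
    (p \in [set p; r; s]) && (r \in [set p; r; s]) by rewrite !inE !eqxx ?orbT.
have in13 : (q \in [set p; q; r]) && (r \in [set p; q; r]) &&
    (q \in [set q; r; t]) && (r \in [set q; r; t]) by rewrite !inE !eqxx ?orbT.
case/andP: in12 => /andP[/andP[i1 i2] i3] i4; case/andP: in13 => /andP[/andP[j1 j2] j3] j4.
move: (apart _ _ p r pr i1 i2 i3 i4) (apart _ _ p r pr i3 i4 i1 i2)
  (apart _ _ q r qr j1 j2 j3 j4) (apart _ _ q r qr j3 j4 j1 j2) => A1 A2 A3 A4.
case/setUP: (e1) => E1; case/setUP: (e2) => E2; case/setUP: (e3) => E3; try by exfalso; auto.
  have /negP[] := triples_in_D_free linP sP.
  by apply/containsD; exists p, q, r, s, t.
have ain e : e \in book a b X -> (a \in e) && (b \in e).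
  by case/imsetP=> x _ ->; rewrite !inE !eqxx orbT.
have /andP[a1 b1] := ain _ E1; have /andP[a2 b2] := ain _ E2; have /andP[a3 b3] := ain _ E3.
have onlyr z : z \in [set p; q; r] -> z \in [set p; r; s] -> z \in [set q; r; t] -> z = r.
  move: u5; rewrite /= !inE !negb_or => /and5P[/and4P[_ _ ps pt] /and3P[_ qs qt] /andP[rs rt] _ _].
  case/orP=> [/orP[]|]/eqP-> //.
    by rewrite (negPf pq) (negPf pr) (negPf pt).
  by rewrite eq_sym (negPf pq) (negPf qr) (negPf qs).
by move: ab; rewrite (onlyr a) // (onlyr b) // eqxx.
Qed.

Lemma ex_num_ge n (H : {set {set 'I_n}}) Fs :
  triple_system H -> avoids H Fs -> #|H| <= ex_num n Fs.
Proof. by move=> tH aH; apply: leq_bigmax_cond; rewrite tH. Qed.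

Lemma ex_num_BD_le_D n : ex_num n [:: confB; confD] <= ex_num n [:: confD].
Proof.
apply/bigmax_leqP => H /andP[tH aH]; apply: ex_num_ge => //.
by move: aH; rewrite /avoids /= => /andP[].
Qed.

Lemma triple_system_triples_in n P : triple_system (triples_in n P).
Proof. by apply/forall_inP=> e; rewrite inE => /andP[]. Qed.

Lemma ex_num_ge_linear n P :
  linear n P -> all (fun b => size b <= 4) P ->
  \sum_(b <- P) 'C(size b, 3) <= ex_num n [:: confB; confD].
Proof.
move=> linP sP; rewrite -(card_triples_in linP); apply: ex_num_ge.
  exact: triple_system_triples_in.
by rewrite /avoids /= triples_in_B_free // triples_in_D_free.
Qed.

Lemma ex_num_ge_book n P (a b : 'I_n) (X : {set 'I_n}) :
    linear n P -> all (fun b => size b <= 4) P -> a != b -> a \notin X -> b \notin X ->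
    (forall x y : 'I_n, x != y -> x \in [set a; b] -> y \in [set a; b] :|: X ->
       count (covers (val x) (val y)) P = 0) ->
  \sum_(b <- P) 'C(size b, 3) + #|X| <= ex_num n [:: confD].
Proof.
move=> linP sP ab aX bX uncov.
have cb x : x \in X -> #|[set a; b; x]| = 3.
  move=> xX; have [xa xb] : x != a /\ x != b.
    by split; [apply: contraNneq aX | apply: contraNneq bX] => <-.
  by rewrite setUC cardsU1 cards2 !inE (negPf xa) (negPf xb) ab.
have -> : #|X| = #|book a b X|.
  rewrite card_in_imset // => x y xX yX /setP/(_ x); rewrite !inE eqxx orbT.
  by move=> /esym/orP[/orP[]|]/eqP // E; [move: aX|move: bX]; rewrite -E xX.
have disj : [disjoint triples_in n P & book a b X].
  apply/pred0P=> e /=; apply/negP=> /andP[]; rewrite inE => /andP[_ /hasP[c cP ec]].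
  case/imsetP=> x _ eE; have := uncov a b ab; rewrite !inE !eqxx orbT => /(_ isT isT) H0.
  have := subsetP ec a; have := subsetP ec b; rewrite eE !inE !eqxx orbT => /(_ isT) bc /(_ isT) ac.
  by have := count_covers_gt0 cP ac bc; rewrite H0.
rewrite -(card_triples_in linP) -cardsUI (disjoint_setI0 disj) cards0 addn0.
apply: ex_num_ge; last by rewrite /avoids /= andbT triples_in_book_D_free.
apply/forall_inP=> e /setUP[|/imsetP[x xX ->]]; last by rewrite cb.
by rewrite inE => /andP[].
Qed.

(** * Counting the blocks of a design with filled parts *)

Lemma sum_covers (L : seq (seq nat)) N :
  all (fun b => uniq b && all (ltn^~ N) b) L ->
  \sum_(0 <= x < N) \sum_(0 <= y < N) (x != y) * count (covers x y) L
    = \sum_(b <- L) size b * (size b).-1.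
Proof.
move=> okL; under eq_bigr => x _ do under eq_bigr => y _ do rewrite -sum_seq_count big_distrr.
under eq_bigr => x _ do rewrite exchange_big.
rewrite exchange_big /= !big_seq; apply: eq_bigr => b bL.
have /andP[ub /allP lb] := allP okL b bL.
have filtE (f : nat -> nat) : \sum_(0 <= x < N) (x \in b) * f x = \sum_(x <- b) f x.
  transitivity (\sum_(x <- [seq x <- index_iota 0 N | x \in b]) f x).
    by rewrite big_filter [RHS]big_mkcond; apply: eq_bigr => x _; case: (x \in b); rewrite ?mul1n.
  apply: perm_big; apply: uniq_perm => // [|x]; first by rewrite filter_uniq ?iota_uniq.
  by rewrite mem_filter mem_index_iota /=; apply: andb_idr => /lb.
transitivity (\sum_(0 <= x < N) (x \in b) * \sum_(0 <= y < N) (y \in b) * (x != y)).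
  apply: eq_bigr => x _; rewrite big_distrr; apply: eq_bigr => y _.
  by rewrite /covers /=; do 3 case: (_ \in _) || case: (_ == _).
rewrite filtE; under eq_bigr => x _ do rewrite filtE sum_seq_count.
rewrite big_seq; under eq_bigr => x xb.
  have -> : count (fun y => x != y) b = (size b).-1; last over.
  rewrite -(count_predC (pred1 x) b) count_uniq_mem // xb /=.
  by apply: eq_count => y /=; rewrite eq_sym.
by rewrite -big_seq big_const_seq count_predT iter_addn_0 mulnC.
Qed.

Lemma sum_multipartite s :
  \sum_(0 <= x < sumn s) \sum_(0 <= y < sumn s) multipartite s x y
    + sumn [seq g * g | g <- s] = sumn s * sumn s.
Proof.
elim: s => [|a s IHs]; first by rewrite big_geq.
have split3 (f : nat -> nat) : \sum_(0 <= x < a + sumn s) f x =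
    \sum_(0 <= x < a) f x + \sum_(0 <= x < sumn s) f (a + x).
  rewrite (@big_cat_nat _ _ _ a) ?leq_addr //=; congr (_ + _).
  by rewrite -{1}(add0n a) big_addn addKn; apply: eq_bigr => x _; rewrite addnC.
rewrite /= split3.
under eq_big_nat => x /andP[_ xa].
  rewrite split3 big_nat big1 => [|y /andP[_ ya]]; last by rewrite multipartite_cons xa leqNgt ya.
  rewrite add0n; under eq_big_nat => y /andP[_ ys] do
    rewrite multipartite_cons xa leq_addr ltn_add2l ys.
  rewrite sum_nat_const_nat subn0 muln1; over.
rewrite sum_nat_const_nat subn0.
under [X in _ * _ + X]eq_big_nat => x /andP[_ xs].
  rewrite split3.
  under eq_big_nat => y /andP[_ ya] do
    rewrite multipartite_cons ltnNge leq_addr /= ya ltn_add2l xs.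
  rewrite sum_nat_const_nat subn0 muln1.
  under eq_bigr => y _ do rewrite multipartite_cons !ltnNge !leq_addr /= !addKn.
  over.
rewrite big_split /= sum_nat_const_nat subn0; nia.
Qed.

(** [Q] is a packing inside the parts. The number [z] of quadruples comes from counting ordered
    pairs, 12 in each quadruple. *)
Lemma gdd_linear s Q :
    gdd s -> all (fun b => uniq b && all (ltn^~ (sumn s)) b) Q ->
    all (fun b => size b <= 4) Q ->
    (forall x y, x != y -> multipartite s x y + count (covers x y) Q <= 1) ->
  exists P z, [/\ linear (sumn s) P, all (fun b => size b <= 4) P,
    forall x y, x != y -> count (covers x y) P = multipartite s x y + count (covers x y) Q,
    \sum_(b <- P) 'C(size b, 3) = 4 * z + \sum_(b <- Q) 'C(size b, 3)
    & 12 * z + sumn [seq g * g | g <- s] = sumn s * sumn s].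
Proof.
move=> [L [uL cL] sL] okQ sQ cQ; exists (L ++ Q), (size L).
have okL : all (fun b => uniq b && all (ltn^~ (sumn s)) b) L.
  apply/allP=> b bL; have ub := allP uL b bL; rewrite ub; apply/allP=> x xb.
  have [|y yb xy] := uniq_gt1_neq ub _ xb; first by rewrite (eqP (allP sL _ bL)).
  have := count_covers_gt0 bL xb yb; rewrite cL // lt0b => /multipartite_lt.
  by case/andP.
have cP x y : x != y -> count (covers x y) (L ++ Q) = multipartite s x y + count (covers x y) Q.
  by move=> xy; rewrite count_cat cL.
split=> //.
- by split=> [|x y xy]; rewrite ?all_cat ?okL // cP // cQ.
- by rewrite all_cat sQ andbT; apply: sub_all sL => b /eqP->.
- rewrite big_cat /=; congr (_ + _); rewrite big_seq.
  under eq_bigr => b bL do rewrite (eqP (allP sL b bL)).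
  by rewrite -big_seq big_const_seq count_predT iter_addn_0.
rewrite -[RHS]sum_multipartite; congr (_ + _).
transitivity (\sum_(b <- L) size b * (size b).-1).
  rewrite big_seq; under eq_bigr => b bL do rewrite (eqP (allP sL b bL)).
  by rewrite -big_seq big_const_seq count_predT iter_addn_0.
rewrite -(sum_covers okL); apply: eq_bigr => x _; apply: eq_bigr => y _.
case: eqVneq => [<-|xy]; last by rewrite mul1n cL.
by rewrite mul0n /multipartite eqxx !andbF.
Qed.

Lemma ex_num_gdd s Q :
    gdd s -> all (fun b => uniq b && all (ltn^~ (sumn s)) b) Q ->
    all (fun b => size b <= 4) Q ->
    (forall x y, x != y -> multipartite s x y + count (covers x y) Q <= 1) ->
  exists2 z, 4 * z + \sum_(b <- Q) 'C(size b, 3) <= ex_num (sumn s) [:: confB; confD]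
    & 12 * z + sumn [seq g * g | g <- s] = sumn s * sumn s.
Proof.
move=> gs okQ sQ cQ; have [P [z [linP sP _ cardP zE]]] := gdd_linear gs okQ sQ cQ.
by exists z; rewrite // -cardP ex_num_ge_linear.
Qed.

Lemma sumn_squares_nseq k a : sumn [seq g * g | g <- nseq k a] = k * (a * a).
Proof. by rewrite map_nseq sumn_nseq mulnC. Qed.

Lemma ex_num_gdd0 s :
  gdd s ->
  exists2 z, 4 * z <= ex_num (sumn s) [:: confB; confD]
    & 12 * z + sumn [seq g * g | g <- s] = sumn s * sumn s.
Proof.
move=> gs; have [//|//|x y _|z] := @ex_num_gdd s [::] gs; first by rewrite addn0; case: multipartite.
by rewrite big_nil addn0; exists z.
Qed.

(** * Lower bounds by residue class *)

Lemma lower_1_4 n : 0 < n -> n %% 12 \in [:: 1; 4] ->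
  n * (n - 1) %/ 3 <= ex_num n [:: confB; confD].
Proof.
move=> n_gt0 n12; have gn : gdd (nseq n 1).
  have -> : n = 1 + 3 * (n.-1 %/ 3) by move: n12; rewrite !inE; lia.
  apply: (@gdd_sub 1 [:: 1]) (gdd_one 1) _ => //; apply: (@gdd3_add_point 0).
  by apply/gdd_cons0/gdd3_exists; move: n12; rewrite !inE; lia.
have := ex_num_gdd0 gn; rewrite sumn_squares_nseq sumn_nseq mul1n => -[z zn zE].
by apply: leq_trans zn; rewrite mulnBr; lia.
Qed.

Lemma lower_2_8 : exists N, forall n, N <= n -> n %% 12 \in [:: 2; 8] ->
  n * (n - 2) %/ 3 <= ex_num n [:: confB; confD].
Proof.
have [N HN] := gdd2_eventually; exists (6 * N + 2) => n Nn n12.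
have gn : gdd (nseq (n %/ 2) 2).
  have -> : n %/ 2 = (3 * (n %/ 6)).+1 by move: n12; rewrite !inE; lia.
  by apply: HN; lia.
have := ex_num_gdd0 gn; rewrite sumn_squares_nseq sumn_nseq.
have -> : 2 * (n %/ 2) = n by move: n12; rewrite !inE; lia.
by move=> [z zn zE]; apply: leq_trans zn; rewrite mulnBr; move: n12; rewrite !inE; lia.
Qed.

Lemma sum_seqE (T : Type) (f : T -> nat) (l : seq T) : \sum_(b <- l) f b = sumn (map f l).
Proof. by rewrite sumnE big_map. Qed.

Lemma hole_covers g s Q x y :
  linear_check g Q -> x != y -> multipartite (g :: s) x y + count (covers x y) Q <= 1.
Proof.
move=> linQ xy; have := linear_checkP linQ xy; have [/andP[xg yg] H|_] := boolP (_ && _).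
  by rewrite multipartite_cons xg [g <= y]leqNgt yg.
by rewrite leqn0 => /eqP->; rewrite addn0 leq_b1.
Qed.

Lemma linear_check_lt g n Q :
  linear_check g Q -> g <= n -> all (fun b => uniq b && all (ltn^~ n) b) Q.
Proof.
case/andP=> okQ _ gn; apply: sub_all okQ => b /andP[-> /allP lb].
by apply/allP=> x /lb /= xg; apply: leq_trans gn.
Qed.

(** Type 5 2^s gives 12 z = n (n - 2) - 15; of the five triples thus missing, the quadruple placed
    in the part of size 5 restores four. *)
Lemma lower_5_11 : exists N, forall n, N <= n -> n %% 12 \in [:: 5; 11] ->
  n * (n - 2) %/ 3 - 1 <= ex_num n [:: confB; confD].
Proof.
have [N HN] := gdd_5_2_eventually; exists (6 * N + 5) => n Nn n12.
have n6 : n = 5 + 2 * (3 * (n %/ 6)) by move: n12; rewrite !inE; lia.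
have gn : gdd (5 :: nseq (3 * (n %/ 6)) 2) by apply: HN; lia.
have lin5 : linear_check 5 [:: [:: 0; 1; 2; 3]] by vm_compute.
have [|//|x y xy|z] := ex_num_gdd gn (Q := [:: [:: 0; 1; 2; 3]]).
- by apply: linear_check_lt lin5 _; rewrite /= leq_addr.
- exact: hole_covers.
rewrite [sumn (_ :: _)]/= [map _ _]/= [sumn (_ :: _)]/= sumn_squares_nseq sumn_nseq -n6.
rewrite sum_seqE (_ : sumn _ = 4); last by vm_compute.
move=> zn zE; apply: leq_trans zn; rewrite mulnBr; move: n12; rewrite !inE; lia.
Qed.

Definition parts3 (g u : nat) : seq (seq nat) :=
  [seq [:: g + 3 * i; g + 3 * i + 1; g + 3 * i + 2] | i <- iota 0 u].

Lemma reshape_index_nseq c k i : i < k * c -> reshape_index (nseq k c) i = i %/ c.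
Proof.
elim: k i => [//|k IHk] i ikc; rewrite reshape_index_cons.
have c_gt0 : 0 < c by case: c ikc {IHk} => //; rewrite muln0.
case: ltnP => ic; first by rewrite divn_small.
rewrite IHk; last by rewrite ltn_subLR // -mulSn.
by rewrite -{2}(subnK ic) divnDr ?dvdnn // divnn c_gt0 addn1.
Qed.

Lemma parts3_covers g u Q x y :
    linear_check g Q -> x != y ->
  multipartite (g :: nseq u 3) x y + count (covers x y) (parts3 g u ++ Q) <= 1.
Proof.
move=> linQ xy; rewrite count_cat; have cQ := linear_checkP linQ xy.
have cT : count (covers x y) (parts3 g u) <=
    [&& g <= x, g <= y, x < g + 3 * u & (x - g) %/ 3 == (y - g) %/ 3].
  case: (boolP [&& _, _, _ & _]) => [/and4P[gx gy xu /eqP E]|H].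
    rewrite /parts3 count_map.
    apply: (@leq_trans (count_mem ((x - g) %/ 3) (iota 0 u))).
      apply: sub_count => i; rewrite /covers /= !inE => /andP[+ _]; lia.
    by rewrite count_uniq_mem ?iota_uniq ?leq_b1.
  rewrite leqNgt -has_count; apply: contra H => /hasP[_ /mapP[i + ->]].
  by rewrite mem_iota /covers !inE; lia.
apply: leq_trans (leq_add (leqnn _) (leq_add cT cQ)) _.
rewrite multipartite_cons sumn_nseq; case: ltnP => xg; first by case: ltnP => yg; lia.
case: ltnP => yg; first by lia.
rewrite /multipartite sumn_nseq; case: (ltnP (x - g) (3 * u)) => xu; last by rewrite /=; lia.
case: (ltnP (y - g) (3 * u)) => yu; last by rewrite /=; lia.
by rewrite !reshape_index_nseq ?(mulnC u) //=; lia.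
Qed.

Lemma sum_parts3 g u : \sum_(b <- parts3 g u) 'C(size b, 3) = u.
Proof.
rewrite sum_seqE /parts3 -map_comp (eq_map (g := fun=> 1)) //.
by rewrite sumn_map_const size_iota mul1n.
Qed.

Lemma parts3_ok g u Q :
  linear_check g Q ->
  all (fun b => uniq b && all (ltn^~ (sumn (g :: nseq u 3))) b) (parts3 g u ++ Q).
Proof.
move=> linQ; rewrite all_cat (linear_check_lt linQ) ?leq_addr // andbT.
apply/allP=> _ /mapP[i + ->]; rewrite mem_iota /= sumn_nseq !inE; lia.
Qed.

Lemma parts3_size g u Q :
  all (fun b => size b <= 4) Q -> all (fun b : seq nat => size b <= 4) (parts3 g u ++ Q).
Proof. by move=> sQ; rewrite all_cat sQ andbT; apply/allP=> _ /mapP[i _ ->]. Qed.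

Lemma ex_num_parts3 g u Q :
    gdd (g :: nseq u 3) -> linear_check g Q -> all (fun b => size b <= 4) Q ->
  exists2 z, 4 * z + u + \sum_(b <- Q) 'C(size b, 3) <= ex_num (g + 3 * u) [:: confB; confD]
    & 12 * z + g * g + 9 * u = (g + 3 * u) * (g + 3 * u).
Proof.
move=> gs linQ sQ; have [|x y xy|z] := ex_num_gdd gs (parts3_ok u linQ).
- exact: parts3_size.
- exact: parts3_covers.
rewrite big_cat sum_parts3 [map _ _]/= [sumn (g :: _)]/= [sumn (_ :: map _ _)]/=.
rewrite sumn_squares_nseq sumn_nseq addnA => zn zE; exists z; first by rewrite -addnA.
by rewrite -zE; lia.
Qed.

Lemma lower_0_3 n : n %% 12 \in [:: 0; 3] ->
  n * (n - 2) %/ 3 <= ex_num n [:: confB; confD].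
Proof.
move=> n12; have n3 : n = 0 + 3 * (n %/ 3) by move: n12; rewrite !inE; lia.
have gn : gdd (0 :: nseq (n %/ 3) 3).
  by apply/gdd_cons0/gdd3_exists; move: n12; rewrite !inE; lia.
have [//|//|z] := @ex_num_parts3 0 (n %/ 3) [::] gn.
rewrite -n3 big_nil => zn zE; apply: leq_trans zn.
by rewrite mulnBr; move: n12; rewrite !inE; lia.
Qed.

Lemma lower_6_9_BD : exists N, forall n, N <= n -> n %% 12 \in [:: 6; 9] ->
  n * (n - 2) %/ 3 - 1 <= ex_num n [:: confB; confD].
Proof.
have [N HN] := gdd_30_3_eventually; exists (3 * N + 30) => n Nn n12.
have n3 : n = 30 + 3 * ((n - 30) %/ 3) by move: n12; rewrite !inE; lia.
have gn : gdd (30 :: nseq ((n - 30) %/ 3) 3) by apply: HN; move: n12; rewrite ?inE; lia.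
have [|z] := ex_num_parts3 gn linear_blocks30; first by vm_compute.
(* 279 = 30 * 28 / 3 - 1, the value of the formula at n = 30. *)
have -> : \sum_(b <- blocks30) 'C(size b, 3) = 279 by rewrite sum_seqE; vm_compute.
rewrite -n3 => zn zE; apply: leq_trans zn.
by rewrite mulnBr; move: n12; rewrite !inE; lia.
Qed.

Lemma lower_7_10 : exists N, forall n, N <= n -> n %% 12 \in [:: 7; 10] ->
  n * (n - 1) %/ 3 - 4 <= ex_num n [:: confB; confD].
Proof.
have [N HN] := gdd_30_3_eventually; exists (3 * N + 31) => n Nn n12.
pose u := (n - 31) %/ 3; have n3 : n = 31 + 3 * u by rewrite /u; move: n12; rewrite !inE; lia.
have gn : gdd (31 :: nseq (3 * u) 1).
  by apply: gdd3_add_point; apply: HN; rewrite /u; move: n12; rewrite ?inE; lia.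
have [||x y xy|z] := ex_num_gdd gn (Q := blocks31).
- by apply: linear_check_lt linear_blocks31 _; rewrite /= leq_addr.
- by vm_compute.
- exact: hole_covers linear_blocks31 xy.
(* 306 = 31 * 30 / 3 - 4, the value of the formula at n = 31. *)
have -> : \sum_(b <- blocks31) 'C(size b, 3) = 306 by rewrite sum_seqE; vm_compute.
rewrite [map _ _]/= [sumn (_ :: _)]/= [sumn (_ :: map _ _)]/= sumn_squares_nseq sumn_nseq mul1n -n3.
move=> zn zE; apply: leq_trans zn.
by rewrite mulnBr; move: n12; rewrite !inE; lia.
Qed.

Lemma lower_6_9_D : exists N, forall n, N <= n -> n %% 12 \in [:: 6; 9] ->
  n * (n - 2) %/ 3 <= ex_num n [:: confD].
Proof.
have [N HN] := gdd_6_3_eventually; exists (3 * N + 6) => n Nn n12.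
pose u := (n - 6) %/ 3; have n3 : n = 6 + 3 * u by rewrite /u; move: n12; rewrite !inE; lia.
have gn : gdd (6 :: nseq u 3) by apply: HN; rewrite /u; move: n12; rewrite ?inE; lia.
(* The points 2, 3, 4, 5 form a quadruple and are also the pages of the book with spine 0, 1:
   together 8 = 6 * 4 / 3 triples. *)
have lin6 : linear_check 6 [:: [:: 2; 3; 4; 5]] by vm_compute.
have [n0 n1 n6] : [/\ 0 < n, 1 < n & 6 <= n] by split; lia.
have sQ : all (fun b => size b <= 4) [:: [:: 2; 3; 4; 5]] by [].
have [P [z []]] := gdd_linear gn (parts3_ok u lin6) (parts3_size 6 u sQ)
  (fun x y => parts3_covers u lin6).
rewrite big_cat [map _ _]/= [sumn (_ :: nseq _ _)]/= [sumn (_ :: map _ _)]/=.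
rewrite sumn_squares_nseq sumn_nseq -n3 => linP sP cP cardP zE.
pose X := [set i : 'I_n | 1 < i < 6].
have X4 : #|X| = 4.
  have -> : X = block_set n [:: 2; 3; 4; 5].
    by apply/setP=> i; rewrite !inE /=; lia.
  by rewrite card_block_set // /= !(leq_trans _ n6).
have uncov (x y : 'I_n) : x != y -> x \in [set Ordinal n0; Ordinal n1] ->
    y \in [set Ordinal n0; Ordinal n1] :|: X -> count (covers (val x) (val y)) P = 0.
  move=> xy; rewrite !inE -!val_eqE /= => x01 yX; rewrite cP // count_cat.
  have [x6 y6] : x < 6 /\ y < 6 by lia.
  have M0 : multipartite (6 :: nseq u 3) x y = false.
    by rewrite multipartite_cons x6 [6 <= y]leqNgt y6.
  have T0 : count (covers (val x) (val y)) (parts3 6 u) = 0.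
    apply/eqP; rewrite -leqn0 leqNgt -has_count; apply/hasP=> -[_ /mapP[i _ ->]].
    by rewrite /covers !inE /=; lia.
  by rewrite M0 T0 /= /covers !inE /=; lia.
have := ex_num_ge_book linP sP (isT : Ordinal n0 != Ordinal n1) _ _ uncov.
rewrite X4 !inE /= => /(_ isT isT); apply: leq_trans.
rewrite cardP sum_parts3 big_seq1 (_ : 'C(_, 3) = 4); last by vm_compute.
rewrite [X in _ <= X]/= mulnBr; move: n12; rewrite !inE; lia.
Qed.

(** * Graphs without a path with three edges *)
Definition P4_free (V : Type) (L : rel V) : Prop :=
  forall x y z w : V, L x y -> L y z -> L z w -> x <> z -> y <> w -> x = w.

Definition degree (V : finType) (L : rel V) (x : V) : nat := #|[set y | L x y]|.

Definition in_triangle (V : finType) (L : rel V) (x : V) : bool :=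
  [exists y, exists z, [&& L x y, L x z & L y z]].

(* Ties in the degree are broken arbitrarily, so that every component has a
   unique vertex of largest key. *)
Definition key (V : finType) (L : rel V) (x : V) : nat :=
  degree L x * #|V| + enum_rank x.

(** In a star or a triangle some vertex is adjacent to all others, so the largest key in a closed
    neighbourhood already picks one vertex per component. *)
Definition center (V : finType) (L : rel V) (x : V) : V :=
  [arg max_(y > x | (y == x) || L x y) key L y].

(** One representative of each star component; isolated vertices and single edges count as stars. *)
Definition hub (V : finType) (L : rel V) (c : V) : bool :=
  (center L c == c) && ~~ in_triangle L c.

Section P4Free.
Variables (V : finType) (L : rel V).
Hypotheses (symL : symmetric L) (irrL : irreflexive L) (P4L : P4_free L).

Lemma key_inj : injective (key L).
Proof.
move=> x y; rewrite /key => E; apply: enum_rank_inj; apply: val_inj.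
have := congr1 (modn^~ #|V|) E.
by rewrite !modnMDl !modn_small.
Qed.

Lemma degree_le_key x y : key L x <= key L y -> degree L x <= degree L y.
Proof.
apply: contraTT; rewrite -!ltnNge /key => yx.
apply: (@leq_trans ((degree L y).+1 * #|V|)); first by rewrite mulSnr ltn_add2l.
by apply: leq_trans (leq_addr _ _); rewrite leq_mul2r yx orbT.
Qed.

Lemma centerP x :
  ((center L x == x) || L x (center L x)) /\
  (forall y, (y == x) || L x y -> key L y <= key L (center L x)).
Proof. by rewrite /center; case: arg_maxnP => [|c Pc max]; rewrite ?eqxx. Qed.

Lemma degree_gt1 x y z : L x y -> L x z -> y != z -> 1 < degree L x.
Proof. by move=> xy xz yz; apply/card_gt1P; exists y, z; rewrite !inE. Qed.

Lemma degree_other x y : 1 < degree L x -> exists2 z, L x z & z != y.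
Proof.
case/card_gt1P=> z [w [+ + zw]]; rewrite !inE => xz xw.
have [zy|zy] := eqVneq z y; last by exists z.
by exists w; rewrite // -zy eq_sym.
Qed.

(** If the center z of y is neither y nor x, then y has degree at least 2, and so has z by
    maximality. A neighbour w of z other than y ends a path x y z w, which forces x = w. *)
Lemma center_adj_aux x y : L x y -> (center L y == x) || L x (center L y).
Proof.
move=> xy; have [/orP[/eqP->|yz] max] := centerP y; first by rewrite xy orbT.
set z := center L y in yz max *; have [//|zx] := eqVneq z x; rewrite orFb.
have dy : 1 < degree L y by apply: (@degree_gt1 _ x z); rewrite // 1?symL // eq_sym.
have dz : 1 < degree L z.
  by apply: leq_trans dy _; apply: degree_le_key; apply: max; rewrite eqxx.
have [w zw wy] := degree_other y dz.
by rewrite (P4L xy yz zw) 1?symL //; [apply/eqP; rewrite eq_sym|apply/eqP; rewrite eq_sym].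
Qed.

Lemma center_adj x y : L x y -> center L x = center L y.
Proof.
move=> xy; apply: key_inj; apply/eqP; rewrite eqn_leq.
have yx : L y x by rewrite symL.
have [_ maxx] := centerP x; have [_ maxy] := centerP y.
by apply/andP; split; [apply: maxy|apply: maxx]; apply: center_adj_aux.
Qed.

Lemma center_fiber c x : center L c = c -> (center L x == c) = (x == c) || L c x.
Proof.
move=> cc; apply/eqP/orP => [xc|[/eqP->//|/center_adj <-//]].
have [+ _] := centerP x; rewrite xc => /orP[/eqP->|]; first by left.
by rewrite symL; right.
Qed.

Lemma centerK x : center L (center L x) = center L x.
Proof. by have [/orP[/eqP E|/center_adj <-//] _] := centerP x; rewrite !E. Qed.

Lemma triangle_nbr x y z w : L x y -> L x z -> L y z -> L x w -> w = y \/ w = z.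
Proof.
move=> xy xz yz xw; have [->|wy] := eqVneq w y; [by left|right].
apply: (P4L (y := x) (z := y)) => //; first by rewrite symL.
  exact/eqP.
by move=> E; rewrite E irrL in xz.
Qed.

Lemma in_triangleP x :
  reflect (exists y z, [/\ L x y, L x z & L y z]) (in_triangle L x).
Proof.
apply: (iffP existsP) => [[y /existsP[z /and3P[]]]|[y [z [xy xz yz]]]].
  by exists y, z.
by exists y; apply/existsP; exists z; rewrite xy xz.
Qed.

Lemma in_triangle_degree x : in_triangle L x -> degree L x = 2.
Proof.
case/in_triangleP=> y [z [xy xz yz]]; rewrite /degree.
have -> : [set w | L x w] = [set y; z].
  apply/setP=> w; rewrite !inE; apply/idP/orP => [xw|[/eqP->|/eqP->] //].
  by have [->|->] := triangle_nbr xy xz yz xw; rewrite eqxx; [left|right].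
by rewrite cards2; case: eqVneq yz => // ->; rewrite irrL.
Qed.

Lemma in_triangle_adj x y : L x y -> in_triangle L x -> in_triangle L y.
Proof.
move=> xy /in_triangleP[z [w [xz xw zw]]]; apply/in_triangleP.
have [->|->] := triangle_nbr xz xw zw xy; first by exists x, w; rewrite symL.
by exists x, z; rewrite symL (symL w z).
Qed.

Lemma in_triangle_center x : in_triangle L (center L x) = in_triangle L x.
Proof.
have [/orP[/eqP->//|xc] _] := centerP x.
by apply/idP/idP; apply: in_triangle_adj; rewrite // symL.
Qed.

(** Were the degree of x larger, that of c would be too, by maximality. Further neighbours u of c
    and w of x give a path u c x w, hence u = w and a triangle at c. *)
Lemma hub_leaf c x : hub L c -> L c x -> degree L x = 1.
Proof.
case/andP=> /eqP cc ntc cx; apply/eqP; rewrite eqn_leq; apply/andP; split; last first.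
  by apply/card_gt0P; exists c; rewrite inE symL.
rewrite leqNgt; apply: contra ntc => dx.
have dc : 1 < degree L c.
  apply: leq_trans dx _; apply: degree_le_key; have [_] := centerP c.
  by rewrite cc; apply; rewrite cx orbT.
have [w xw wc] := degree_other c dx; have [u cu ux] := degree_other x dc.
apply/in_triangleP; exists x, u; split=> //.
suff -> : u = w by [].
apply/esym; apply: (P4L (y := x) (z := c)) => //; [by rewrite symL|by rewrite symL|exact/eqP|].
by apply/eqP; rewrite eq_sym.
Qed.

Lemma degree3_hub x : 2 < degree L x -> hub L x.
Proof.
move=> dx; have nt : ~~ in_triangle L x by apply: contraTN dx => /in_triangle_degree->.
rewrite /hub nt andbT; have [/orP[//|xc] _] := centerP x.
have hc : hub L (center L x) by rewrite /hub centerK eqxx in_triangle_center.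
by move: dx; rewrite (hub_leaf hc) // symL.
Qed.

Lemma hub_center x : ~~ in_triangle L x -> hub L (center L x).
Proof. by move=> nt; rewrite /hub centerK eqxx in_triangle_center. Qed.

Lemma degree2_hub x : 1 < degree L x -> ~~ in_triangle L x -> hub L x.
Proof.
move=> dx /hub_center hc; have [/orP[/eqP<-//|xc] _] := centerP x.
by move: dx; rewrite (hub_leaf hc) // symL.
Qed.

Lemma hub_of_edge x y : L x y -> ~~ in_triangle L x -> degree L x = 1 -> degree L y = 1 ->
  exists2 c, hub L c & degree L c = 1.
Proof.
move=> xy /hub_center hc dx dy; exists (center L x) => //.
have [/orP[/eqP->//|xc] _] := centerP x.
suff -> : center L x = y by [].
by apply/eqP; apply: contraT => cy; have := degree_gt1 xc xy cy; rewrite dx.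
Qed.

Lemma card_center_fiber c : center L c = c -> #|[set x | center L x == c]| = (degree L c).+1.
Proof.
move=> cc; have -> : [set x | center L x == c] = c |: [set x | L c x].
  by apply/setP=> x; rewrite !inE center_fiber.
by rewrite cardsU1 inE irrL.
Qed.

(** By components: a star with d leaves has degree sum 2d = 2 (d + 1) - 2, and a triangle has degree
    sum 6 = 2 * 3. *)
Lemma sum_degree : \sum_x degree L x + 2 * #|[set c | hub L c]| = 2 * #|V|.
Proof.
have bigfib (F : V -> nat) : \sum_x F x =
    \sum_(c | center L c == c) \sum_(x | center L x == c) F x.
  by apply: (partition_big (center L)) => x _; rewrite centerK.
have -> : #|V| = \sum_(x : V) 1 by rewrite sum1_card.
rewrite (bigfib (degree L)) (bigfib (fun=> 1)).
have -> : #|[set c | hub L c]| = \sum_(c | center L c == c) ~~ in_triangle L c.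
  by rewrite -sum1_card big_mkcond [RHS]big_mkcond; apply: eq_bigr => c _;
    rewrite inE /hub; case: eqP => //; case: in_triangle.
rewrite !big_distrr -big_split /=; apply: eq_bigr => c /eqP cc.
rewrite sum1_card -cardsE card_center_fiber //.
rewrite (bigD1 c) /=; last by rewrite cc.
have -> : \sum_(x | (center L x == c) && (x != c)) degree L x = \sum_(x in [set x | L c x]) degree L x.
  apply: eq_bigl => x; rewrite inE center_fiber //.
  by case: eqVneq => [->|]; rewrite ?irrL ?andbT.
have [tc|ntc] := boolP (in_triangle L c).
  rewrite (eq_bigr (fun=> 2)) => [|x]; last first.
    by rewrite inE => cx; apply: in_triangle_degree; apply: in_triangle_adj cx tc.
  by rewrite sum_nat_const -/(degree L c) in_triangle_degree.
rewrite (eq_bigr (fun=> 1)) => [|x]; last first.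
  by rewrite inE; apply: hub_leaf; rewrite /hub cc eqxx.
by rewrite sum_nat_const -/(degree L c); lia.
Qed.

Lemma card_not_in_triangle :
  #|[set x | ~~ in_triangle L x]| = \sum_(c | hub L c) (degree L c).+1.
Proof.
rewrite -sum1_card (partition_big (center L) (hub L)) => [|x] /=; last first.
  by rewrite inE; apply: hub_center.
apply: eq_bigr => c /andP[/eqP cc ntc]; rewrite sum1_card -card_center_fiber // -cardsE.
apply: eq_card => x; rewrite inE unfold_in /= !inE andbC; case: eqP => //= xc.
by rewrite -in_triangle_center xc.
Qed.

Lemma card_in_triangle_mod3 : #|[set x | in_triangle L x]| %% 3 = 0.
Proof.
rewrite -sum1_card (partition_big (center L) (fun c => (center L c == c) && in_triangle L c)) => [|x] /=; last first.
  by rewrite inE centerK eqxx in_triangle_center.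
rewrite (eq_bigr (fun=> 3)) => [|c /andP[/eqP cc tc]].
  by rewrite sum_nat_const modnMl.
have := card_center_fiber cc; rewrite in_triangle_degree // => <-.
rewrite sum1_card -cardsE; apply: eq_card => x; rewrite inE unfold_in /= !inE andbC; case: eqP => //= xc.
by rewrite -in_triangle_center xc.
Qed.
End P4Free.

(** * Links *)
Lemma isolated_hub (V : finType) (L : rel V) x : irreflexive L -> degree L x = 0 -> hub L x.
Proof.
move=> irrL /eqP; rewrite cards_eq0 => /eqP/setP d0.
have nx y : L x y = false by have := d0 y; rewrite !inE.
rewrite /hub; apply/andP; split; last first.
  by apply/in_triangleP=> -[y [z [+ _ _]]]; rewrite nx.
by have [+ _] := centerP L x; rewrite nx orbF.
Qed.

Definition link (V : finType) (H : {set {set V}}) (v : V) : rel V :=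
  fun x y => [set v; x; y] \in H.

(* The tree components of the link of v, except for the isolated vertex v. *)
Definition stars (V : finType) (H : {set {set V}}) (v : V) : {set V} :=
  [set c | hub (link H v) c] :\ v.

Section Links.
Variables (V : finType) (H : {set {set V}}).
Hypotheses (tripleH : triple_system H) (freeH : ~~ contains H confD).
Local Notation T := (link H).

Lemma link_card v x y : T v x y -> #|[set v; x; y]| = 3.
Proof. by move=> E; apply/eqP; move/forall_inP: tripleH; apply. Qed.

Lemma link_sym v : symmetric (T v).
Proof. by move=> x y; rewrite /link setUAC. Qed.

Lemma link_swap v x y : T v x y = T x v y.
Proof. by rewrite /link (setUC [set v]). Qed.

Lemma link_rot v x y : T v x y = T x y v.
Proof. by rewrite link_swap link_sym. Qed.

Lemma link_irr v : irreflexive (T v).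
Proof.
move=> x; apply/negP=> /link_card; rewrite -setUA setUid cards2.
by case: (_ == _).
Qed.

Lemma link_self v x : T v v x = false.
Proof. by rewrite link_rot link_rot link_irr. Qed.

Lemma link_neq v x y : T v x y -> [/\ v != x, v != y & x != y].
Proof.
move=> vxy; split; apply: contraTneq vxy => ->; first by rewrite link_self.
  by rewrite link_sym link_self.
by rewrite link_irr.
Qed.

Lemma link_P4_free v : P4_free (T v).
Proof.
move=> x y z w xy yz zw xz yw; apply/eqP; apply: contraNT freeH => xw.
have [vx vy nxy] := link_neq xy; have [_ vz nyz] := link_neq yz; have [_ vw nzw] := link_neq zw.
apply/containsD; exists y, z, v, x, w; split.
- rewrite /= !inE !negb_or nyz (eq_sym y v) vy (eq_sym y x) nxy (eq_sym z v) vz (eq_sym z x) nzw vx vw xw.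
  by rewrite (introN eqP yw) (introN eqP xz).
- by rewrite -[_ \in H]/(T y z v) -link_rot.
- by rewrite -[_ \in H]/(T y v x) link_swap link_sym.
by rewrite -[_ \in H]/(T z v w) link_swap.
Qed.

Lemma codegreeC v x : degree (T v) x = degree (T x) v.
Proof. by apply: eq_card => y; rewrite !inE link_swap. Qed.

Lemma degree_self v : degree (T v) v = 0.
Proof. by apply: eq_card0 => y; rewrite inE link_self. Qed.

Lemma hub_self v : hub (T v) v.
Proof. by apply: isolated_hub; [exact: link_irr|exact: degree_self]. Qed.

Lemma card_hubs v : #|[set c | hub (T v) c]| = #|stars H v|.+1.
Proof. by rewrite (cardsD1 v) inE hub_self. Qed.

Lemma sum_codegrees : \sum_v \sum_x degree (T v) x = 6 * #|H|.
Proof.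
transitivity (\sum_v \sum_x \sum_y \sum_(e in H) ([set v; x; y] == e)).
  apply: eq_bigr => v _; apply: eq_bigr => x _; rewrite /degree -sum1_card big_mkcond.
  apply: eq_bigr => y _; rewrite inE /link; case: (boolP (_ \in H)) => yH.
    by rewrite (bigD1 _ yH) /= eqxx big1 // => e /andP[_ /negPf]; rewrite eq_sym => ->.
  by rewrite big1 // => e eH; case: eqP => // E; rewrite E eH in yH.
under eq_bigr => v _ do under eq_bigr => x _ do rewrite exchange_big.
under eq_bigr => v _ do rewrite exchange_big.
rewrite exchange_big /= mulnC -sum_nat_const; apply: eq_bigr => e eH.
have e3 : #|e| = 3 by apply/eqP; move/forall_inP: tripleH; apply.
have E v x y : ([set v; x; y] == e) = [&& v \in e, x \in e :\ v & y \in e :\ v :\ x].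
  apply/eqP/and3P => [E|[ve xe ye]].
    have := e3; rewrite -E => c3; have vxy : T v x y by rewrite /link E.
    have [vx vy xy] := link_neq vxy.
    by split; rewrite !inE !eqxx ?orbT ?andbT ?[x == v]eq_sym ?[y == x]eq_sym
      ?[y == v]eq_sym ?vx ?xy ?vy.
  apply/eqP; rewrite eqEcard !subUset !sub1set e3.
  move: xe ye; rewrite !inE => /andP[xv xe] /and3P[yx yv ye]; rewrite ve xe ye /=.
  by rewrite setUC cardsU1 cards2 !inE negb_or yv yx eq_sym xv.
under eq_bigr => v _ do under eq_bigr => x _ do under eq_bigr => y _ do rewrite E.
transitivity (\sum_(v in e) \sum_(x in e :\ v) \sum_(y in e :\ v :\ x) 1).
  rewrite [RHS]big_mkcond; apply: eq_bigr => v _; case: (v \in e); last first.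
    by rewrite big1 // => x _; rewrite big1.
  rewrite [RHS]big_mkcond; apply: eq_bigr => x _; case: (x \in _); last by rewrite big1.
  by rewrite [RHS]big_mkcond; apply: eq_bigr => y _; case: (y \in _).
rewrite (eq_bigr (fun=> 2)) => [|v ve]; first by rewrite sum_nat_const e3.
have e2 : #|e :\ v| = 2 by have := cardsD1 v e; rewrite e3 ve => -[].
rewrite (eq_bigr (fun=> 1)) => [|x xe]; first by rewrite sum_nat_const e2.
by rewrite sum1_card; have := cardsD1 x (e :\ v); rewrite e2 xe => -[].
Qed.

(** [sum_degree] is added up over all links. The vertex v, isolated in its own link, is a tree
    component not counted in [stars], which turns n into n - 1. *)
Lemma sum_stars : 3 * #|H| + \sum_v #|stars H v| = #|V| * (#|V| - 1).
Proof.
have E v : \sum_x degree (T v) x + 2 * #|stars H v|.+1 = 2 * #|V|.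
  by rewrite -card_hubs sum_degree //; [exact: link_sym|exact: link_irr|exact: link_P4_free].
have : \sum_v (\sum_x degree (T v) x + 2 * #|stars H v|.+1) = #|V| * (2 * #|V|).
  by rewrite (eq_bigr _ (fun v _ => E v)) sum_nat_const.
rewrite big_split sum_codegrees /= -big_distrr /=.
have sum1V : \sum_(v : V) 1 = #|V| by rewrite sum1_card.
under eq_bigr => v _ do rewrite -addn1; rewrite big_split /= sum1V mulnCA mulnBr muln1.
move: (\sum_v _) => S; have : #|V| <= #|V| * #|V| by case: #|V| => // k; rewrite mulnS leq_addr.
by move: #|V| #|H| => m h; nia.
Qed.

Lemma card_nontriangle v :
  #|[set x | ~~ in_triangle (T v) x]| = (\sum_(c in stars H v) (degree (T v) c).+1).+1.
Proof.
rewrite card_not_in_triangle; [|exact: link_sym|exact: link_irr|exact: link_P4_free].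
rewrite (bigD1 v) ?hub_self //= degree_self add1n; congr _.+1.
by apply: eq_bigl => c; rewrite !inE andbC.
Qed.

Lemma card_nontriangle_mod3 v :
  #|[set x | ~~ in_triangle (T v) x]| = #|V| %[mod 3].
Proof.
rewrite -(cardC [set x | in_triangle (T v) x]).
have /eqP := card_in_triangle_mod3 (link_sym v) (@link_irr v) (@link_P4_free v).
rewrite -/(_ %| _) => /dvdnP[t ->]; rewrite modnMDl; congr (_ %% 3).
by apply: eq_card => x; rewrite !inE.
Qed.

(** Without stars, triangles would partition the n - 1 vertices other than v. *)
Lemma stars_gt0 v : #|V| %% 3 != 1 -> 0 < #|stars H v|.
Proof.
rewrite -(card_nontriangle_mod3 v) card_nontriangle; apply: contraNT.
by rewrite -eqn0Ngt cards_eq0 => /eqP->; rewrite big_set0.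
Qed.

Lemma upper_general : 3 * #|H| <= #|V| * (#|V| - 1).
Proof. by rewrite -sum_stars leq_addr. Qed.

Lemma upper_mod3 : #|V| %% 3 != 1 -> 3 * #|H| <= #|V| * (#|V| - 2).
Proof.
move=> V3; have : #|V| <= \sum_v #|stars H v|.
  by rewrite -sum1_card; apply: leq_sum => v _; apply: stars_gt0.
have := sum_stars; rewrite !mulnBr; lia.
Qed.

Lemma upper_mod3_strict :
  #|V| %% 3 != 1 -> ~ (forall v, #|stars H v| = 1) -> 3 * #|H| < #|V| * (#|V| - 2).
Proof.
move=> V3 ns; have : #|V| < \sum_v #|stars H v|.
  rewrite ltnNge; apply/negP => le; apply: ns => v.
  have : \sum_w #|stars H w| = \sum_w (#|stars H w| - 1) + \sum_(w : V) 1.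
    by rewrite -big_split; apply: eq_bigr => w _; rewrite /= subnK ?stars_gt0.
  have sum1V : \sum_(w : V) 1 = #|V| by rewrite sum1_card.
  rewrite sum1V => E; have /eqP : \sum_w (#|stars H w| - 1) = 0.
    by apply/eqP; rewrite -leqn0 -(leq_add2r #|V|) -E.
  by rewrite sum_nat_eq0 => /forallP/(_ v)/= s1; have := stars_gt0 v V3; lia.
have := sum_stars; rewrite !mulnBr; lia.
Qed.

Lemma star_unique v : #|stars H v| = 1 ->
  exists c, [/\ c != v, hub (T v) c, forall c', hub (T v) c' -> c' != v -> c' = c
    & #|[set x | ~~ in_triangle (T v) x]| = (degree (T v) c).+2].
Proof.
move=> /eqP/cards1P[c sE]; exists c.
have : c \in stars H v by rewrite sE inE.
rewrite !inE => /andP[cv hc]; split=> // [c' hc' c'v|].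
  by apply/eqP; rewrite -in_set1 -sE !inE c'v.
by rewrite card_nontriangle sE big_set1.
Qed.
End Links.

(** * Systems in which every link has a single star *)

Lemma even_sum_degrees (V : finType) (R : rel V) :
  symmetric R -> irreflexive R -> ~~ odd (\sum_x degree R x).
Proof.
move=> symR irrR.
have E (P : rel V) : \sum_x #|[set y | P x y]| = #|[set p : V * V | P p.1 p.2]|.
  rewrite -sum1dep_card -(pair_big_dep xpredT P (fun _ _ => 1)) /=.
  by apply: eq_bigr => x _; rewrite sum1dep_card.
pose lt (x y : V) := enum_rank x < enum_rank y.
have -> : \sum_x degree R x =
    \sum_x #|[set y | R x y && lt x y]| + \sum_x #|[set y | R x y && lt y x]|.
  rewrite -big_split; apply: eq_bigr => x _ /=.
  rewrite /degree -(cardsID [set y | lt x y]); congr (_ + _).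
    by apply: eq_card => y; rewrite !inE.
  apply: eq_card => y; rewrite !inE andbC /lt -leqNgt leq_eqVlt.
  have [xy|//] := eqVneq (val (enum_rank y)) (val (enum_rank x)).
  by rewrite -(enum_rank_inj (val_inj xy)) irrR.
rewrite !E; set A := [set p | _]; set B := [set p | _].
have -> : #|B| = #|A|; last by rewrite addnn odd_double.
have swap_inj : injective (fun p : V * V => (p.2, p.1)) by move=> [a b] [c d] [-> ->].
rewrite -(card_imset (mem A) swap_inj).
apply: eq_card => -[x y]; rewrite inE /=; apply/idP/imsetP => [Bxy|[[a b] + [-> ->]]].
  by exists (y, x); rewrite ?inE // symR.
by rewrite inE /= symR.
Qed.

Section MoreLinks.
Variables (V : finType) (H : {set {set V}}).
Hypotheses (tripleH : triple_system H) (freeH : ~~ contains H confD).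
Local Notation T := (link H).
Local Notation s v := #|stars H v|.
Let symT := @link_sym V H.
Let irrT := link_irr tripleH.
Let P4T := link_P4_free tripleH freeH.

(** The pairs x v and x c have codegree 1, x being a leaf in both links, so in the link of x the
    edge v c is a whole component. *)
Lemma leaf_edge v c x :
  hub (T v) c -> hub (T c) v -> T v c x ->
  exists2 c', hub (T x) c' & degree (T x) c' = 1.
Proof.
move=> hc hv vcx.
have dv : degree (T x) v = 1.
  by rewrite codegreeC // (hub_leaf (@symT v) (@P4T v) hc).
have dc : degree (T x) c = 1.
  by rewrite codegreeC // (hub_leaf (@symT c) (@P4T c) hv) // -link_swap.
have xvc : T x v c by rewrite -link_rot -link_rot.
have nt : ~~ in_triangle (T x) v.
  by apply: contra_eqN dv => /(in_triangle_degree (@symT x) (irrT x) (@P4T x))->.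
exact: (hub_of_edge (@symT x) (irrT x) (@P4T x) xvc nt dv dc).
Qed.

Lemma triangle_other v x y z w : T v x y -> T v x z -> T v y z -> T v x w -> w = y \/ w = z.
Proof. exact: (@triangle_nbr _ _ (@symT v) (irrT v) (@P4T v)). Qed.

(* If every link had a single star, then its size would be congruent to 1
   modulo 3; a nontrivial star would yield a star with a single edge in the
   link of any of its leaves.  Hence every vertex would have a unique
   uncovered partner. *)
Lemma not_one_star_odd : #|V| %% 3 = 2 -> odd #|V| -> ~ (forall v, s v = 1).
Proof.
move=> V3 oddV s1.
have deg3 v c : hub (T v) c -> c != v -> degree (T v) c %% 3 = 0.
  move=> hc cv; have [c' [_ _ uc' nt]] := star_unique tripleH freeH (s1 v).
  rewrite (uc' c) //; have := card_nontriangle_mod3 tripleH freeH v; rewrite nt; lia.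
have deg0 v c : hub (T v) c -> c != v -> degree (T v) c = 0.
  move=> hc cv; have d3 := deg3 v c hc cv; apply/eqP; rewrite -leqn0 leqNgt; apply/negP => d_gt0.
  (* A positive multiple of 3 is at least 3, and such a degree forces a hub. *)
  have hv : hub (T c) v.
    by apply: (degree3_hub (@symT c) (irrT c) (@P4T c)); rewrite codegreeC; lia.
  have /card_gt0P[x] := d_gt0; rewrite inE => vcx.
  have [c' hc' d1] := leaf_edge hc hv vcx.
  have c'x : c' != x by apply: contra_eq_neq d1 => ->; rewrite degree_self.
  by have := deg3 _ _ hc' c'x; rewrite d1.
(* The graph of uncovered pairs, regular of degree 1; by handshaking this is impossible on an odd
   number of vertices. *)
pose R v c := (c != v) && (degree (T v) c == 0).
have symR : symmetric R by move=> v c; rewrite /R eq_sym codegreeC.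
have irrR : irreflexive R by move=> v; rewrite /R eqxx.
have := even_sum_degrees symR irrR; rewrite (eq_bigr (fun=> 1)) => [|v _].
  by rewrite sum1_card; move: oddV; rewrite cardT => ->.
rewrite -(s1 v); apply: eq_card => c; rewrite !inE; apply: andb_id2l => cv.
by apply/eqP/idP => [/isolated_hub->//|/deg0->].
Qed.

(* A star with at least four leaves gives a copy of confB, since no two of
   its leaves form an uncovered pair. *)
Lemma nonisolated_star v c :
    (forall v, s v = 1) -> #|V| %% 3 = 0 -> ~~ contains H confB ->
  hub (T v) c -> c != v -> degree (T v) c = 1.
Proof.
move=> s1 V3 freeB hc cv.
have deg3 u d : hub (T u) d -> d != u -> degree (T u) d %% 3 = 1.
  move=> hd du; have [d' [_ _ ud' nt]] := star_unique tripleH freeH (s1 u).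
  rewrite (ud' d) //; have := card_nontriangle_mod3 tripleH freeH u; rewrite nt; lia.
have d3 := deg3 v c hc cv; apply/eqP; rewrite eqn_leq andbC; apply/andP; split; first by lia.
rewrite leqNgt; apply: contra freeB => d_gt1.
have hv : hub (T c) v.
  by apply: (degree3_hub (@symT c) (irrT c) (@P4T c)); rewrite codegreeC; lia.
have /card_gt1P[x [x' [+ + xx']]] := d_gt1; rewrite !inE => vcx vcx'.
(* If x x' were uncovered, x' would be a hub of degree 0 in the link of x, against [deg3]. *)
have [y xx'y] : exists y, T x x' y.
  have : 0 < degree (T x) x'.
    rewrite lt0n; apply/eqP => d0; have h := isolated_hub (irrT x) d0.
    by have := deg3 _ _ h; rewrite d0 eq_sym xx' => /(_ isT).
  by case/card_gt0P=> y; rewrite inE; exists y.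
have leafv w w' : T v c w -> T v w w' -> w' = c.
  move=> vcw vww'; apply/eqP; apply: contraT => w'c.
  have := hub_leaf (@symT v) (@P4T v) hc vcw.
  by move/eqP; rewrite eqn_leq => /andP[+ _]; rewrite leqNgt (degree_gt1 vww' _ w'c) // symT.
have leafc w w' : T v c w -> T c w w' -> w' = v.
  move=> vcw cww'; apply/eqP; apply: contraT => w'v; have cvw : T c v w by rewrite -link_swap.
  have := hub_leaf (@symT c) (@P4T c) hv cvw.
  by move/eqP; rewrite eqn_leq => /andP[+ _]; rewrite leqNgt (degree_gt1 cww' _ w'v) // symT.
have [vc vx cx] := link_neq tripleH vcx; have [_ vx' cx'] := link_neq tripleH vcx'.
have [_ xy x'y] := link_neq tripleH xx'y.
have yv : y != v.
  apply: contraNneq cx' => yv; apply/eqP/esym/(leafv x x' vcx).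
  by rewrite link_rot -yv.
have yc : y != c.
  apply: contraNneq vx' => yc; apply/eqP/esym/(leafc x x' vcx).
  by rewrite link_rot -yc.
apply/containsB; exists x, x', v, c, y; split.
- by rewrite /= !inE !negb_or xx' xy x'y (eq_sym x v) vx (eq_sym x c) cx (eq_sym x' v) vx'
    (eq_sym x' c) cx' vc (eq_sym v y) yv (eq_sym c y) yc.
- exact: xx'y.
- by rewrite -[_ \in H]/(T x v c) -link_rot -link_rot.
by rewrite -[_ \in H]/(T x' v c) -link_rot -link_rot.
Qed.
End MoreLinks.

(* No tight component is K_4 minus a triple. *)
Definition K4_closed (V : finType) (H : {set {set V}}) : Prop :=
  forall v x y z, link H v x y -> link H v x z -> link H v y z -> link H x y z.

(** * Complete quadruples *)

Section Closed.
Variables (V : finType) (H : {set {set V}}).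
Hypotheses (tripleH : triple_system H) (freeH : ~~ contains H confD).
Hypothesis closedH : K4_closed H.
Local Notation T := (link H).
Local Notation s v := #|stars H v|.
Let symT := @link_sym V H.
Let irrT := link_irr tripleH.
Let P4T := link_P4_free tripleH freeH.

Definition full (v x y z : V) : bool := [&& T v x y, T v x z, T v y z & T x y z].

(** When x lies in a triangle of the link of v, it has just two neighbours there, and these complete
    the quadruple: the pair alone determines it. *)
Definition quad (v x : V) : {set V} := v |: (x |: [set w | T v x w]).

Lemma full_swap v x y z : full v x y z = full x v y z.
Proof.
by rewrite /full (link_swap H v x y) (link_swap H v x z) [T v y z && _]andbC.
Qed.

Lemma full_swap2 v x y z : full v x y z = full v y x z.
Proof.
rewrite /full (symT v x y) (link_swap H x y z); congr (_ && _).
by rewrite andbCA.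
Qed.

Lemma full_swap3 v x y z : full v x y z = full v x z y.
Proof. by rewrite /full (symT v y z) (symT x y z) andbCA. Qed.

Lemma in_triangle_full v x : in_triangle (T v) x -> exists y z, full v x y z.
Proof.
case/in_triangleP=> y [z [xy xz yz]]; exists y, z.
by rewrite /full xy xz yz (closedH xy).
Qed.

Lemma full_quad v x y z : full v x y z -> in_triangle (T v) x /\ quad v x = [set v; x; y; z].
Proof.
case/and4P=> xy xz yz xyz; split; first by apply/in_triangleP; exists y, z.
rewrite /quad; have -> : [set w | T v x w] = [set y; z].
  apply/setP=> w; rewrite !inE; apply/idP/orP => [xw|[/eqP->|/eqP->] //].
  by have [->|->] := triangle_other tripleH freeH xy xz yz xw; rewrite eqxx; [left|right].
by rewrite !setUA.
Qed.

Lemma full_card v x y z : full v x y z -> #|[set v; x; y; z]| = 4.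
Proof.
case/and4P=> xy xz yz xyz; have [vx vy nxy] := link_neq tripleH xy.
have [_ vz nyz] := link_neq tripleH yz; have [_ nxz _] := link_neq tripleH xyz.
by rewrite setUC cardsU1 (link_card tripleH xy) !inE !negb_or !(eq_sym z) vz nxz nyz.
Qed.

Lemma quad_pairs v x a b :
    in_triangle (T v) x -> a \in quad v x -> b \in quad v x -> a != b ->
  in_triangle (T a) b /\ quad a b = quad v x.
Proof.
move=> /in_triangle_full[y [z F]]; have [_ ->] := full_quad F.
have key c d e f : full c d e f -> [set c; d; e; f] = [set v; x; y; z] ->
    in_triangle (T c) d /\ quad c d = [set v; x; y; z].
  by move=> /full_quad[? ->] ->.
have F1 : full x v y z by rewrite -full_swap.
have F2 : full v y x z by rewrite -full_swap2.
have F3 : full y v x z by rewrite -full_swap.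
have F4 : full v z x y by rewrite -full_swap2 -full_swap3.
have F5 : full z v x y by rewrite -full_swap.
have F6 : full x y v z by rewrite -full_swap2.
have F7 : full y x v z by rewrite -full_swap.
have F8 : full x z v y by rewrite -full_swap2 -full_swap3.
have F9 : full z x v y by rewrite -full_swap.
have F10 : full y z v x by rewrite -full_swap2 -full_swap3.
have F11 : full z y v x by rewrite -full_swap.
rewrite !inE -!orbA => /or4P[]/eqP-> /or4P[]/eqP-> //; rewrite ?eqxx // => _;
  (apply: key; [eassumption|]); apply/setP=> w; rewrite !inE;
  by case: (w == v); case: (w == x); case: (w == y); case: (w == z).
Qed.

(** The ordered pairs inside complete quadruples are classified by their quadruple, and each class
    has 4 * 3 members. *)
Lemma card_in_triangle_dvd12 : 12 %| \sum_v #|[set x | in_triangle (T v) x]|.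
Proof.
pose Q := fun p : V * V => quad p.1 p.2.
pose A := [set p : V * V | in_triangle (T p.1) p.2].
have -> : \sum_v #|[set x | in_triangle (T v) x]| = #|A|.
  rewrite -sum1dep_card -(pair_big_dep xpredT (fun v x => in_triangle (T v) x) (fun _ _ => 1)) /=.
  by apply: eq_bigr => v _; rewrite sum1dep_card.
rewrite -sum1_card (partition_big Q (mem (Q @: A))) => [|p pA] /=; last exact: imset_f.
apply: dvdn_sum => S /imsetP[[v x]]; rewrite inE /= => vx ->.
have [y [z F]] := in_triangle_full vx; have [_ QE] := full_quad F.
have pairs a b : in_triangle (T a) b && (quad a b == quad v x) =
    (a \in quad v x) && (b \in quad v x :\ a).
  rewrite in_setD1; apply/andP/and3P => [[ab /eqP E]|[a_in ba b_in]]; last first.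
    by rewrite eq_sym in ba; have [-> ->] := quad_pairs vx a_in b_in ba.
  have [y' [z' /and4P[aby _ _ _]]] := in_triangle_full ab.
  by have [nab _ _] := link_neq tripleH aby; split; rewrite -?E ?[b == a]eq_sym // /quad !inE eqxx ?orbT.
rewrite sum1dep_card.
have -> : #|[set p | (p \in A) && (Q p == Q (v, x))]| =
    #|[set p : V * V | (p.1 \in quad v x) && (p.2 \in quad v x :\ p.1)]|.
  by apply: eq_card => -[a b]; rewrite inE [RHS]inE -pairs inE.
rewrite -sum1dep_card -(pair_big_dep (mem (quad v x)) (fun a b => b \in quad v x :\ a) (fun _ _ => 1)) /=.
rewrite (eq_bigr (fun=> 3)) => [|a a_in].
  by rewrite sum_nat_const QE full_card.
by rewrite sum1_card; have := cardsD1 a (quad v x); rewrite a_in QE full_card // => -[].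
Qed.
End Closed.

(** * The pairs outside the complete quadruples *)

Section Leave.
Variables (V : finType) (H : {set {set V}}).
Hypotheses (tripleH : triple_system H) (freeH : ~~ contains H confD).
Hypothesis closedH : K4_closed H.
Local Notation T := (link H).
Local Notation s v := #|stars H v|.
Let symT := @link_sym V H.
Let irrT := link_irr tripleH.
Let P4T := link_P4_free tripleH freeH.

(* The vertices joined to v by a pair outside the complete quadruples. *)
Definition leave (v : V) : {set V} := [set x | ~~ in_triangle (T v) x] :\ v.

Lemma in_triangle_self v : in_triangle (T v) v = false.
Proof.
by apply: contra_eqF (degree_self tripleH v) => /(in_triangle_degree (@symT v) (irrT v) (@P4T v))->.
Qed.

Lemma card_leaveS v : #|[set x | ~~ in_triangle (T v) x]| = #|leave v|.+1.
Proof. by rewrite (cardsD1 v) inE in_triangle_self. Qed.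

Lemma card_leave v : #|leave v| = \sum_(c in stars H v) (degree (T v) c).+1.
Proof. by apply: succn_inj; rewrite -card_leaveS card_nontriangle. Qed.

(** Closedness is essential: in K_4 minus a triple the link of the apex has a triangle, while in the
    links of the other vertices the component is a path. *)
Lemma in_triangle_sym v x : in_triangle (T v) x = in_triangle (T x) v.
Proof.
suff tri a b : in_triangle (T a) b -> in_triangle (T b) a by apply/idP/idP; apply: tri.
case/(in_triangle_full closedH)=> y [z]; rewrite full_swap.
by case/(full_quad tripleH freeH).
Qed.

Lemma leave_sym v x : (x \in leave v) = (v \in leave x).
Proof. by rewrite !inE in_triangle_sym eq_sym. Qed.

Lemma leave_self v : v \notin leave v.
Proof. by rewrite !inE eqxx. Qed.

Lemma sum_leave : \sum_v #|leave v| = #|V| * (#|V| - 1) %[mod 12].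
Proof.
have /dvdnP[k E] := card_in_triangle_dvd12 tripleH freeH closedH.
have : \sum_v (#|[set x | in_triangle (T v) x]| + #|leave v|.+1) = #|V| * #|V|.
  rewrite -sum_nat_const; apply: eq_bigr => v _; rewrite -card_leaveS -(cardsC [set x | in_triangle (T v) x]).
  by congr (_ + _); apply: eq_card => x; rewrite !inE.
have sum1V : \sum_(v : V) 1 = #|V| by rewrite sum1_card.
rewrite big_split E /=; under eq_bigr => v _ do rewrite -addn1.
rewrite big_split /= sum1V mulnBr muln1 => <-.
by rewrite addnA addnK modnMDl.
Qed.

Lemma stars_leave v : (0 < #|leave v|) = (0 < s v).
Proof.
rewrite card_leave; apply/idP/idP => [|/card_gt0P[c cs]]; last by rewrite (bigD1 c).
by apply: contraTT; rewrite -!eqn0Ngt cards_eq0 => /eqP->; rewrite big_set0.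
Qed.

Lemma leave_hub v c : c \in stars H v -> c \in leave v.
Proof. by rewrite !inE => /andP[-> /andP[]]. Qed.

Lemma leave_leaf v c x : c \in stars H v -> T v c x -> x \in leave v.
Proof.
rewrite !inE => /andP[cv /andP[_ ntc]] vcx; have [_ vx _] := link_neq tripleH vcx.
rewrite eq_sym vx /=; apply: contra ntc; apply: (in_triangle_adj (@symT v) (irrT v) (@P4T v)).
by rewrite symT.
Qed.

Hypothesis V3 : #|V| %% 3 = 1.

Lemma card_leave_mod3 v : #|leave v| %% 3 = 0.
Proof. have := card_nontriangle_mod3 tripleH freeH v; rewrite card_leaveS; lia. Qed.

Lemma one_star v : s v = 1 ->
  exists c, [/\ c \in stars H v, #|leave v| = (degree (T v) c).+1
              & leave v = c |: [set x | T v c x]].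
Proof.
move=> /eqP/cards1P[c sE]; exists c; have cs : c \in stars H v by rewrite sE inE.
have cardE : #|leave v| = (degree (T v) c).+1 by rewrite card_leave sE big_set1.
split=> //; apply/esym/eqP; rewrite eqEcard cardE cardsU1 inE irrT leqnn andbT.
apply/subsetP=> x /setU1P[->|]; first exact: leave_hub.
by rewrite in_set => /(leave_leaf cs).
Qed.

Lemma star_swap v c : c \in stars H v -> 1 < degree (T v) c -> v \in stars H c.
Proof.
rewrite !inE => /andP[cv hc] dc; rewrite eq_sym cv /=.
apply: (degree2_hub (@symT c) (irrT c) (@P4T c)); first by rewrite codegreeC.
by rewrite in_triangle_sym; case/andP: hc.
Qed.

(** In the link of p the pair v c is an isolated edge, which contributes 2 to the leave of p. The
    size of the leave is a multiple of 3, so another star is present. *)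
Lemma page_stars v c p :
  c \in stars H v -> 1 < degree (T v) c -> T v c p -> 1 < s p.
Proof.
move=> cs dc vcp; have := cs; rewrite !inE => /andP[cv hc].
have := star_swap cs dc; rewrite !inE => /andP[_ hv].
have [d hd d1] := leaf_edge tripleH freeH hc hv vcp.
have dp : d \in stars H p.
  by rewrite !inE hd andbT; apply: contra_eq_neq d1 => ->; rewrite degree_self.
rewrite ltn_neqAle eq_sym; apply/andP; split; last by apply/card_gt0P; exists d.
apply/eqP=> s1; have [d' [_ hd' ud' nt]] := star_unique tripleH freeH s1.
have dd' : d = d' by apply: ud' => //; move: dp; rewrite !inE => /andP[].
have := card_leave_mod3 p; move: nt; rewrite card_leaveS -dd' d1 => -[->].
by [].
Qed.

(* The stars of size 3 come in pairs with a common pair of leaves. *)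
Lemma twin v : s v = 1 -> #|leave v| = 3 ->
  exists c p q, [/\ leave v = [set c; p; q], v \in leave c, p \in leave c, q \in leave c
    & 1 < s p] /\ [/\ 1 < s q, p != q & #|leave c| = 3 -> s c = 1].
Proof.
move=> /one_star[c [cs cardE leaveE]] d3.
have dc : degree (T v) c = 2 by move: cardE; rewrite d3 => -[].
have /cards2P[p [q [pq pqE]]] : #|[set x | T v c x]| == 2 by apply/eqP.
have [vcp vcq] : T v c p /\ T v c q.
  by move/setP: pqE => E; have := E p; have := E q; rewrite !inE !eqxx orbT.
have vc := star_swap cs (_ : 1 < degree (T v) c); rewrite dc in vc; have {}vc := vc isT.
exists c, p, q; rewrite leaveE pqE setUA leave_sym leave_hub //; split; split=> //.
- by apply: leave_leaf vc _; rewrite -link_swap.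
- by apply: leave_leaf vc _; rewrite -link_swap.
- by apply: page_stars cs _ vcp; rewrite dc.
- by apply: page_stars cs _ vcq; rewrite dc.
rewrite card_leave (bigD1 v) //= codegreeC dc => E.
rewrite (cardsD1 v) vc; congr (_ + _); apply/eqP; rewrite cards_eq0 -subset0.
apply/subsetP=> d /setD1P[dv dc']; move: E; rewrite (bigD1 d) ?dc' //=; lia.
Qed.

(** A smaller sum would make the leave a cubic graph on six vertices, at least three of them with a
    single star. By [twin] these come in pairs joined to the same two vertices with more stars; two
    such pairs give a vertex of degree 4. *)
Lemma stars_ge12 : (#|V| * (#|V| - 1)) %% 12 = 6 -> 12 <= \sum_v s v.
Proof.
move=> n6; rewrite leqNgt; apply/negP => lt12.
(* The sum differs from n (n - 1) by a multiple of 3, hence is one itself. *)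
have le9 : \sum_v s v <= 9 by have := sum_stars tripleH freeH; lia.
have sumd := sum_leave; rewrite n6 in sumd.
pose S := [set v | 0 < s v].
have sumS (B : {set V}) : \sum_(x in B) s x <= \sum_x s x by rewrite [leqRHS](bigID (mem B)) leq_addr.
have leaveS v : leave v \subset S.
  by apply/subsetP=> x xv; rewrite inE -stars_leave; apply/card_gt0P; exists v; rewrite -leave_sym.
have cardS : #|S| <= 9.
  apply: leq_trans le9; apply: leq_trans (sumS S).
  by rewrite -sum1_card; apply: leq_sum => v; rewrite inE.
have ltS v : v \in S -> #|leave v| < #|S|.
  move=> vS; rewrite (cardsD1 v S) vS ltnS; apply: subset_leq_card.
  by apply/subsetD1P; split; rewrite ?leave_self.
have ge3 v : v \in S -> 3 <= #|leave v|.
  by rewrite inE -stars_leave; have := card_leave_mod3 v; lia.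
(* With two stars or more, the leave has fewer than 9 vertices, so at most 6. A single star with
   more than two leaves has at least five, each with two stars by [page_stars]: already too many. *)
have le3s v : #|leave v| <= 3 * s v.
  have [|] := posnP (s v); first by move=> s0; have := stars_leave v; rewrite s0; lia.
  move=> s_gt0; have vS : v \in S by rewrite inE.
  have [s2|] := ltnP 1 (s v); first by have := ltS v vS; have := card_leave_mod3 v; lia.
  move=> s1'; have s1 : s v = 1 by apply/eqP; rewrite eqn_leq s1' s_gt0.
  have [c [cs cardE _]] := one_star s1; rewrite leqNgt s1; apply/negP => d4.
  have d5 : 5 <= degree (T v) c by have := card_leave_mod3 v; lia.
  have : \sum_(x in v |: [set x | T v c x]) s x <= 9 by apply: leq_trans (sumS _) le9.
  rewrite big_setU1 /=; last by rewrite inE link_sym link_self.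
  have : \sum_(x in [set x | T v c x]) 2 <= \sum_(x in [set x | T v c x]) s x.
    by apply: leq_sum => x; rewrite inE; apply: page_stars => //; lia.
  by rewrite sum_nat_const -/(degree (T v) c); lia.
have sumSd : \sum_v #|leave v| = \sum_(v in S) #|leave v|.
  rewrite [LHS](bigID (mem S)) /= [X in _ + X]big1 ?addn0 // => v.
  by rewrite inE -stars_leave -eqn0Ngt => /eqP.
have le27 : \sum_v #|leave v| <= 27.
  by apply: leq_trans (leq_sum _ (fun v _ => le3s v)) _; rewrite -big_distrr /= -[27]/(3 * 9) leq_mul2l.
have ge3S : 3 * #|S| <= \sum_v #|leave v|.
  by rewrite sumSd mulnC -sum_nat_const; apply: leq_sum.
have [S0|[v0 v0S]] := set_0Vmem S; first by move: sumd; rewrite sumSd S0 big_set0.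
have S4 : 4 <= #|S| by have := ltS v0 v0S; have := ge3 v0 v0S; lia.
(* The residue 6 modulo 12 leaves 6 and 18 up to 27, and 3 |S| >= 12 rules out 6. *)
have sum18 : \sum_v #|leave v| = 18 by move: sumd ge3S le27; move: (\sum_v _) => D; lia.
have d3 v : v \in S -> #|leave v| = 3.
  by move=> vS; have := ltS v vS; have := ge3 v vS; have := card_leave_mod3 v; lia.
have S6 : #|S| = 6.
  move: sum18; rewrite sumSd (eq_bigr (fun=> 3)) => [|v /d3 //].
  by rewrite sum_nat_const; lia.
pose A := [set v | s v == 1]; pose B := [set v | 1 < s v].
have ABS : #|A| + #|B| = 6.
  rewrite -S6 -cardsUI; have -> : A :&: B = set0 by apply/setP=> v; rewrite !inE; lia.
  by rewrite cards0 addn0; apply: eq_card => v; rewrite !inE; lia.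
(* From |A| + |B| = 6 and |A| + 2 |B| <= 9. *)
have A3 : 3 <= #|A|.
  have : \sum_(v in A) 1 + \sum_(v in B) 2 <= 9.
    apply: leq_trans le9; rewrite [leqRHS](bigID (mem A)) /=; apply: leq_add.
      by apply: leq_sum => v; rewrite inE => /eqP->.
    rewrite [leqRHS](bigID (mem B)) /=; apply: leq_trans (leq_addr _ _).
    rewrite (eq_bigl (fun v => (v \notin A) && (v \in B))) => [|v]; last by rewrite !inE; lia.
    by apply: leq_sum => v /andP[_]; rewrite inE.
  by rewrite !sum_nat_const; lia.
have AS v : v \in A -> #|leave v| = 3 by rewrite inE => /eqP sv; apply: d3; rewrite inE sv.
have [v vA] : exists v, v \in A by apply/card_gt0P; lia.
have s1 v1 : v1 \in A -> s v1 = 1 by rewrite inE => /eqP.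
have [c [p [q [[lv vc pc qc sp] [sq pq sc]]]]] := twin (s1 v vA) (AS v vA).
have inS x y : x \in leave y -> x \in S by move=> xy; apply: (subsetP (leaveS y)).
have cA : c \in A.
  by rewrite inE; apply/eqP/sc/d3/(inS _ v); rewrite lv !inE eqxx.
have BA x y : 1 < s x -> y \in A -> y != x.
  by move=> sx; apply: contraTneq => ->; rewrite inE neq_ltn sx orbT.
have cv : c != v by apply: contraTneq vc => ->; apply: leave_self.
have lc : leave c = [set v; p; q].
  apply/esym/eqP; rewrite eqEcard !subUset !sub1set vc pc qc AS //=.
  by rewrite -setUA cardsU1 cards2 !inE negb_or !(BA _ v) // pq.
have [v' v'A] : exists v', v' \in A :\ v :\ c.
  apply/card_gt0P; move: A3; rewrite (cardsD1 v) vA (cardsD1 c) in_setD1 cv cA.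
  by rewrite !add1n !ltnS.
have {v'A} [v'c v'v v'A] : [/\ v' != c, v' != v & v' \in A].
  by move: v'A; rewrite !in_setD1 => /and3P[].
have [c' [p' [q' [[lv' vc' pc' qc' sp'] [_ _ sc']]]]] := twin (s1 v' v'A) (AS v' v'A).
have v'lv : v' \notin leave v by rewrite lv !inE !negb_or v'c !BA.
have v'lc : v' \notin leave c by rewrite lc !inE !negb_or v'v !BA.
have c'A : c' \in A.
  by rewrite inE; apply/eqP/sc'/d3/(inS _ v'); rewrite lv' !inE eqxx.
have c'v : c' != v by apply: contraNneq v'lv => <-.
have c'c : c' != c by apply: contraNneq v'lc => <-.
have c'v' : c' != v' by apply: contraTneq vc' => ->; apply: leave_self.
have four (X : {set V}) : v \in X -> c \in X -> v' \in X -> c' \in X -> 4 <= #|X|.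
  move=> vX cX v'X c'X; have u4 : uniq [:: v; c; v'; c'].
    by rewrite /= !inE !negb_or !(eq_sym v) !(eq_sym c v') (eq_sym c c') cv v'v c'v v'c c'c eq_sym c'v'.
  rewrite -[4]/(size [:: v; c; v'; c']) -(card_uniqP u4); apply: subset_leq_card.
  by apply/subsetP=> x; rewrite !inE => /or4P[]/eqP->.
(* Two disjoint twin pairs put four vertices in [A], so nothing but p and q is left for [B]. *)
have BE : [set p; q] = B.
  apply/eqP; rewrite eqEcard subUset !sub1set !inE sp sq cards2 pq /=.
  by rewrite -(leq_add2l #|A|) ABS -[6]/(4 + 2) leq_add2r; apply: four.
have p'S : p' \in S by apply: (inS _ v'); rewrite lv' !inE eqxx orbT.
have p'B : p' \in [set p; q] by rewrite BE inE.
have p'v : p' \in leave v by rewrite lv -setUA in_setU p'B orbT.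
have p'c : p' \in leave c by rewrite lc -setUA in_setU p'B orbT.
have p'v' : p' \in leave v' by rewrite lv' !inE eqxx orbT.
by have := four (leave p'); rewrite d3 // !(leave_sym p') => /(_ p'v p'c p'v' pc').
Qed.
End Leave.

(** * The theorem *)
(* The missing triple of a component K_4 minus a triple can be added, since
   every triple with two vertices in the quadruple lies in the quadruple. *)
Lemma maximum_K4_closed (V : finType) (H : {set {set V}}) :
    triple_system H -> ~~ contains H confD ->
    (forall H' : {set {set V}}, triple_system H' -> ~~ contains H' confD -> #|H'| <= #|H|) ->
  K4_closed H.
Proof.
move=> tripleH freeH maxH v x y z vxy vxz vyz; rewrite /link.
have [vx vy xy] := link_neq tripleH vxy; have [_ vz yz] := link_neq tripleH vyz.
have [_ _ xz] := link_neq tripleH vxz.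
set e := [set x; y; z]; apply: contraT => eH; pose H' := e |: H.
have e3 : #|e| = 3 by rewrite /e setUC cardsU1 cards2 !inE negb_or !(eq_sym z) xz yz xy.
pose W := [set v; x; y; z].
have sym := @link_sym V H; have swap := link_swap H.
(* For a pair a b avoiding the apex v: a third vertex w other than v makes c, v, b, w a path in the
   link of a, whence w = c. *)
have side a b c w : link H v a b -> link H v a c -> b != c -> link H a b w -> w \in [set v; c].
  move=> vab vac bc abw; rewrite !inE; have [//|wv] := eqVneq w v.
  apply/eqP/esym; apply: (link_P4_free tripleH freeH (v := a) (y := v) (z := b)) => //.
  - by rewrite sym -swap.
  - by rewrite -swap.
  - by apply/eqP; rewrite eq_sym.
  by apply/eqP; rewrite eq_sym.
have apex a b c w : link H v a b -> link H v a c -> link H v b c -> link H v a w -> w \in [set b; c].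
  move=> vab vac vbc vaw; rewrite !inE.
  by have [->|->] := triangle_other tripleH freeH vab vac vbc vaw; rewrite eqxx ?orbT.
have [vyx vzx vzy] : [/\ link H v y x, link H v z x & link H v z y] by split; rewrite sym.
have inW a b w : a \in W -> b \in W -> a != b -> link H a b w -> w \in W.
  have sub c d : w \in [set c; d] -> c \in W -> d \in W -> w \in W.
    by move=> /set2P[]->.
  have [vW xW yW zW] : [/\ v \in W, x \in W, y \in W & z \in W] by rewrite !inE !eqxx !orbT.
  have memW u : u \in W -> [|| u == v, u == x, u == y | u == z] by rewrite !inE -!orbA.
  move=> /memW/or4P[]/eqP-> /memW/or4P[]/eqP->; rewrite ?eqxx // => _ abw.
  - exact: sub (apex _ _ _ _ vxy vxz vyz abw) yW zW.
  - exact: sub (apex _ _ _ _ vyx vyz vxz abw) xW zW.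
  - exact: sub (apex _ _ _ _ vzx vzy vxy abw) xW yW.
  - by rewrite swap in abw; exact: sub (apex _ _ _ _ vxy vxz vyz abw) yW zW.
  - exact: sub (side _ _ _ _ vxy vxz yz abw) vW zW.
  - by apply: sub (side _ _ _ _ vxz vxy _ abw) vW yW; rewrite eq_sym.
  - by rewrite swap in abw; exact: sub (apex _ _ _ _ vyx vyz vxz abw) xW zW.
  - exact: sub (side _ _ _ _ vyx vyz xz abw) vW zW.
  - by apply: sub (side _ _ _ _ vyz vyx _ abw) vW xW; rewrite eq_sym.
  - by rewrite swap in abw; exact: sub (apex _ _ _ _ vzx vzy vxy abw) xW yW.
  - exact: sub (side _ _ _ _ vzx vzy xy abw) vW yW.
  by apply: sub (side _ _ _ _ vzy vzx _ abw) vW xW; rewrite eq_sym.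
have absorb a b c : [set a; b; c] \in H' -> a != b -> a \in W -> b \in W -> c \in W.
  move=> /setU1P[E _ _ _|abc ab aW bW]; last exact: inW abc.
  have : c \in e by rewrite -E !inE eqxx !orbT.
  by rewrite !inE => /orP[/orP[]|]/eqP->; rewrite eqxx ?orbT.
suff : #|H'| <= #|H| by rewrite cardsU1 eH add1n ltnn.
apply: maxH; first by apply/forall_inP=> f /setU1P[->|fH]; [rewrite e3|exact: (forall_inP tripleH)].
apply/negP=> /containsD[p [q [r [s [t [u5 e1 e2 e3']]]]]].
have [pr qr pq _] := uniq5_neq u5.
have notin a b c : [set a; b; c] \in H' -> ~~ [&& a \in W, b \in W & c \in W] -> [set a; b; c] \in H.
  move=> /setU1P[E|//]; apply: contraNT => _.
  have sub : e \subset W by apply/subsetP=> w; rewrite !inE => /orP[/orP[]|]/eqP->; rewrite eqxx ?orbT.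
  by move: sub; rewrite -E !subUset !sub1set -andbA.
(* With its middle triple in [W], the whole configuration would lie in these four vertices.
   Otherwise none of its triples lies in [W], so the added one is not among them. *)
have allW : ~~ [&& p \in W, q \in W & r \in W].
  apply/negP=> /and3P[pW qW rW].
  have sW : s \in W by apply: absorb e2 pr pW rW.
  have tW : t \in W by apply: absorb e3' qr qW rW.
  have W4 : #|W| <= 4.
    by rewrite /W setUC cardsU1 (eqP (forall_inP tripleH _ vxy)); case: (_ \notin _).
  have : #|[:: p; q; r; s; t]| <= #|W|.
    apply: subset_leq_card; apply/subsetP=> w.
    by rewrite !in_cons in_nil orbF => /or4P[/eqP->|/eqP->|/eqP->|/orP[]/eqP->].
  by rewrite (card_uniqP u5) => /leq_trans/(_ W4).
have [H1 H2 H3] : [/\ [set p; q; r] \in H, [set p; r; s] \in H & [set q; r; t] \in H].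
  split; apply: notin => //; apply: contra allW => /and3P[aW bW _]; rewrite aW bW ?andbT /=.
    by apply: (absorb p r q) => //; rewrite setUAC.
  by apply: (absorb q r p) => //; rewrite setUC setUA.
by move/negP: freeH; apply; apply/containsD; exists p, q, r, s, t.
Qed.

Lemma not_contains_set0 (V : finType) : ~~ contains (set0 : {set {set V}}) confD.
Proof. by apply/containsD=> -[a [b [c [d [e [_]]]]]]; rewrite inE. Qed.

Lemma exists_maximum (V : finType) :
  exists H : {set {set V}}, [/\ triple_system H, ~~ contains H confD
    & forall H' : {set {set V}}, triple_system H' -> ~~ contains H' confD -> #|H'| <= #|H|].
Proof.
pose P (H : {set {set V}}) := triple_system H && ~~ contains H confD.
have P0 : P set0 by rewrite /P not_contains_set0 andbT; apply/forall_inP=> e; rewrite inE.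
case: (arg_maxnP (fun H : {set {set V}} => #|H|) P0) => H /andP[tH fH] maxH.
by exists H; split=> // H' tH' fH'; apply: maxH; rewrite /P tH'.
Qed.

(* If every link has a single star, and it is a single edge, then every
   vertex lies in (n - 3)/3 complete quadruples. *)
Lemma not_one_star_B_free (V : finType) (H : {set {set V}}) :
    triple_system H -> ~~ contains H confD -> ~~ contains H confB ->
    #|V| %% 12 \in [:: 6; 9] ->
  ~ (forall v, #|stars H v| = 1).
Proof.
move=> tripleH freeH freeB V12 s1.
have V3 : #|V| %% 3 = 0 by move: V12; rewrite !inE; lia.
have star1 := nonisolated_star tripleH freeH s1 V3 freeB.
(* In the link of x the vertex v has degree at least 2. Outside a triangle it would be a hub with
   more than one leaf, against [star1]. *)
have closedH : K4_closed H.
  move=> v x y z vxy vxz vyz; have [vx _ _] := link_neq tripleH vxy.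
  have [_ _ yz] := link_neq tripleH vyz.
  have symx := @link_sym V H x; have irrx := @link_irr _ _ tripleH x.
  have P4x := @link_P4_free _ _ tripleH freeH x.
  have [xvy xvz] : link H x v y /\ link H x v z by split; rewrite -link_swap.
  have d2 := degree_gt1 xvy xvz yz.
  have [/in_triangleP[a [b [xva xvb xab]]]|nt] := boolP (in_triangle (link H x) v).
    have := triangle_nbr symx irrx P4x xva xvb xab xvy.
    have := triangle_nbr symx irrx P4x xva xvb xab xvz.
    by move=> [] zE [] yE; move: yz; rewrite zE yE ?eqxx // symx.
  by have := star1 _ _ (degree2_hub symx irrx P4x d2 nt) vx; move: d2; case: degree => [|[]].
have /dvdnP[k E] := card_in_triangle_dvd12 tripleH freeH closedH.
(* The three vertices are v and the ends of its single edge. Hence 12 divides n (n - 3), which is 6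
   modulo 12 for n = 6, 9. *)
have : \sum_v (#|[set x | in_triangle (link H v) x]| + 3) = #|V| * #|V|.
  rewrite -sum_nat_const; apply: eq_bigr => v _.
  have [c [cv hc _ nt]] := star_unique tripleH freeH (s1 v).
  rewrite (star1 _ _ hc cv) in nt.
  rewrite -(cardsC [set x | in_triangle (link H v) x]) -nt.
  by congr (_ + _); apply: eq_card => x; rewrite !inE.
have sum3 : \sum_(v : V) 3 = #|V| * 3 by rewrite sum_nat_const.
rewrite big_split E /= sum3; move: V12; rewrite !inE.
move: #|V| => n n12 nE; have : n * n %% 12 = (n %% 12) * (n %% 12) %% 12 by rewrite modnMml modnMmr.
by case/orP: n12 => /eqP n12; rewrite n12 -nE; lia.
Qed.

Lemma card_le_valueD n (H : {set {set 'I_n}}) :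
  0 < n -> triple_system H -> ~~ contains H confD -> #|H| <= valueD n.
Proof.
move=> n_gt0 tripleH freeH; rewrite /valueD; have cn := card_ord n.
have U1 := upper_general tripleH freeH; have U3 := upper_mod3 tripleH freeH.
have U3' := upper_mod3_strict tripleH freeH.
have odd3 := not_one_star_odd tripleH freeH.
rewrite !cn in U1 U3 U3' odd3.
case: ifP => [_|n14]; first by rewrite leq_divRL // mulnC.
case: ifP => [n710|n710].
  (* [H] itself may have components K_4 minus a triple; a maximum system has none, and its size
     bounds that of [H]. *)
  have [M [tripleM freeM maxM]] := exists_maximum 'I_n.
  apply: leq_trans (maxM H tripleH freeH) _.
  have closedM := maximum_K4_closed tripleM freeM maxM.
  have := stars_ge12 tripleM freeM closedM; have := sum_stars tripleM freeM; rewrite !cn.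
  have n3 : n %% 3 = 1 by move: n710; rewrite !inE; lia.
  have n6 : n * (n - 1) %% 12 = 6.
    rewrite -modnMml -modnMmr.
    move: n710; rewrite !inE => /orP[]/eqP n12; rewrite n12.
      by have -> : (n - 1) %% 12 = 6 by lia.
    by have -> : (n - 1) %% 12 = 9 by lia.
  by move=> E /(_ n3 n6); clear -E; move: (n * (n - 1)) E => m; lia.
have n3 : n %% 3 != 1 by move: n14 n710; rewrite !inE; lia.
case: ifP => [_|n0238]; first by rewrite leq_divRL // mulnC; exact: U3.
case: ifP => [n5|_]; last by rewrite leq_divRL // mulnC; exact: U3.
have lt : 3 * #|H| < n * (n - 2).
  by apply: U3' n3 _; apply: odd3; move: n5; rewrite !inE; lia.
have n2 : n %% 3 = 2 by move: n5; rewrite !inE; lia.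
have n20 : (n - 2) %% 3 = 0 by lia.
have : n * (n - 2) %% 3 = 0 by rewrite -modnMmr n20 muln0.
by clear -lt; move: (n * (n - 2)) lt => m; lia.
Qed.

Lemma upper_D n : 0 < n -> ex_num n [:: confD] <= valueD n.
Proof.
move=> n_gt0; apply/bigmax_leqP => H /andP[tripleH]; rewrite /avoids /= andbT.
exact: card_le_valueD.
Qed.

Lemma card_lt_mod_6_9 n (H : {set {set 'I_n}}) :
    n %% 12 \in [:: 6; 9] -> triple_system H -> ~~ contains H confD -> ~~ contains H confB ->
  #|H| <= n * (n - 2) %/ 3 - 1.
Proof.
move=> n69 tripleH freeH freeB; have n3 : n %% 3 = 0 by move: n69; rewrite !inE; lia.
have := not_one_star_B_free tripleH freeH freeB; have := upper_mod3_strict tripleH freeH.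
rewrite !card_ord n3 => /(_ isT) U /(_ n69)/U lt.
have : n * (n - 2) %% 3 = 0 by rewrite -modnMml n3.
by clear -lt; move: (n * (n - 2)) lt => m; lia.
Qed.

Lemma upper_BD n : 0 < n -> ex_num n [:: confB; confD] <= valueBD n.
Proof.
move=> n_gt0; have le_D := leq_trans (ex_num_BD_le_D n) (upper_D n_gt0).
have [n69|n69] := boolP (n %% 12 \in [:: 6; 9]); last first.
  suff <- : valueD n = valueBD n by [].
  rewrite /valueD /valueBD; do 4 (case: ifP => [//|+]); move: n69; rewrite !inE; lia.
have -> : valueBD n = n * (n - 2) %/ 3 - 1.
  by move: n69; rewrite /valueBD !inE => /orP[]/eqP->.
apply/bigmax_leqP => H /andP[tripleH]; rewrite /avoids /= andbT => /andP[freeB freeH].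
exact: card_lt_mod_6_9.
Qed.

Theorem theorem3 :
  (exists n0 : nat, forall n : nat, 0 < n -> n0 <= n ->
     ex_num n [:: confD] = valueD n /\ ex_num n [:: confB; confD] = valueBD n)
  /\ (forall n : nat, 0 < n ->
        ex_num n [:: confD] <= valueD n /\ ex_num n [:: confB; confD] <= valueBD n)
  /\ (forall n : nat, 0 < n -> n %% 12 \in [:: 0; 1; 3; 4] ->
        ex_num n [:: confD] = valueD n /\ ex_num n [:: confB; confD] = valueBD n).
Proof.
have both n : 0 < n -> valueD n = valueBD n -> valueBD n <= ex_num n [:: confB; confD] ->
    ex_num n [:: confD] = valueD n /\ ex_num n [:: confB; confD] = valueBD n.
  move=> n_gt0 vE lo; have loD := leq_trans lo (ex_num_BD_le_D n).
  by split; apply/eqP; rewrite eqn_leq ?upper_D ?upper_BD // vE.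
have small n : 0 < n -> n %% 12 \in [:: 0; 1; 3; 4] ->
    ex_num n [:: confD] = valueD n /\ ex_num n [:: confB; confD] = valueBD n.
  move=> n_gt0 n12; apply: both => //; move: n12 (lower_1_4 n_gt0) (@lower_0_3 n);
    rewrite /valueD /valueBD !inE => /or4P[]/eqP-> //= lo1 lo2; by [apply: lo1|apply: lo2].
split; last by split=> // n n_gt0; split; [exact: upper_D|exact: upper_BD].
have [N1 L1] := lower_2_8; have [N2 L2] := lower_5_11; have [N3 L3] := lower_6_9_BD.
have [N4 L4] := lower_6_9_D; have [N5 L5] := lower_7_10.
exists (N1 + N2 + N3 + N4 + N5) => n n_gt0 nN.
have [le1 le2 le3 le4 le5] : [/\ N1 <= n, N2 <= n, N3 <= n, N4 <= n & N5 <= n] by split; lia.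
move: (L1 n le1) (L2 n le2) (L3 n le3) (L4 n le4) (L5 n le5) => {}L1 {}L2 {}L3 {}L4 {}L5.
have leD := upper_D n_gt0; have leBD := upper_BD n_gt0.
have [n69|n69] := boolP (n %% 12 \in [:: 6; 9]).
  have [vD vBD] : valueD n = n * (n - 2) %/ 3 /\ valueBD n = n * (n - 2) %/ 3 - 1.
    by move: n69; rewrite /valueD /valueBD !inE => /orP[]/eqP->.
  split; apply/eqP; rewrite eqn_leq ?leD ?leBD ?vD ?vBD; first exact: L4.
  exact: L3.
have [/(small n n_gt0)//|n0134] := boolP (n %% 12 \in [:: 0; 1; 3; 4]).
apply: both => //.
  by rewrite /valueD /valueBD; do 4 (case: ifP => [//|+]); move: n69; rewrite !inE; lia.
have n12 := ltn_pmod n (isT : 0 < 12).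
move: n12 n69 n0134 L1 L2 L5; rewrite /valueBD.
by case: (n %% 12) => [|[|[|[|[|[|[|[|[|[|[|[|]]]]]]]]]]]] //= _ _ _ L1 L2 L5;
  [exact: L1|exact: L2|exact: L5|exact: L1|exact: L5|exact: L2].
Qed.
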